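(* There is an absolute constant $c>0$ such that every finite simple graph $G$ on $n\ge 2$ vertices with degree sequence $d_1,\dots,d_n$ satisfies $\mathrm{cr}(G)\le c\log n\,\big(\mathrm{pcr}(G)+\sum_{k=1}^n d_k^2\big)$.
   Context: Logarithms are base 2. A drawing of a graph maps vertices to distinct points of the plane and edges to simple continuous curves joining their endpoints and passing through no other vertex point; any two curves share finitely many points, no two are tangent, no three pass through a common point. $\mathrm{cr}(G)$ is the minimum number of crossing points over all drawings of $G$; $\mathrm{pcr}(G)$ is the minimum, over all drawings, of the number of unordered pairs of edges that cross. *)

(* Defs.v *)
(* The plane is R * R for an abstract R : realType. *)
From mathcomp Require Import all_boot all_order all_algebra.
From mathcomp Require Import finmap.
From mathcomp Require Import all_classical all_reals all_analysis.

Set Implicit Arguments.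
Unset Strict Implicit.
Unset Printing Implicit Defensive.

Import Order.TTheory GRing.Theory Num.Theory.
Import numFieldNormedType.Exports.

Local Open Scope classical_set_scope.
Local Open Scope ring_scope.

(* Minimum of a set of natural numbers; the value 0 on the empty set is junk. *)
Definition natmin (A : set nat) : nat :=
  xget 0%N [set k | A k /\ forall j, A j -> (k <= j)%N].

Lemma natminP (A : set nat) : A !=set0 ->
  A (natmin A) /\ forall j, A j -> (natmin A <= j)%N.
Proof.
case=> j Aj; rewrite /natmin; case: xgetP => [k -> //|none].
have exA : exists n, `[< A n >] by exists j; apply/asboolP.
case: (ex_minnP exA) => k /asboolP Ak kmin.
by have [] := none k; split=> // i Ai; apply/kmin/asboolP.
Qed.

Definition log2 {R : realType} (x : R) : R := ln x / ln 2.

(* A simple graph on V is a symmetric irreflexive relation e; an edge is the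
   two-element set of its endpoints. *)
Definition edges (V : finType) (e : rel V) : {set {set V}} :=
  [set f : {set V} | [exists x, exists y, e x y && (f == [set x; y])]]%SET.

Definition degree (V : finType) (e : rel V) (v : V) : nat :=
  #|[set w | e v w]%SET|.

Section Curves.
Variable R : realType.
Implicit Types (a b : R -> R * R) (p : R * R).

(* A curve is a function on R of which only the restriction to [0, 1] matters. *)
Definition arc a : set (R * R) := a @` `[0, 1].
Definition arc_interior a : set (R * R) := a @` `]0, 1[.

(* Near p, the two arcs look like the two coordinate axes near the origin, up to
   a homeomorphism h (with inverse g) from an open neighbourhood U of p onto an
   open neighbourhood W of the origin. *)
Definition cross_at a b p : Prop :=
  exists (U W : set (R * R)) (h g : R * R -> R * R),
    [/\ [/\ open U, U p, open W & h p = (0, 0)],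
        [/\ {within U, continuous h} & {within W, continuous g}],
        [/\ forall q, U q -> W (h q), forall q, W q -> U (g q),
            forall q, U q -> g (h q) = q & forall q, W q -> h (g q) = q],
        (forall q, U q -> (arc a q <-> (h q).2 = 0)) &
        (forall q, U q -> (arc b q <-> (h q).1 = 0))].

(* For continuous curves without derivatives, tangency (touching) at a common
   interior point means that the curves do not cross there. *)
Definition tangent_at a b p : Prop :=
  [/\ arc_interior a p, arc_interior b p & ~ cross_at a b p].

End Curves.

(* The curve of an edge may be parametrised from either endpoint.  Curves of
   non-edges are arbitrary and play no role.  Several curves may end at a common
   vertex; "passing through a point" refers to the interior of a curve. *)
Record drawing (R : realType) (V : finType) (e : rel V) := Drawing {
  pos : V -> R * R;
  curve : {set V} -> R -> R * R;
  pos_inj : injective pos;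
  curve_continuous : forall f, f \in edges e ->
    {within `[0, 1]%classic, continuous (curve f)};
  curve_simple : forall f, f \in edges e ->
    forall s t : R, `[0, 1]%classic s -> `[0, 1]%classic t ->
      curve f s = curve f t -> s = t;
  curve_ends : forall f, f \in edges e ->
    [set curve f 0; curve f 1] = [set pos v | v in [set` f]];
  curve_avoids : forall f, f \in edges e ->
    forall v, arc (curve f) (pos v) -> v \in f;
  curves_finite : forall f g, f \in edges e -> g \in edges e -> f != g ->
    finite_set (arc (curve f) `&` arc (curve g));
  curves_not_tangent : forall f g, f \in edges e -> g \in edges e -> f != g ->
    forall p, ~ tangent_at (curve f) (curve g) p;
  curves_no_triple : forall f g k,
    f \in edges e -> g \in edges e -> k \in edges e ->
    f != g -> g != k -> f != k ->
    forall p, ~ [/\ arc_interior (curve f) p, arc_interior (curve g) p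
                  & arc_interior (curve k) p]
}.

Section CrossingNumbers.
Variables (R : realType) (V : finType) (e : rel V).
Implicit Type D : drawing R e.

Definition crossing_points D : set (R * R) :=
  [set p | exists f g : {set V}, [/\ f \in edges e, g \in edges e, f != g &
     cross_at (curve D f) (curve D g) p]].

Definition crossing_pairs D : {set {set {set V}}} :=
  [set F : {set {set V}} | `[< exists f g : {set V},
     [/\ f \in edges e, g \in edges e, f != g, F = [set f; g]%SET &
         exists p, cross_at (curve D f) (curve D g) p] >]]%SET.

Lemma finite_crossing_points D : finite_set (crossing_points D).
Proof.
pose E : set ({set V} * {set V}) :=
  [set u | [/\ u.1 \in edges e, u.2 \in edges e & u.1 != u.2]].
apply: (@sub_finite_set _ _
  (\bigcup_(u in E) (arc (curve D u.1) `&` arc (curve D u.2)))).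
  move=> p [f [g [fE gE fg]]] [U [W [h [k [[_ Up _ hp] _ _ hf hg]]]]].
  exists (f, g) => //=; split; first by apply/(hf p Up); rewrite hp.
  by apply/(hg p Up); rewrite hp.
apply: bigcup_finite; first exact: finite_finset.
by move=> u [uE1 uE2 u12]; apply: curves_finite.
Qed.

Definition cr : nat :=
  natmin [set #|` fset_set (crossing_points D)| | D in [set: drawing R e]].

Definition pcr : nat :=
  natmin [set #|crossing_pairs D| | D in [set: drawing R e]].

End CrossingNumbers.
Arguments cr : clear implicits.
Arguments pcr : clear implicits.

(* Main.v *)
(** Fix a drawing with the least number of crossing pairs and call two edges entangled if they
    cross in it or share a vertex.  The number [W] of entangled ordered pairs is at most
    [2 pcr + \sum d_k ^ 2].  Entanglement is the intersection pattern of plane curves, so nine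
    connected families of edges joining three edges to three edges always contain two entangled
    members in families with distinct ends on both sides: for polygons the number of crossings of
    independent paths of a [K33] is odd, because it is odd for one position and does not change
    when one vertex and its three paths are replaced, and curves are approximated by polygons.
    This excludes havens for the metric in which an edge is as long as it is congested in an
    optimal path system, whence every nonempty set [F] of edges has a separator [Z] with
    [#|Z| ^ 2 * w F <= C * w U ^ 2] for both sides [U] of the cut, where [w] counts entangled
    pairs.  Placing the vertices of the two sides one after the other, recursively, gives a linear
    order of the vertices with [O(W log W)] pairs of interleaving edges.  With the vertices put in
    this order on a parabola, in a position where no three disjoint chords are concurrent, and
    straight edges, every crossing point is a vertex or comes from an interleaving pair. *)

From mathcomp Require Import all_boot all_order all_algebra zify ring lra.
From mathcomp Require Import boolp.

Set Implicit Arguments.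
Unset Strict Implicit.
Unset Printing Implicit Defensive.

(** * Weighted depth and havens *)

Section Depth.
Variables (T : finType) (A : rel T) (om : T -> nat) (cap : nat).
Implicit Types (M b : {set T}) (x y z : T) (s : seq T) (l : nat).

(** A haven is refuted by a [K33] whose nine families violate the crossing property. Three connected
    hubs are grown in turn, each maximal subject to the ball of its radius being light; then most of
    the weight lies between one and two radii away. So three places can be chosen in all three
    shells at once and, as small balls are light, far from one another. Family [(i, j)] is hub [i]
    together with a shortest path to it from place [j]. Paths from two places stay apart because the
    places do. The obstacle is to keep a path to one hub away from another hub: every hub is taken
    in a region from which the surroundings of the earlier ones are cut, with a wider margin for the
    hubs than for the paths, and the radii grow so fast that a path to an early hub cannot come near
    a later one. When some ball is heavy instead, a cut is found by sweeping the distance from its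
    centre. The cut bounds the separator by both sides for two reasons: the number of edges passing
    over a vertex then telescopes to the square root of the weight, and the crossings created by a
    cut are paid by its lighter side, which yields a single logarithm. *)

Definition touches b x := [exists y in b, A x y].

Definition wt s := \sum_(x <- s) om x.

Lemma wt_cons x s : wt (x :: s) = om x + wt s.
Proof. exact: big_cons. Qed.

Lemma wt_cat s1 s2 : wt (s1 ++ s2) = wt s1 + wt s2.
Proof. exact: big_cat. Qed.

(* [cap] stands for infinity. *)
Definition reach M b x l : Prop :=
  [\/ x \in b, cap <= l |
      exists s, [/\ all (mem M) (x :: s), path A x s, touches b (last x s) &
                    wt (x :: s) <= l]].

Lemma ex_reach M b x : exists l, `[< reach M b x l >].
Proof. by exists cap; apply/asboolP/Or32. Qed.

(** A path pays for all its vertices, the first included, but not for the vertex of [b] that it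
    touches. So [x] occupies the levels [t] with [depth - om x < t <= depth]. *)
Definition depth M b x := ex_minn (ex_reach M b x).

Lemma depth_le M b x l : reach M b x l -> depth M b x <= l.
Proof. by rewrite /depth => rl; case: ex_minnP => k _; apply; apply/asboolP. Qed.

Lemma depth_reach M b x : reach M b x (depth M b x).
Proof. by rewrite /depth; case: ex_minnP => k /asboolP. Qed.

Lemma depth_cap M b x : depth M b x <= cap.
Proof. exact/depth_le/Or32. Qed.

Lemma depth0 M b x : x \in b -> depth M b x = 0.
Proof. by move=> xb; apply/eqP; rewrite -leqn0; apply/depth_le/Or31. Qed.

Lemma depth_seq M b x s : all (mem M) (x :: s) -> path A x s ->
  touches b (last x s) -> depth M b x <= wt (x :: s).
Proof. by move=> *; apply/depth_le/Or33; exists s. Qed.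

Lemma depth_lip M b x y : x \in M -> y \in M -> A x y ->
  depth M b x <= om x + depth M b y.
Proof.
move=> xM yM xy; case: (depth_reach M b y) => [yb|cy|[s [sM ps ls ws]]].
- rewrite (@leq_trans (wt [:: x])) //; last by rewrite wt_cons /wt big_nil; lia.
  by apply: depth_seq => //=; rewrite ?xM //; apply/existsP; exists y; rewrite yb.
- by rewrite (leq_trans (depth_cap _ _ _)) // (leq_trans cy) ?leq_addl.
- rewrite (@leq_trans (wt (x :: y :: s))) //; last by rewrite wt_cons leq_add2l.
  by apply: depth_seq; rewrite //= ?xM ?xy.
Qed.

Lemma depth_path M b s1 x s v s2 : x :: s = s1 ++ v :: s2 ->
  all (mem M) (x :: s) -> path A x s ->
  depth M b x <= wt s1 + depth M b v.
Proof.
elim: s1 x s => [|y s1 IH] x s /=; first by case=> -> _ _ _; rewrite leq_addl.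
case=> <-{y} es /andP[xM sM] ps; case: s es sM ps => [|y s] es; first by case: s1 {IH} es.
move=> /= /andP[yM sM] /andP[xy ps].
apply: leq_trans (depth_lip _ xM yM xy) _; rewrite wt_cons -addnA leq_add2l.
by apply: IH ps => //=; apply/andP.
Qed.

(** The rest of the path bounds the depth of [v] from above; by [depth_path] a smaller depth would
    make the whole path too heavy. *)
Lemma depth_geodesic M b x : x \notin b -> depth M b x < cap ->
  exists s, [/\ all (mem M) (x :: s), path A x s, touches b (last x s) &
    forall s1 v s2, x :: s = s1 ++ v :: s2 -> depth M b v = wt (v :: s2)].
Proof.
move=> xb dc; case: (depth_reach M b x) => [|c|[s [sM ps ls ws]]].
- by rewrite (negbTE xb).
- by move: (leq_trans dc c); rewrite ltnn.
exists s; split=> // s1 v s2 e; apply/eqP; rewrite eqn_leq; apply/andP; split.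
  have sM2 : all (mem M) (v :: s2) by move: sM; rewrite e all_cat => /andP[].
  case: s1 e => [|y s1] /=; first by case=> <- <-; apply: depth_seq.
  case=> _ es; apply: depth_seq => //.
    by move: ps; rewrite es cat_path /= => /andP[_ /andP[]].
  by move: ls; rewrite es last_cat.
rewrite -(leq_add2l (wt s1)) -wt_cat -e; apply: leq_trans ws _.
exact: depth_path e sM ps.
Qed.

Lemma depth_subset M M' b x : M \subset M' -> depth M' b x <= depth M b x.
Proof.
move=> MM'; case: (depth_reach M b x) => [xb|c|[s [sM ps ls ws]]].
- by rewrite depth0.
- exact: leq_trans (depth_cap _ _ _) c.
- apply: leq_trans ws; apply: depth_seq => //.
  by apply: sub_all sM => z; apply: (subsetP MM').
Qed.

Lemma depth_setU1 M b y x l : l < cap -> depth M (y |: b) x <= l ->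
  (depth M b x <= l) || (depth M [set y] x <= l).
Proof.
move=> lc dl; case: (depth_reach M (y |: b) x) => [|c|[s [sM ps ls ws]]].
- rewrite in_setU1 => /orP[/eqP-> | xb]; last by rewrite depth0.
  by rewrite [depth M [set y] y]depth0 ?inE // orbT.
- by move: lc; rewrite ltnNge (leq_trans c dl).
have wl := leq_trans ws dl.
case/existsP: ls => z /andP[]; rewrite in_setU1 => /orP[/eqP->|zb] lz.
  apply/orP; right; apply: leq_trans wl; apply: depth_seq => //.
  by apply/existsP; exists y; rewrite inE eqxx.
apply/orP; left; apply: leq_trans wl; apply: depth_seq => //.
by apply/existsP; exists z; rewrite zb.
Qed.

End Depth.

(** * Thin spheres by averaging over levels *)

Section Sphere.
Variables (T : finType) (om d : T -> nat).

(** The vertices occupying level [t]. A step from [x] lowers the depth by at most [om x], so these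
    vertices separate depth below [t] from what lies beyond. *)
Definition sphere (M : {set T}) t := [set x in M | t <= d x < t + om x].

Lemma sum_sphere (M : {set T}) lo hi :
  \sum_(lo <= t < hi) #|sphere M t| <= \sum_(x in M) om x.
Proof.
rewrite (eq_bigr (fun t => \sum_(x in M) (t <= d x < t + om x))); last first.
  move=> t _; rewrite -sum1_card big_mkcond [RHS]big_mkcond; apply: eq_bigr => x _.
  by rewrite !inE; case: (x \in M) => //=; case: ifP.
rewrite exchange_big; apply: leq_sum => x _ /=.
have cnt : \sum_((d x).+1 - om x <= t < (d x).+1) 1 <= om x.
  by rewrite sum_nat_const_nat muln1; lia.
apply: leq_trans cnt.
rewrite sum1_size (eq_bigr (fun t => if t <= d x < t + om x then 1 else 0)) => [|t _]; last by case: ifP.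
rewrite -big_mkcond sum1_count -size_filter.
apply: uniq_leq_size; first by rewrite filter_uniq ?iota_uniq.
by move=> t; rewrite mem_filter !mem_index_iota; lia.
Qed.

Lemma exists_small_sphere (M : {set T}) lo h : 0 < h ->
  exists t, [/\ lo < t, t <= lo + h & #|sphere M t| * h <= \sum_(x in M) om x].
Proof.
move=> h0; set S := \sum_(x in M) om x; apply: contrapT => none.
have := sum_sphere M lo.+1 (lo + h).+1; rewrite -/S.
apply/negP; rewrite -ltnNge -(ltn_pmul2r h0) [ltnRHS]big_distrl /=.
have {none} big t : lo < t <= lo + h -> S.+1 <= #|sphere M t| * h.
  case/andP=> t1 t2; rewrite ltnNge; apply/negP => le; apply: none.
  by exists t.
apply: (@leq_trans (\sum_(lo.+1 <= t < (lo + h).+1) S.+1)).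
  by rewrite sum_nat_const_nat subSS addKn mulnC ltn_pmul2l.
by rewrite big_nat [leqRHS]big_nat; apply: leq_sum => t; rewrite ltnS; apply: big.
Qed.

End Sphere.

(** * Connectivity inside a set of vertices *)

Section Joined.
Variables (T : finType) (A : rel T).
Implicit Types (X Y : {set T}) (x y : T).

Definition inside X : rel T := [rel x y | [&& x \in X, y \in X & A x y]].

Definition joined X x y := (x \in X) && connect (inside X) x y.

Lemma joined_path X x s : all (mem X) (x :: s) -> path A x s ->
  joined X x (last x s).
Proof.
move=> /= /andP[xX sX] ps; rewrite /joined xX; apply/connectP; exists s => //.
elim: s x xX sX ps => //= y s IH x xX /andP[yX sX] /andP[xy ps].
by rewrite {1}/inside /= xX yX xy /= IH.
Qed.

Lemma joinedP X x y : reflect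
  (exists s, [/\ all (mem X) (x :: s), path A x s & y = last x s]) (joined X x y).
Proof.
apply: (iffP idP) => [/andP[xX /connectP[s ps ->]]|[s [sX ps ->]]]; last exact: joined_path.
exists s; elim: s x xX ps => [|z s IH] x xX /=; first by rewrite xX.
by case/andP=> /and3P[_ zX xz] /(IH _ zX) [/= -> -> _]; rewrite xX xz.
Qed.

Lemma joined_subset X Y x y : X \subset Y -> joined X x y -> joined Y x y.
Proof.
move=> XY /joinedP[s [sX ps ->]]; apply/joined_path => //.
by apply: sub_all sX => z; apply: (subsetP XY).
Qed.

Lemma joined_memr X x y : joined X x y -> y \in X.
Proof. by move=> /joinedP[s [/allP sX _ ->]]; apply: sX; rewrite mem_last. Qed.

Lemma joined_meml X x y : joined X x y -> x \in X. Proof. by case/andP. Qed.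

Lemma joined_refl X x : x \in X -> joined X x x.
Proof. by move=> xX; rewrite /joined xX connect0. Qed.

Lemma joined_trans X x y z : joined X x y -> joined X y z -> joined X x z.
Proof. by case/andP=> xX xy /andP[_ yz]; rewrite /joined xX (connect_trans xy). Qed.

Lemma joined_step X x y : x \in X -> y \in X -> A x y -> joined X x y.
Proof. by move=> xX yX xy; rewrite /joined xX; apply: connect1; apply/and3P. Qed.

Hypothesis Asym : symmetric A.

Lemma joined_sym X x y : joined X x y = joined X y x.
Proof.
suff H u v : joined X u v -> joined X v u by apply/idP/idP; apply: H.
move=> uv; rewrite /joined (joined_memr uv); case/andP: uv => _ uv.
rewrite sym_connect_sym // => a b.
by rewrite /inside /= Asym andbCA.
Qed.

Definition linked X := [forall x in X, forall y in X, joined X x y].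

Lemma linkedP X : reflect {in X &, forall x y, joined X x y} (linked X).
Proof.
apply: (iffP forall_inP) => [H x y xX yX|H x xX]; last by apply/forall_inP => y; apply: H.
by move/forall_inP: (H x xX); apply.
Qed.

Lemma linked1 x : linked [set x].
Proof.
by apply/linkedP => u v; rewrite !inE => /eqP-> /eqP->; apply: joined_refl; rewrite inE.
Qed.

Lemma linkedU1 X x : linked X -> touches A X x -> linked (x |: X).
Proof.
move=> /linkedP lX /existsP[y /andP[yX xy]].
have to z : z \in x |: X -> joined (x |: X) z y.
  rewrite in_setU1 => /orP[/eqP->|zX].
    by apply: joined_step; rewrite ?setU11 // setU1r.
  by apply: joined_subset (lX _ _ zX yX); apply: subsetU1.
by apply/linkedP => u v /to uy /to; rewrite joined_sym; apply: joined_trans.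
Qed.

Lemma linked_boundary X Y : linked X -> Y \subset X -> Y != set0 -> Y != X ->
  exists2 x, x \in X :\: Y & touches A Y x.
Proof.
move=> /linkedP lX YX /set0Pn[y yY] nYX.
have /set0Pn[x] : X :\: Y != set0.
  by rewrite setD_eq0; apply: contraNN nYX => XY; rewrite eqEsubset YX.
rewrite inE => /andP[xY xX].
have /joinedP[s [sX ps e]] := lX _ _ (subsetP YX _ yY) xX.
rewrite e in xY; elim: s y yY sX ps xY {e} => [|z s IH] y yY /=; first by rewrite yY.
case/and3P=> _ zX sX /andP[yz ps] lY; have [zY|zY] := boolP (z \in Y).
  by apply: (IH z); rewrite //= zX.
by exists z; [rewrite inE zY|apply/existsP; exists y; rewrite yY Asym].
Qed.

End Joined.

(** * Heavy shells around a hub in a haven *)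

Section Haven.
Variables (T : finType) (A : rel T) (om q : T -> nat) (cap rho : nat) (F : {set T}).
Hypotheses (Asym : symmetric A) (W0 : 0 < \sum_(x in F) q x).

Implicit Types (X Y Z M N K b : {set T}).

Definition vol X := \sum_(x in X) q x.

Let W := vol F.
Let Omega := \sum_(x in F) om x.

Definition light X := 20 * vol X < W.

Lemma vol_subset X Y : X \subset Y -> vol X <= vol Y.
Proof.
move=> XY; rewrite /vol [leqRHS](big_setID X) /= (setIidPr XY).
exact: leq_addr.
Qed.

Lemma light_subset X Y : X \subset Y -> light Y -> light X.
Proof. by move=> /vol_subset; rewrite /light; clear; lia. Qed.

Lemma volU X Y : vol (X :|: Y) <= vol X + vol Y.
Proof.
rewrite /vol [leqLHS](big_setID X) /= setUK leq_add2l.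
by apply: vol_subset; rewrite setDUl setDv set0U subsetDl.
Qed.

Lemma volD X : X \subset F -> W = vol X + vol (F :\: X).
Proof. by move=> XF; rewrite /W /vol (big_setID X) (setIidPr XF). Qed.

(** The unit of cost is [Omega / rho], the size of a sphere found by averaging over [rho] levels;
    [n] counts the units spent on the separator. *)
Definition region n X Z := [/\ X \subset F, Z \subset F :\: X,
  {in X & F, forall x y, A x y -> y \in X :|: Z} & #|Z| * rho <= n * Omega].

Lemma region_leq n m X Z : n <= m -> region n X Z -> region m X Z.
Proof.
by move=> nm [? ? ? c]; split=> //; apply: leq_trans c _; rewrite leq_mul2r nm orbT.
Qed.

Hypothesis haven : forall X Z, region 6 X Z -> light (X :|: Z) \/ light (F :\: X).

(** Components are added one at a time. In a haven their union is either light or heavier than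
    [19/20] of the total, so a single component makes the jump and has more than [18/20]. *)
Lemma heavy_component M Z : region 6 M Z -> ~~ light M ->
  exists K, [/\ K \subset M, linked A K, K != set0 & 18 * W < 20 * vol K].
Proof.
move=> [MF ZF bM cZ] hM.
pose C x := [set y | joined A M x y].
have CM x : C x \subset M by apply/subsetP => y; rewrite inE => /joined_memr.
pose U s := \bigcup_(x <- s) C x.
have UM s : U s \subset M.
  by rewrite /U; elim: s => [|x s IH]; rewrite ?big_nil ?sub0set // big_cons subUset CM.
have rU s : region 6 (U s) Z.
  split=> //; first exact: subset_trans (UM _) MF.
    by apply: subset_trans ZF _; apply: setDS.
  move=> x y xU yF xy; have xM := subsetP (UM s) _ xU.
  have := bM _ _ xM yF xy; rewrite !inE => /orP[yM|->]; last by rewrite orbT.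
  apply/orP; left; move: xU; rewrite /U; elim: s => [|z s IH]; rewrite ?big_nil ?inE // !big_cons !inE.
  case/orP=> [zx|/IH ->]; last by rewrite orbT.
  by rewrite (joined_trans zx) // joined_step.
have EU : U (enum M) = M.
  apply/eqP; rewrite eqEsubset UM; apply/subsetP => x xM.
  rewrite /U big_enum; apply/bigcupP; exists x => //.
  by rewrite inE joined_refl.
suff [x Cx] : exists x, 18 * W < 20 * vol (C x).
  have Cn : C x != set0 by apply: contraTneq Cx => ->; rewrite /vol big_set0; lia.
  exists (C x); split=> //.
  have /set0Pn[y yC] := Cn; have xM : x \in M by move: yC; rewrite inE; apply: joined_meml.
  have inC u s : all (mem M) (u :: s) -> path A u s -> u \in C x -> all (mem (C x)) (u :: s).
    elim: s u => [|v s IH] u /=; first by move=> _ _ ->.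
    case/and3P=> uM vM sM /andP[uv ps] uC; rewrite uC; apply: IH => //=; first by rewrite vM.
    by move: uC; rewrite !inE => /joined_trans; apply; apply: joined_step.
  have xC : x \in C x by rewrite inE joined_refl.
  have fromx u : u \in C x -> joined A (C x) x u.
    rewrite inE => /joinedP[s [sM ps ->]]; apply: joined_path => //.
    exact: inC.
  by apply/linkedP => u v /fromx xu /fromx; apply: joined_trans; rewrite joined_sym.
have : ~~ light (U (enum M)) by rewrite EU.
elim: (enum M) => [|x s IH].
  by rewrite /light /U big_nil [vol set0]big_set0 W0.
have [ls nls|] := boolP (light (U s)); last by move=> n _; apply: IH.
exists x; have [/(light_subset (subsetUl _ _))|lc] := haven (rU (x :: s)); first by rewrite (negbTE nls).
have e := volD (subset_trans (UM (x :: s)) MF).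
have := volU (C x) (U s); rewrite -(big_cons _ _ _ _ xpredT C) -/(U (x :: s)).
by move: ls lc; rewrite /light; lia.
Qed.

Notation dep := (depth A om cap).

Lemma depth_setX_lip M b : {in M &, forall x y, A x y -> dep M b x <= om x + dep M b y}.
Proof. by move=> x y xM yM; apply: depth_lip. Qed.

(** Distance is measured in [M] while the cut is made in [N]: two nested regions are trimmed by the
    same distance at different levels. *)
Definition beyond N M b t := [set x in N | t + om x <= dep M b x].

Lemma region_beyond n M N Z b t : N \subset M -> region n N Z ->
    #|sphere om (dep M b) N t| * rho <= Omega ->
  region n.+1 (beyond N M b t) (Z :|: sphere om (dep M b) N t).
Proof.
move=> NM [NF ZF bN cZ] cS; split.
- by apply: subset_trans NF; apply/subsetP => x; rewrite inE => /andP[].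
- apply/subsetP => x; rewrite !inE => /orP[/(subsetP ZF)|/andP[xN /andP[_ dx]]].
    by rewrite !inE => /andP[/negPf-> ->].
  by rewrite (subsetP NF) // xN leqNgt dx.
- move=> x y; rewrite !inE => /andP[xN dx] yF xy.
  have := bN _ _ xN yF xy; rewrite !inE => /orP[yN|->]; last by rewrite orbT.
  have := depth_setX_lip b (subsetP NM _ xN) (subsetP NM _ yN) xy.
  by rewrite yN /=; move: dx; clear; case: (y \in Z); rewrite ?orbT //=; lia.
- apply: leq_trans (_ : (#|Z| + #|sphere om (dep M b) N t|) * rho <= _).
    by rewrite leq_mul2r cardsU leq_subr orbT.
  by rewrite mulnDl mulSn addnC leq_add.
Qed.

Definition near M b R := [set x in M | dep M b x <= R].

(** Some sphere between the radii [R] and [R + R] is small. Its inside contains the smaller ball and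
    is not light, so the haven makes its outside light. *)
Lemma near_beyond n M Z b R : region n M Z -> n <= 5 -> 0 < R -> rho <= R ->
  ~~ light (near M b R) -> light (F :\: near M b (R + R)).
Proof.
move=> rM n5 R0 rhoR; apply: contraNT => nl.
have [MF ZF bM cZ] := rM.
have [t [lt tl ct]] := exists_small_sphere om (dep M b) M R R0.
pose X := [set x in M | dep M b x < t].
have cS : #|sphere om (dep M b) M t| * rho <= Omega.
  apply: leq_trans (leq_trans (leq_mul (leqnn _) rhoR) ct) _.
  by rewrite /Omega [leqRHS](big_setID M) /= (setIidPr MF) leq_addr.
have rX : region 6 X (Z :|: sphere om (dep M b) M t).
  split.
  - by apply: subset_trans MF; apply/subsetP => x; rewrite inE => /andP[].
  - apply/subsetP => x; rewrite !inE => /orP[/(subsetP ZF)|/andP[xN /andP[dx _]]].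
      by rewrite !inE => /andP[/negPf-> ->].
    by rewrite (subsetP MF) // xN ltnNge dx.
  - move=> x y; rewrite !inE => /andP[xN dx] yF xy.
    have := bM _ _ xN yF xy; rewrite !inE => /orP[yN|->]; last by rewrite orbT.
    rewrite Asym in xy.
    have := depth_setX_lip b yN xN xy.
    by rewrite yN /=; move: dx; clear; case: (y \in Z); rewrite ?orbT //=; lia.
  - apply: leq_trans (_ : (#|Z| + #|sphere om (dep M b) M t|) * rho <= _).
      by rewrite leq_mul2r cardsU leq_subr orbT.
    by rewrite mulnDl; nia.
have [h|h] := haven rX.
  apply: light_subset h; apply: subset_trans (subsetUl _ _).
  by apply/subsetP => x; rewrite !inE => /andP[-> d]; rewrite (leq_ltn_trans d).
case/negP: nl; apply: light_subset h; apply: setDS.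
by apply/subsetP => x; rewrite !inE => /andP[-> d] /=; lia.
Qed.

(** Take [b] maximal among the linked subsets of a heavy component whose [R]-ball is light. With one
    more vertex [f] the [R]-ball is not light, so the outside of the doubled ball of [f |: b] is
    light. Dropping also the light balls of [f] and [b] leaves [20 - 3 = 17] twentieths. *)
Lemma exists_hub n n' M Z M' Z' R :
    region n M Z -> n <= 5 -> region n' M' Z' -> n' <= 6 -> M' \subset M -> ~~ light M' ->
    0 < R -> rho <= R -> R + R < cap ->
    {in M', forall x, light (near F [set x] (R + R))} ->
  exists b, [/\ b \subset M', linked A b, b != set0, light (near M b R) &
    17 * W < 20 * vol (near M b (R + R) :\: near M b R)].
Proof.
move=> rM n5 rM' n6 M'M nl R0 rhoR Rcap lball.
have [K [KM' lK K0 vK]] := heavy_component (region_leq n6 rM') nl.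
have MF : M \subset F by case: rM.
have nearF b l : near M b l \subset near F b l.
  apply/subsetP => x; rewrite !inE => /andP[xM d]; rewrite (subsetP MF) //=.
  by apply: leq_trans d; apply: depth_subset.
pose P b := [&& b \subset K, linked A b, b != set0 & light (near M b R)].
have near_leq b l l' : l <= l' -> near M b l \subset near M b l'.
  by move=> ll; apply/subsetP => x; rewrite !inE => /andP[-> d]; apply: leq_trans ll.
have [x0 x0K] := set0Pn _ K0.
have P0 : P [set x0].
  rewrite /P sub1set x0K linked1 -?card_gt0 ?cards1 //=.
  apply: light_subset (lball x0 (subsetP KM' _ x0K)).
  by apply: subset_trans (nearF _ _); apply: near_leq; lia.
have [b /maxsetP[/and4P[bK lb b0 nb] bmax] _] := maxset_exists P0.
have bKn : b != K.
  apply: contraTneq nb => ->; rewrite /light -leqNgt.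
  have : vol K <= vol (near M K R).
    apply: vol_subset; apply/subsetP => x xK.
    by rewrite inE depth0 // andbT (subsetP M'M) // (subsetP KM').
  by clear - vK; lia.
have [f /setDP[fK fb] tf] := linked_boundary Asym lK bK b0 bKn.
have nlf : ~~ light (near M (f |: b) R).
  apply/negP => lf; case/negP: fb.
  rewrite -(bmax (f |: b)) ?setU11 //; last exact: subsetUr.
  rewrite /P subUset sub1set fK bK linkedU1 //= lf andbT.
  by apply/set0Pn; exists f; rewrite setU11.
exists b; split=> //; first exact: subset_trans KM'.
have lb2 := near_beyond rM n5 R0 rhoR nlf.
have nU : near M (f |: b) (R + R) \subset near M b (R + R) :|: near F [set f] (R + R).
  apply/subsetP => x; rewrite !inE => /andP[xM] /(depth_setU1 Rcap).
  rewrite (subsetP MF) // xM /= => /orP[->//|d]; apply/orP; right.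
  by apply: leq_trans d; apply: depth_subset.
have sub b' l : near M b' l \subset F.
  by apply: subset_trans MF; apply/subsetP => x; rewrite inE => /andP[].
have e := volD (sub (f |: b) (R + R)).
have v1 := leq_trans (vol_subset nU) (volU _ _).
have lf := lball f (subsetP KM' _ fK).
have v2 : vol (near M b (R + R)) <= vol (near M b (R + R) :\: near M b R) + vol (near M b R).
  apply: leq_trans (volU _ _); apply: vol_subset; apply/subsetP => x.
  by rewrite in_setU in_setD => ->; rewrite andbT orNb.
by rewrite /light in nb lf lb2; clear - nb lf lb2 e v1 v2; lia.
Qed.

End Haven.

(** * Nested hubs and geodesics that avoid the other hubs *)

Section Tower.
Variables (T : finType) (A : rel T) (om : T -> nat) (cap rho : nat) (F : {set T}).
Hypotheses (Arefl : reflexive A) (Asym : symmetric A).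
Implicit Types (x y p u v : T) (s : seq T) (i n k m : nat) (N B : {set T}).

Notation dep := (depth A om cap).

Lemma path_prefix p s s1 v s2 : p :: s = s1 ++ v :: s2 -> path A p s ->
  exists s', [/\ p :: s' = rcons s1 v, path A p s' & last p s' = v].
Proof.
case: s1 => [|y s1] /=; first by case=> <- _ _; exists [::].
case=> <- -> ps; exists (rcons s1 v); rewrite last_rcons; split=> //.
by move: ps; rewrite -cat_rcons cat_path => /andP[].
Qed.

Lemma depth_nbr N B x u : x \in N -> u \in B -> A u x -> dep N B x <= om x.
Proof.
move=> xM ub ux; apply: (leq_trans (@depth_seq _ A om cap N B x [::] _ _ _)) => //=.
- by rewrite xM.
- by apply/existsP; exists u; rewrite ub Asym.
- by rewrite wt_cons /wt big_nil addn0.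
Qed.

(** Geodesics run in [M k], the hub lies in the smaller [M' k]. The gap [rho] between the cut levels
    [t k] and [t' k] exceeds no vertex weight from below: it pays for the vertex at which a geodesic
    would touch a later hub. *)
Variables (M M' b : nat -> {set T}) (t t' R : nat -> nat).
Hypotheses (MS : forall k, k < 3 -> M k.+1 = beyond A om cap (M k) (M k) (b k) (t k))
  (M'S : forall k, k < 3 -> M' k.+1 = beyond A om cap (M' k) (M k) (b k) (t' k))
  (bM' : forall k, k < 3 -> b k \subset M' k) (M'M : M' 0 \subset M 0) (MF : M 0 \subset F)
  (om_rho : {in M 0, forall x, om x <= rho})
  (t0 : forall k, k < 3 -> 0 < t k) (t2 : forall k, k < 3 -> t k <= 2 * rho)
  (tt' : forall k, k < 3 -> t k + rho <= t' k)
  (RS : forall k, k < 2 -> R k + R k + 3 * rho <= R k.+1) (Rcap : R 2 + R 2 < cap).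

Lemma tower_R i n : i < n -> n < 3 -> R i + R i + 3 * rho <= R n.
Proof.
elim: n => // n IH; rewrite ltnS leq_eqVlt => /orP[/eqP-> //|/IH {}IH]; first exact: RS.
by rewrite ltnS => n2; move: (IH (ltnW n2)) (RS n2); clear; lia.
Qed.

Lemma tower_M i n : i <= n -> n <= 3 -> M n \subset M i.
Proof.
elim: n => [|n IH]; first by rewrite leqn0 => /eqP->.
rewrite leq_eqVlt => /orP[/eqP-> //|]; rewrite ltnS => le n3.
by apply: subset_trans (IH le (ltnW n3)); rewrite MS //; apply/subsetP => x; rewrite inE => /andP[].
Qed.

Lemma tower_M' i n : i <= n -> n <= 3 -> M' n \subset M' i.
Proof.
elim: n => [|n IH]; first by rewrite leqn0 => /eqP->.
rewrite leq_eqVlt => /orP[/eqP-> //|]; rewrite ltnS => le n3.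
by apply: subset_trans (IH le (ltnW n3)); rewrite M'S //; apply/subsetP => x; rewrite inE => /andP[].
Qed.

Lemma tower_M'M n : n <= 3 -> M' n \subset M n.
Proof.
elim: n => // n IH n3; rewrite MS // M'S //; apply/subsetP => x.
rewrite !inE => /andP[xM d]; rewrite (subsetP (IH (ltnW n3))) //=.
by apply: leq_trans d; rewrite leq_add2r; have := tt' n3; clear; lia.
Qed.

(** A neighbour of hub [n] has depth at most its own weight, so the cut at a positive level removed
    it. *)
Lemma tower_hub_below i n v u : n < i -> i <= 3 -> v \in M i -> u \in b n -> ~~ A u v.
Proof.
move=> ni i3 vM ub; apply/negP => uv; have n3 : n < 3 by apply: leq_trans i3.
have := subsetP (tower_M ni i3) _ vM; rewrite MS // inE => /andP[vMn].
by have := depth_nbr vMn ub uv; have := t0 n3; clear; lia.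
Qed.

Definition place p := forall k, k < 3 -> [&& p \in M k, R k < dep (M k) (b k) p &
  dep (M k) (b k) p <= R k + R k].

Lemma place_geodesic k p : k < 3 -> place p -> exists s,
  [/\ all (mem (M k)) (p :: s), path A p s, touches A (b k) (last p s),
     wt om (p :: s) <= R k + R k &
     forall s1 v s2, p :: s = s1 ++ v :: s2 -> dep (M k) (b k) v = wt om (v :: s2)].
Proof.
move=> k3 /(_ k k3) /and3P[pM Rp pR].
have Rk : R k + R k < cap.
  move: k3; rewrite ltnS leq_eqVlt => /orP[/eqP-> //|/tower_R/(_ isT)].
  by move: Rcap; clear; lia.
have pb : p \notin b k by apply: contraTN Rp => /depth0 ->.
have [s [sM ps ls ds]] := depth_geodesic pb (leq_ltn_trans pR Rk).
by exists s; split=> //; rewrite -(ds [::] p s).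
Qed.

(* Going up the tower, an initial piece of the geodesic is too short to come near
   the intermediate hubs, so it stays in the regions that were cut out around them. *)
Lemma tower_geodesic_above i n p s u v : i < n -> n < 3 -> place p ->
    all (mem (M i)) (p :: s) -> path A p s -> wt om (p :: s) <= R i + R i ->
    (forall s1 v s2, p :: s = s1 ++ v :: s2 -> dep (M i) (b i) v = wt om (v :: s2)) ->
  v \in p :: s -> u \in b n -> ~~ A v u.
Proof.
move=> lin n3 pp sM ps ws ds vs ub; apply/negP => vu.
have i3 : i < 3 by apply: ltn_trans n3.
have uM' : u \in M' n by apply: (subsetP (bM' n3)).
have := subsetP (tower_M' lin (ltnW n3)) _ uM'; rewrite M'S // inE => /andP[uM'i du].
have uMi := subsetP (tower_M'M (ltnW i3)) _ uM'i.
have vMi : v \in M i by apply: (allP sM).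
(* The later hub survived the cut at [t' i] with its own weight to spare, and one step costs at most
   that weight. *)
have dv : t' i <= dep (M i) (b i) v.
  rewrite Asym in vu; have := depth_lip om cap (b i) uMi vMi vu.
  by move: du; clear; lia.
have [s1 [s2 e]] : exists s1 s2, p :: s = s1 ++ v :: s2.
  by case/splitPr: vs => s1 s2; exists s1, s2.
have [s' [e' ps' ls']] := path_prefix e ps.
have ws' : wt om (p :: s') <= R i + R i.
  by apply: leq_trans ws; rewrite e e' -cat_rcons wt_cat leq_addr.
have omi x : x \in M i -> om x <= rho.
  by move=> xM; apply/om_rho/(subsetP (tower_M (leq0n i) (ltnW i3))).
(* At [m = i.+1] the depths along the geodesic, which decrease towards [v], are still large enough
   to pass the cut at [t i]. At later [m] the place is farther than [R m] from the hub, while the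
   piece weighs at most [R i + R i]; the spare [3 * rho] covers [t m] and one vertex. *)
have inM m : i < m -> m <= n -> all (mem (M m)) (p :: s').
  elim: m => // m IH; rewrite ltnS => im mn; apply/allP => x xs.
  have m3 : m < 3 := leq_trans mn (ltnW n3).
  rewrite /= MS // inE; move: im; rewrite leq_eqVlt => /orP[/eqP im|im].
    have xin : x \in p :: s by rewrite e -cat_rcons -e' mem_cat xs.
    have xMi : x \in M i := allP sM _ xin.
    rewrite -im xMi /=; have ti := tt' i3; have ox := omi x xMi.
    move: xs; rewrite e' mem_rcons inE => /orP[/eqP->|xs1].
      by move: (omi v vMi) dv ti; clear; lia.
    have dsv := ds _ _ _ e.
    case/splitPr: xs1 e {e'} => s3 s4; rewrite -catA cat_cons => /ds ->.
    by rewrite wt_cons wt_cat -dsv; move: ti dv; clear; lia.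
  have all_m := IH im (ltnW mn).
  have xMm : x \in M m := allP all_m _ xs.
  have /and3P[_ Rp _] := pp m m3.
  have ox := om_rho (subsetP (tower_M (leq0n m) (ltnW m3)) _ xMm).
  rewrite xMm /=; have Rim := tower_R im m3; have tm := t2 m3.
  have [s3 [s4 e3]] : exists s3 s4, p :: s' = s3 ++ x :: s4.
    by case/splitPr: xs => s3 s4; exists s3, s4.
  have := depth_path om cap (b m) e3 all_m ps'.
  move: ws'; rewrite e3 wt_cat wt_cons.
  by move: Rp Rim tm ox; clear; lia.
have aln := inM n lin (leqnn n).
have /and3P[_ Rp _] := pp n n3.
have : dep (M n) (b n) p <= wt om (p :: s').
  by apply: depth_seq => //; apply/existsP; exists u; rewrite ub ls'.
by have := tower_R lin n3; move: ws' Rp; clear; lia.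
Qed.

(** Walk from [p'] to [v'], step to [v] and follow the first path backwards to [p]. *)
Lemma far_geodesics N N' p p' s s' v v' l l' : N \subset F -> N' \subset F ->
    all (mem N) (p :: s) -> path A p s -> wt om (p :: s) <= l -> v \in p :: s ->
    all (mem N') (p' :: s') -> path A p' s' -> wt om (p' :: s') <= l' -> v' \in p' :: s' ->
  A v v' -> dep F [set p] p' <= l + l'.
Proof.
move=> NF N'F sN ps ws vs sN' ps' ws' vs' vv'.
have [s1 [s2 e]] : exists s1 s2, p :: s = s1 ++ v :: s2.
  by case/splitPr: vs => s1 s2; exists s1, s2.
have [s1' [s2' e']] : exists s1 s2, p' :: s' = s1 ++ v' :: s2.
  by case/splitPr: vs' => a1 a2; exists a1, a2.
have [a [ea pa la]] := path_prefix e ps.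
have [a' [ea' pa' la']] := path_prefix e' ps'.
have wa : wt om (p :: a) <= l.
  by apply: leq_trans ws; rewrite e ea -cat_rcons wt_cat leq_addr.
have wa' : wt om (p' :: a') <= l'.
  by apply: leq_trans ws'; rewrite e' ea' -cat_rcons wt_cat leq_addr.
have aF : {subset p :: a <= F}.
  move=> x xa; apply: (subsetP NF); apply: (allP sN).
  by rewrite e -cat_rcons -ea mem_cat xa.
have a'F : {subset p' :: a' <= F}.
  move=> x xa; apply: (subsetP N'F); apply: (allP sN').
  by rewrite e' -cat_rcons -ea' mem_cat xa.
have er : rev (p :: a) = v :: rev (belast p a) by rewrite lastI rev_rcons la.
apply: (@leq_trans (wt om (p' :: a' ++ rev (p :: a)))); last first.
  rewrite -cat_cons wt_cat addnC leq_add //; apply: leq_trans wa.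
  by rewrite /wt (perm_big _ (permEl (perm_rev _))).
apply: depth_seq.
- rewrite -cat_cons all_cat; apply/andP; split; apply/allP => x; first exact: a'F.
  by rewrite mem_rev; apply: aF.
- rewrite cat_path pa' er /= la' Asym vv' /= -la rev_path.
  by rewrite (eq_path (e' := A)) // => x y; rewrite Asym.
- rewrite last_cat er /=; apply/existsP; exists p; rewrite inE eqxx /=.
  have -> : last v (rev (belast p a)) = last p (rev (p :: a)) by rewrite er.
  by rewrite rev_cons last_rcons.
Qed.

End Tower.

(** This is all that the combinatorial part knows about the plane. The families are connected sets
    rather than paths, and they may overlap. *)
Definition K33_crossing (T : finType) (A : rel T) :=
  forall (p p' : 'I_3 -> T) (X : 'I_3 -> 'I_3 -> {set T}),
    (forall i j, joined A (X i j) (p i) (p' j)) ->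
  exists i i' j j' u v,
    [/\ i != i', j != j', u \in X i j, v \in X i' j' & A u v].

(** * The crossing property excludes havens with light balls *)

Section NoHaven.
Variables (T : finType) (A : rel T) (om q : T -> nat) (cap rho : nat) (F : {set T}).
Hypotheses (Arefl : reflexive A) (Asym : symmetric A) (W0 : 0 < \sum_(x in F) q x)
  (rho0 : 0 < rho) (rho_cap : 320 * rho < cap).
Hypothesis haven : forall X Z, region A om rho F 6 X Z ->
  light q F (X :|: Z) \/ light q F (F :\: X).
Hypothesis light_balls : forall x, x \in F -> om x <= rho ->
  light q F (near A om cap F [set x] (320 * rho)).

Let F0 := [set x in F | om x <= rho].
Let W := vol q F.

(** The state after [n] hubs: each hub costs one more sphere in either separator and one more
    twentieth of the weight outside [M']. *)
Definition level n (M M' : {set T}) :=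
  [/\ exists Z, region A om rho F n.+1 M Z, exists Z, region A om rho F n.+1 M' Z,
      M' \subset M, M \subset F0 & 20 * vol q (F :\: M') < n.+1 * W].

(** Fewer than [Omega / rho] vertices can be heavier than [rho], so as a separator they cost one
    unit, and the haven makes them light. *)
Lemma level0 : level 0 F0 F0.
Proof.
have F0F : F0 \subset F by apply/subsetP => x; rewrite inE => /andP[].
have cZ : #|F :\: F0| * rho <= \sum_(x in F) om x.
  rewrite [leqRHS](big_setID F0) /= -sum_nat_const (leq_trans _ (leq_addl _ _)) //.
  apply: leq_sum => x; rewrite !inE => /andP[h xF]; rewrite xF /= -ltnNge in h.
  exact: ltnW.
have r0 : exists Z, region A om rho F 1 F0 Z.
  exists (F :\: F0); split; rewrite ?mul1n // => x y _ yF _.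
  by rewrite !inE yF andbT orbN.
split=> //; rewrite mul1n.
have r1 : region A om rho F 6 set0 (F :\: F0).
  split; rewrite ?sub0set ?setD0 ?subsetDl //; first by move=> x y; rewrite inE.
  by apply: leq_trans cZ _; rewrite -{1}[X in X <= _]mul1n leq_mul2r orbT.
case: (haven r1) => [|]; first by rewrite set0U.
by rewrite setD0 /light; lia.
Qed.

Lemma level_step n M M' R : level n M M' -> n < 3 -> 5 * rho <= R -> R + R <= 320 * rho ->
  exists b t t', [/\ level n.+1 (beyond A om cap M M b t) (beyond A om cap M' M b t'),
    [/\ 0 < t, t <= 2 * rho & t + rho <= t'], [/\ b \subset M', linked A b & b != set0] &
    17 * W < 20 * vol q (near A om cap M b (R + R) :\: near A om cap M b R)].
Proof.
move=> [[Z rZ] [Z' rZ'] M'M MF0 vM'] n3 R5 R320.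
have W0' : 0 < W by [].
have nl : ~~ light q F M'.
  have e := volD q (let: And4 h _ _ _ := rZ' in h).
  by rewrite /light -leqNgt; move: vM' e W0' n3; rewrite -/W; clear; nia.
have R0 : 0 < R by move: R5 rho0; clear; lia.
have lb : {in M', forall x, light q F (near A om cap F [set x] (R + R))}.
  move=> x /(subsetP M'M)/(subsetP MF0); rewrite inE => /andP[xF ox].
  apply: light_subset (light_balls xF ox).
  by apply/subsetP => y; rewrite !inE => /andP[->] /= d; apply: leq_trans R320.
have [b [bM' lkb b0 nb vb]] := exists_hub Asym W0 haven rZ (leq_trans n3 (isT : 3 <= 5)) rZ'
  (leq_trans n3 (isT : 3 <= 6)) M'M nl R0
  (ltac:(by move: R5; clear; lia) : rho <= R) (leq_ltn_trans R320 rho_cap) lb.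
have sumF (N : {set T}) : N \subset F -> \sum_(x in N) om x <= \sum_(x in F) om x.
  by move=> NF; rewrite [leqRHS](big_setID N) /= (setIidPr NF) leq_addr.
have MF : M \subset F by case: rZ.
have M'F : M' \subset F by case: rZ'.
(* The windows [rho < t <= 2 * rho] and [3 * rho < t' <= 4 * rho] leave the gap of [rho] between the
   two cuts. *)
have [t [t1 t2 ct]] := exists_small_sphere om (depth A om cap M b) M rho rho0.
have [t' [t'1 t'2 ct']] := exists_small_sphere om (depth A om cap M b) M' (3 * rho) rho0.
have tt' : t + rho <= t' by move: t2 t'1; clear; lia.
exists b, t, t'; split=> //; last by split=> //; move: t1 t2; clear; lia.
split.
- by eexists; apply: region_beyond (subxx _) rZ (leq_trans ct (sumF _ MF)).
- by eexists; apply: region_beyond M'M rZ' (leq_trans ct' (sumF _ M'F)).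
- apply/subsetP => x; rewrite !inE => /andP[/(subsetP M'M)->] /=.
  by apply: leq_trans; rewrite leq_add2r; apply: leq_trans tt'; apply: leq_addr.
- by apply: subset_trans MF0; apply/subsetP => x; rewrite inE => /andP[].
(* What the cut removes from [M'] has depth below [t' + om x <= 5 * rho <= R], hence lies in the
   light ball of the hub. *)
have sub : F :\: beyond A om cap M' M b t' \subset (F :\: M') :|: near A om cap M b R.
  apply/subsetP => x; rewrite !inE => /andP[h xF]; rewrite xF andbT.
  move: h; case xM' : (x \in M') => //=; rewrite (subsetP M'M) //= -ltnNge => d.
  have := subsetP MF0 _ (subsetP M'M _ xM'); rewrite inE => /andP[_].
  by move: d t'2 R5; clear; lia.
have := leq_trans (vol_subset q sub) (volU _ _ _).
by move: nb vM'; rewrite /light -/W; clear; nia.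
Qed.

Lemma no_haven : K33_crossing A -> False.
Proof.
move=> K33.
(* The radii [5], [20], [80] times [rho] satisfy [R k + R k + 3 * rho <= R k.+1]. A geodesic weighs
   at most [160 * rho], so two of them cannot bridge [320 * rho]. *)
have [b0 [t0 [t0' [l1 tt0 [bM0 lk0 nb0] v0]]]] := level_step (R := 5 * rho) level0 isT
  (leqnn _) (ltac:(by clear; lia)).
have [b1 [t1 [t1' [l2 tt1 [bM1 lk1 nb1] v1]]]] := level_step (R := 20 * rho) l1 isT
  (ltac:(by clear; lia)) (ltac:(by clear; lia)).
have [b2 [t2 [t2' [l3 tt2 [bM2 lk2 nb2] v2]]]] := level_step (R := 80 * rho) l2 isT
  (ltac:(by clear; lia)) (ltac:(by clear; lia)).
pose M1 := beyond A om cap F0 F0 b0 t0.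
pose M1' := beyond A om cap F0 F0 b0 t0'.
pose M2 := beyond A om cap M1 M1 b1 t1.
pose M2' := beyond A om cap M1' M1 b1 t1'.
pose M3 := beyond A om cap M2 M2 b2 t2.
pose M3' := beyond A om cap M2' M2 b2 t2'.
rewrite -/M1 -/M1' -/M2 -/M2' -/M3 -/M3' in l1 l2 l3 bM1 bM2 v1 v2.
pose Mk k := nth F0 [:: F0; M1; M2; M3] k.
pose Mk' k := nth F0 [:: F0; M1'; M2'; M3'] k.
pose b k := nth b0 [:: b0; b1; b2] k.
pose t k := nth t0 [:: t0; t1; t2] k.
pose t' k := nth t0' [:: t0'; t1'; t2'] k.
pose R k := nth 0 [:: 5 * rho; 20 * rho; 80 * rho] k.
have F0F : F0 \subset F by apply/subsetP => x; rewrite inE => /andP[].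
have om_rho : {in Mk 0, forall x, om x <= rho} by move=> x; rewrite inE => /andP[].
have MS k : k < 3 -> Mk k.+1 = beyond A om cap (Mk k) (Mk k) (b k) (t k).
  by case: k => [|[|[|]]].
have M'S k : k < 3 -> Mk' k.+1 = beyond A om cap (Mk' k) (Mk k) (b k) (t' k).
  by case: k => [|[|[|]]].
have bM' k : k < 3 -> b k \subset Mk' k by case: k => [|[|[|]]].
have t_gt0 k : k < 3 -> 0 < t k by case: k => [|[|[|//]]] _; [case: tt0|case: tt1|case: tt2].
have t_le2 k : k < 3 -> t k <= 2 * rho by case: k => [|[|[|//]]] _; [case: tt0|case: tt1|case: tt2].
have t_t' k : k < 3 -> t k + rho <= t' k by case: k => [|[|[|//]]] _; [case: tt0|case: tt1|case: tt2].
have RS k : k < 2 -> R k + R k + 3 * rho <= R k.+1 by case: k => [|[|//]] _; rewrite /R /=; clear; lia.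
have Rcap : R 2 + R 2 < cap by rewrite /R /=; move: rho0 rho_cap; clear; lia.
have MkF k : k < 3 -> Mk k \subset F.
  move=> k3; apply: subset_trans F0F.
  exact: (tower_M MS (leq0n k) (ltnW k3)).
pose G k := near A om cap (Mk k) (b k) (R k + R k) :\: near A om cap (Mk k) (b k) (R k).
have GF k : k < 3 -> G k \subset F.
  move=> k3; apply: subset_trans (MkF k k3).
  by apply/subsetP => x; rewrite !inE => /andP[_ /andP[]].
have vG k : k < 3 -> 20 * vol q (F :\: G k) < 3 * W.
  move=> k3; have := volD q (GF k k3).
  have : 17 * W < 20 * vol q (G k) by case: k k3 => [|[|[|//]]] _.
  by rewrite -/W; clear; lia.
have bad_places B : vol q B < vol q F -> exists2 p, p \in F & p \notin B.
  move=> vB; apply/subsetPn; apply: contraTN vB => FB.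
  by rewrite -leqNgt vol_subset.
(* Each shell misses less than [3/20] of the weight, all three miss less than [9/20], and two light
   balls cost [2/20]: room remains for three places. *)
pose B0 := (F :\: G 0) :|: (F :\: G 1) :|: (F :\: G 2).
have vB0 : 20 * vol q B0 < 9 * W.
  have := leq_trans (volU q ((F :\: G 0) :|: (F :\: G 1)) _) (leq_add (volU q (F :\: G 0) (F :\: G 1)) (leqnn (vol q (F :\: G 2)))).
  by rewrite -/B0; move: (vG 0 isT) (vG 1 isT) (vG 2 isT); clear; lia.
have W0' : 0 < W by [].
have placeP p : p \in F -> p \notin B0 -> place A om cap Mk b R p.
  move=> pF pB k k3.
  have : p \in G k.
    apply: contraNT pB => pG.
    have : p \in F :\: G k by rewrite in_setD pG.
    apply: subsetP; case: k {pG} k3 => [|[|[|//]]] _; last exact: subsetUr.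
      by rewrite /B0 -setUA subsetUl.
    by rewrite /B0 -setUA setUCA subsetUl.
  rewrite /G in_setD /near [p \in [set _ in _ | _ <= R k]]inE inE => /andP[h /andP[pM d]].
  by move: h; rewrite pM d /= -ltnNge => ->.
pose ball p := near A om cap F [set p] (320 * rho).
have ball_light p : place A om cap Mk b R p -> 20 * vol q (ball p) < W.
  move=> plp; have /and3P[pF0 _ _] := plp 0 isT; move: pF0; rewrite inE => /andP[pF op].
  exact: light_balls.
have [p0 p0F p0B] : exists2 p, p \in F & p \notin B0.
  by apply: bad_places; move: vB0 W0'; rewrite /W; clear; lia.
have pl0 := placeP _ p0F p0B.
have [p1 p1F] : exists2 p, p \in F & p \notin B0 :|: ball p0.
  apply: bad_places; apply: leq_ltn_trans (volU _ _ _) _.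
  by move: (ball_light _ pl0) vB0 W0'; rewrite /W; clear; lia.
rewrite in_setU negb_or => /andP[p1B p1b].
have pl1 := placeP _ p1F p1B.
have [p2 p2F] : exists2 p, p \in F & p \notin B0 :|: ball p0 :|: ball p1.
  apply: bad_places; apply: leq_ltn_trans (volU _ _ _) _.
  apply: (@leq_ltn_trans (vol q B0 + vol q (ball p0) + vol q (ball p1))).
    by rewrite leq_add2r volU.
  by move: (ball_light _ pl0) (ball_light _ pl1) vB0 W0'; rewrite /W; clear; lia.
rewrite in_setU negb_or in_setU negb_or => /andP[/andP[p2B p2b] p2b'].
have pl2 := placeP _ p2F p2B.
pose p (j : 'I_3) := nth p0 [:: p0; p1; p2] j.
have pl j : place A om cap Mk b R (p j) by case: j => [[|[|[|//]]] ?].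
have far (j j' : 'I_3) : j < j' -> 320 * rho < depth A om cap F [set p j] (p j').
  case: j j' => [[|[|[|//]]] ?] [[|[|[|//]]] ?] //= _; rewrite ltnNge.
  - by move: p1b; rewrite inE p1F.
  - by move: p2b; rewrite inE p2F.
  - by move: p2b'; rewrite inE p2F.
have geo (i j : 'I_3) : exists s : seq T, [/\ all (mem (Mk i)) (p j :: s), path A (p j) s,
    touches A (b i) (last (p j) s), wt om (p j :: s) <= R i + R i &
    forall s1 v s2, p j :: s = s1 ++ v :: s2 -> depth A om cap (Mk i) (b i) v = wt om (v :: s2)].
  exact: (place_geodesic RS Rcap (ltn_ord i) (pl j)).
pose S (i j : 'I_3) := sval (cid (geo i j)).
have SP (i j : 'I_3) : [/\ all (mem (Mk i)) (p j :: S i j), path A (p j) (S i j),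
    touches A (b i) (last (p j) (S i j)), wt om (p j :: S i j) <= R i + R i &
    forall s1 v s2, p j :: S i j = s1 ++ v :: s2 ->
      depth A om cap (Mk i) (b i) v = wt om (v :: s2)].
  exact: (svalP (cid (geo i j))).
have b_neq0 (i : 'I_3) : b i != set0 by case: i => [[|[|[|//]]] ?].
have lk (i : 'I_3) : linked A (b i) by case: i => [[|[|[|//]]] ?].
pose c (i : 'I_3) := sval (cid (set0Pn _ (b_neq0 i))).
have cb i : c i \in b i := svalP (cid (set0Pn _ (b_neq0 i))).
(* Adjacent members of independent families would be hub to hub, hub to path or path to path; the
   three cases are excluded separately below. *)
pose X (i j : 'I_3) := b i :|: [set x in p j :: S i j].
have bX (i j : 'I_3) : b i \subset X i j by apply: subsetUl.
have SX (i j : 'I_3) : {subset p j :: S i j <= X i j} by move=> x xs; rewrite in_setU [x \in [set _ in _]]inE xs orbT.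
have [|i [i' [j [j' [u [v [ii' jj' uX vX uv]]]]]]] := K33 c p X.
  move=> i j; have [_ ps ls _ _] := SP i j.
  have pX : joined A (X i j) (p j) (last (p j) (S i j)).
    by apply: joined_path => //; apply/allP => x; apply: SX.
  case/existsP: ls => y /andP[yb ly].
  have lX : last (p j) (S i j) \in X i j by apply: SX; apply: mem_last.
  rewrite joined_sym //; apply: joined_trans pX _.
  apply: joined_trans (joined_step lX (subsetP (bX i j) _ yb) ly) _.
  by apply: joined_subset (bX i j) _; apply: (linkedP _ _ (lk i)).
have i3 := ltn_ord i; have i3' := ltn_ord i'.
have bMk k : k < 3 -> b k \subset Mk k.
  move=> k3; apply: subset_trans (bM' k k3) _.
  exact: (tower_M'M MS M'S _ t_t' (ltnW k3)).
have below n m x y : n < m -> m < 3 -> x \in Mk m -> y \in b n -> ~~ A y x.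
  move=> nm m3; apply: (tower_hub_below Asym MS t_gt0 nm (ltnW m3)).
have hub_path (k m : 'I_3) x y jj : k != m -> x \in b k -> y \in p jj :: S m jj -> A x y -> False.
  have [sM ps _ ws ds] := SP m jj; move=> km xb ys xy.
  have yM : y \in Mk m := allP sM _ ys.
  case: (ltngtP k m) => [lt|lt|e]; last by case/eqP: km; apply: val_inj.
    by have := below _ _ _ _ lt (ltn_ord m) yM xb; rewrite xy.
  have := tower_geodesic_above Asym MS M'S bM' (subxx _) om_rho t_le2 t_t' RS lt (ltn_ord k)
    (pl jj) sM ps ws ds ys xb.
  by rewrite Asym xy.
have hub_hub (k m : 'I_3) x y : k != m -> x \in b k -> y \in b m -> A x y -> False.
  move=> km xb yb xy; case: (ltngtP k m) => [lt|lt|e]; last by case/eqP: km; apply: val_inj.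
    have := below _ _ _ _ lt (ltn_ord m) (subsetP (bMk _ (ltn_ord m)) _ yb) xb.
    by rewrite xy.
  have := below _ _ _ _ lt (ltn_ord k) (subsetP (bMk _ (ltn_ord k)) _ xb) yb.
  by rewrite Asym xy.
have R160 (k : 'I_3) : R k + R k <= 160 * rho.
  by case: k => [[|[|[|//]]] ?]; rewrite /R /=; clear; lia.
have path_path (k k' l l' : 'I_3) x y : l < l' -> x \in p l :: S k l -> y \in p l' :: S k' l' ->
    A x y -> False.
  move=> ll' xs ys xy; have := far _ _ ll'.
  have [sM ps _ ws _] := SP k l; have [sM' ps' _ ws' _] := SP k' l'.
  have := far_geodesics cap Arefl Asym (MkF _ (ltn_ord k)) (MkF _ (ltn_ord k')) sM ps ws xs sM' ps' ws' ys xy.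
  by move: (R160 k) (R160 k'); clear; lia.
move: uX vX; rewrite !in_setU => /orP[ub|up] /orP[vb|vp].
- exact: hub_hub ii' ub vb uv.
- by rewrite inE in vp; apply: hub_path ii' ub vp uv.
- by rewrite inE in up; rewrite eq_sym in ii'; rewrite Asym in uv; apply: hub_path ii' vb up uv.
rewrite inE in up; rewrite inE in vp.
case: (ltngtP j j') => [lt|lt|e]; last by case/eqP: jj'; apply: val_inj.
  exact: path_path lt up vp uv.
by rewrite Asym in uv; apply: path_path lt vp up uv.
Qed.

End NoHaven.

(** * Path systems and sparse cuts *)

(** Cauchy-Schwarz, by summing [2 * c i * c j <= c i ^ 2 + c j ^ 2] with weights [q i * q j]. *)
Lemma sqr_sum_weighted (I : finType) (D : {set I}) (q c : I -> nat) :
  (\sum_(i in D) q i * c i) ^ 2 <= (\sum_(i in D) q i) * \sum_(i in D) q i * c i ^ 2.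
Proof.
rewrite -(leq_pmul2l (isT : 0 < 2)) expnS expn1.
have e : 2 * ((\sum_(i in D) q i) * \sum_(i in D) q i * c i ^ 2) =
    \sum_(i in D) \sum_(j in D) q i * q j * (c i ^ 2 + c j ^ 2).
  transitivity (\sum_(i in D) \sum_(j in D) (q i * (q j * c j ^ 2)) +
                \sum_(i in D) \sum_(j in D) (q j * (q i * c i ^ 2))).
    rewrite -big_distrlr /= exchange_big /= -big_distrlr /=; lia.
  rewrite -big_split; apply: eq_bigr => i _; rewrite -big_split; apply: eq_bigr => j _ /=; lia.
rewrite e big_distrlr /= big_distrr; apply: leq_sum => i _ /=.
rewrite big_distrr; apply: leq_sum => j _ /=.
have := nat_Cauchy (c i) (c j); move: (q i) (q j) (c i) (c j) => a b x y h.
by rewrite [q in q <= _](_ : _ = a * b * (2 * (x * y))); [rewrite leq_mul2l h orbT|lia].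
Qed.

Lemma sum_inj_leq (I J : finType) (h : I -> J) (Phi : J -> nat) : injective h ->
  \sum_(i : I) Phi (h i) <= \sum_(j : J) Phi j.
Proof.
move=> hi; rewrite (eq_bigl (mem [set: I])) => [|i]; last by rewrite /= inE.
rewrite -(big_imset (h := h) Phi) /=; last by move=> x y _ _; apply: hi.
by rewrite [leqRHS](bigID (mem (h @: setT))) /= leq_addr.
Qed.

Lemma sum_ffun3_pair (J : finType) (a a' : 'I_3) (Phi : J -> J -> nat) : a != a' ->
  \sum_(i : {ffun 'I_3 -> J}) Phi (i a) (i a') <= #|J| * \sum_(x : J) \sum_(y : J) Phi x y.
Proof.
move=> aa'.
have [e eP] : exists e : 'I_3, forall k, [|| k == a, k == a' | k == e].
  case: a a' aa' => [[|[|[|//]]] ?] [[|[|[|//]]] ?] //= _;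
    [exists (inord 2)|exists (inord 1)|exists (inord 2)|exists (inord 0)|exists (inord 1)|exists (inord 0)];
    by case=> [[|[|[|//]]] ?]; rewrite -?val_eqE /= ?inordK.
pose h (i : {ffun 'I_3 -> J}) := (i a, i a', i e).
have hi : injective h.
  by move=> f g [ea ea' ee]; apply/ffunP => k; case/or3P: (eP k) => /eqP->.
apply: leq_trans (sum_inj_leq (fun u => Phi u.1.1 u.1.2) hi) _.
rewrite -(pair_bigA _ (fun u z => Phi u.1 u.2)) /= -(pair_bigA _ (fun x y => \sum_(z : J) Phi x y)) /=.
rewrite big_distrr; apply: leq_sum => x _ /=; rewrite big_distrr; apply: leq_sum => y _ /=.
by rewrite sum_nat_const.
Qed.

Section PathSystem.
Variables (T : finType) (A : rel T) (F : {set T}).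
Hypotheses (Arefl : reflexive A) (Asym : symmetric A) (K33 : K33_crossing A).
Hypothesis linkedF : linked A F.

Definition nbrs f := #|[set g | A f g]|.
Implicit Types (f g : T) (X : {set T}).
Let q := nbrs.
Let W := vol q F.

(* One sample for each unit of weight, so that changing a single path changes
   the congestion by at most one. *)
Definition sample := {x in [pred x : T * T | (x.1 \in F) && A x.1 x.2]}.
Definition base (j : sample) := (val j).1.

Lemma base_mem j : base j \in F. Proof. by rewrite /base; case: j => x /= /andP[]. Qed.

Lemma sum_base (Phi : T -> nat) : \sum_(j : sample) Phi (base j) = \sum_(f in F) q f * Phi f.
Proof.
transitivity (\sum_(x : T * T | (x.1 \in F) && A x.1 x.2) Phi x.1).
  by rewrite (big_sub [pred x : T * T | (x.1 \in F) && A x.1 x.2] (fun x => Phi x.1)).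
rewrite -(pair_big_dep (fun x => x \in F) (fun x y => A x y) (fun x y => Phi x)) /=.
apply: eq_bigr => f _; rewrite sum_nat_const; congr (_ * _).
by rewrite /q /nbrs cardsE.
Qed.

Lemma card_sample : #|{: sample}| = W.
Proof. by rewrite -sum1_card (sum_base (fun=> 1)); apply: eq_bigr => f _; rewrite muln1. Qed.

(** Every ordered pair of samples is routed. Only a connected set is recorded, since length and
    congestion depend on nothing else. *)
Definition path_system (P : {ffun sample * sample -> {set T}}) :=
  [forall x, (P x \subset F) && joined A (P x) (base x.1) (base x.2)].

Definition congestion (P : {ffun sample * sample -> {set T}}) f := \sum_x (f \in P x : nat).

Definition energy P := \sum_(f in F) q f * congestion P f ^ 2.

Definition opt := [arg min_(P < [ffun=> F] | path_system P) energy P].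

Lemma optP : path_system opt /\ forall P, path_system P -> energy opt <= energy P.
Proof.
rewrite /opt; case: arg_minnP; last by move=> P sP Pmin; split.
apply/forallP => x; rewrite ffunE subxx.
by apply: (linkedP _ _ linkedF); apply: base_mem.
Qed.

Lemma opt_subset x : opt x \subset F.
Proof. by case: optP => /forallP/(_ x)/andP[]. Qed.

Lemma opt_joined x : joined A (opt x) (base x.1) (base x.2).
Proof. by case: optP => /forallP/(_ x)/andP[]. Qed.

Let c := congestion opt.
(** Up to the factor 2 this is the derivative of the energy in the congestion of [f], which makes
    the sets of an optimal system nearly shortest. *)
Definition flow_len f := q f * congestion opt f.

Lemma nbrs_gt0 f : 0 < q f.
Proof. by rewrite /q /nbrs card_gt0; apply/set0Pn; exists f; rewrite inE. Qed.

Lemma congestion_gt0 f : f \in F -> 0 < c f.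
Proof.
move=> fF; have ff : ((f, f).1 \in F) && A (f, f).1 (f, f).2 by rewrite fF Arefl.
pose j : sample := Sub (f, f) ff.
rewrite /c /congestion (bigD1 (j, j)) //=.
have /joined_meml : joined A (opt (j, j)) f f by have := opt_joined (j, j).
by move=> ->.
Qed.

(** Reroute the single pair [x] through [X]. Where the congestion [c] is at least 1, leaving [f]
    saves [2 * c - 1 >= c] and entering costs [2 * c + 1 <= 3 * c], each times [q f]; optimality
    compares the two. *)
Lemma opt_len x X : X \subset F -> joined A X (base x.1) (base x.2) ->
  \sum_(f in opt x) flow_len f <= 3 * \sum_(f in X) flow_len f.
Proof.
move=> XF jX; pose P := [ffun y => if y == x then X else opt y].
have sP : path_system P.
  apply/forallP => y; rewrite ffunE; case: eqP => [->|_]; first by rewrite XF.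
  by rewrite opt_subset opt_joined.
have [_ /(_ P sP) le] := optP.
have cP f : congestion P f + (f \in opt x) = c f + (f \in X).
  rewrite /c /congestion !(bigD1 (P := xpredT) x) //= ffunE eqxx.
  rewrite [X in _ + X + _](eq_bigr (fun y => (f \in opt y : nat))); last first.
    by move=> y /negPf yx; rewrite ffunE yx.
  by rewrite addnC addnCA addnC.
have sub (Y : {set T}) : Y \subset F -> \sum_(f in Y) flow_len f = \sum_(f in F) q f * ((f \in Y) * c f).
  move=> YF; rewrite [RHS](big_setID Y) (setIidPr YF) /= [X in _ = _ + X]big1 ?addn0.
    by apply: eq_bigr => f fY; rewrite fY mul1n.
  by move=> f; rewrite inE => /andP[/negPf->]; rewrite mul0n muln0.
rewrite !sub ?opt_subset // -(leq_add2l (energy P)).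
apply: leq_trans (_ : energy opt + 3 * \sum_(f in F) q f * ((f \in X) * c f) <= _); last by rewrite leq_add2r.
rewrite /energy big_distrr -!big_split; apply: leq_sum => f fF /=.
have := cP f; have := congestion_gt0 fF; rewrite -/c -/(c f).
move: (congestion P f) (c f) (q f) => c' c0 q0; clear.
case: (f \in opt x) => /=; case: (f \in X) => /=; rewrite ?addn0 ?addn1 => c00.
- by case=> ->; nia.
- by move=> <-; nia.
- by move=> ->; nia.
- by move=> ->; nia.
Qed.

Lemma sum_opt_len : \sum_x \sum_(f in opt x) flow_len f = energy opt.
Proof.
rewrite (eq_bigr (fun x => \sum_(f in F) (f \in opt x) * flow_len f)); last first.
  move=> x _; rewrite [RHS](big_setID (opt x)) (setIidPr (opt_subset x)) /= [X in _ = _ + X]big1 ?addn0.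
    by apply: eq_bigr => f fo; rewrite fo mul1n.
  by move=> f; rewrite inE => /andP[/negPf->].
rewrite exchange_big; apply: eq_bigr => f _ /=.
by rewrite -big_distrl /= /flow_len /energy -/c -/(c f) mulnCA mulnn.
Qed.

Lemma flow_len_sqr : (\sum_(f in F) flow_len f) ^ 2 <= W * energy opt.
Proof. exact: sqr_sum_weighted. Qed.

Let touch (X Y : {set T}) : nat := [exists f in X, exists g in Y, A f g].

(** A touching pair contains some adjacent [f], [g], so the count is at most the sum of [c f * c g]
    over adjacent pairs; the arithmetic-geometric inequality and the degrees [q] turn it into the
    energy. *)
Lemma touch_energy : \sum_x \sum_y touch (opt x) (opt y) <= energy opt.
Proof.
apply: (@leq_trans (\sum_(f in F) \sum_(g in F) A f g * (c f * c g))).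
  rewrite (eq_bigr (fun f => \sum_(g in F) \sum_x \sum_y A f g * ((f \in opt x) * (g \in opt y)))); last first.
    move=> f _; apply: eq_bigr => g _; rewrite /c /congestion big_distrlr /= big_distrr.
    by apply: eq_bigr => x _; rewrite big_distrr.
  under [leqRHS]eq_bigr do rewrite exchange_big /=.
  rewrite [leqRHS]exchange_big /=; apply: leq_sum => x _.
  under [leqRHS]eq_bigr do rewrite exchange_big /=.
  rewrite [leqRHS]exchange_big /=; apply: leq_sum => y _.
  rewrite /touch; case: existsP => // -[f /andP[fx /existsP[g /andP[gy fg]]]].
  rewrite (bigD1 f) ?(subsetP (opt_subset x)) //= (bigD1 g) ?(subsetP (opt_subset y)) //=.
  by rewrite fx gy fg.
rewrite -(leq_pmul2l (isT : 0 < 2)).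
apply: (@leq_trans (\sum_(f in F) \sum_(g in F) (A f g * c f ^ 2 + A f g * c g ^ 2))).
  rewrite big_distrr; apply: leq_sum => f _; rewrite big_distrr; apply: leq_sum => g _ /=.
  by have [cc _] := nat_Cauchy (c f) (c g); case: (A f g); rewrite ?mul0n ?muln0 ?mul1n.
under eq_bigr do rewrite big_split /=.
rewrite big_split /= [X in _ + X]exchange_big /= mul2n -addnn.
have le : \sum_(f in F) \sum_(g in F) A f g * c f ^ 2 <= energy opt.
  apply: leq_sum => f _; rewrite -big_distrl leq_mul2r; apply/orP; right.
  rewrite /q /nbrs -sum1_card big_mkcond [leqRHS]big_mkcond; apply: leq_sum => g _ /=.
  by rewrite inE; case: (g \in F); case: (A f g).
apply: leq_add => //; apply: leq_trans le; apply: leq_sum => f _; apply: leq_sum => g _.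
by rewrite Asym.
Qed.

(** Each of the [W ^ 6] choices of three and three samples has a touching pair of independent
    routes, at one of [6 * 6] positions. A given pair at a given position belongs to [W ^ 2]
    choices. *)
Lemma energy_ge : W ^ 4 <= 36 * energy opt.
Proof.
have [W0|W0] := posnP W; first by rewrite W0.
pose T4 := \sum_x \sum_y touch (opt x) (opt y).
pose D := [set a : 'I_3 * 'I_3 | a.1 != a.2].
have cD : #|D| = 6.
  rewrite cardsE -sum1_card big_mkcond -(pair_bigA _ (fun a b => if a != b then 1 else 0)) /=.
  by rewrite !big_ord_recl !big_ord0.
have : (W ^ 3) * (W ^ 3) <= 36 * (W * W * T4).
  have cf : #|{: {ffun 'I_3 -> sample}}| = W ^ 3 by rewrite card_ffun card_ord card_sample.
  have -> : W ^ 3 * W ^ 3 = \sum_(i : {ffun 'I_3 -> sample}) \sum_(j : {ffun 'I_3 -> sample}) 1.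
    by rewrite !sum_nat_const muln1 cf.
  apply: (@leq_trans (\sum_(i : {ffun 'I_3 -> sample}) \sum_(j : {ffun 'I_3 -> sample})
      \sum_(a in D) \sum_(b in D) touch (opt (i a.1, j b.1)) (opt (i a.2, j b.2)))).
    apply: leq_sum => i _; apply: leq_sum => j _.
    have [|a [a' [b [b' [u [v [aa' bb' uX vX uv]]]]]]] :=
      K33 (p := base \o i) (p' := base \o j) (X := fun a b => opt (i a, j b)).
      by move=> a b; apply: opt_joined.
    rewrite (bigD1 (a, a')) ?inE //= (bigD1 (b, b')) ?inE //= -addnA.
    apply: leq_trans (leq_addr _ _); rewrite /touch lt0b.
    by apply/existsP; exists u; rewrite uX; apply/existsP; exists v; rewrite vX.
  under eq_bigr do rewrite exchange_big /=.
  rewrite [leqLHS]exchange_big /=.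
  apply: (@leq_trans (\sum_(a in D) \sum_(b in D) (W * W * T4))); last first.
    by rewrite !sum_nat_const cD mulnA.
  apply: leq_sum => a aD; under eq_bigr do rewrite exchange_big /=.
  rewrite exchange_big; apply: leq_sum => b bD /=.
  rewrite !inE in aD bD.
  apply: leq_trans (sum_ffun3_pair (fun x x' => \sum_(j : {ffun 'I_3 -> sample})
    touch (opt (x, j b.1)) (opt (x', j b.2))) aD) _.
  rewrite card_sample -mulnA leq_mul2l; apply/orP; right.
  apply: (@leq_trans (\sum_x \sum_x' W * \sum_y \sum_y' touch (opt (x, y)) (opt (x', y')))).
    apply: leq_sum => x _; apply: leq_sum => x' _; rewrite -card_sample.
    exact: sum_ffun3_pair (fun y y' => touch (opt (x, y)) (opt (x', y'))) bD.
  under eq_bigr do rewrite -big_distrr /=.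
  rewrite -big_distrr /= leq_mul2l; apply/orP; right.
  have pairE (Psi : sample * sample -> nat) : \sum_u Psi u = \sum_x \sum_y Psi (x, y).
    by rewrite (pair_bigA _ (fun x y => Psi (x, y))); apply: eq_bigr => -[].
  rewrite /T4 pairE; apply: leq_sum => x _.
  rewrite exchange_big; apply: leq_sum => y _ /=.
  by rewrite pairE.
have := touch_energy; rewrite -/T4 => te h.
rewrite -(leq_pmul2l (_ : 0 < W * W)) ?muln_gt0 ?W0 //.
apply: leq_trans (_ : W ^ 3 * W ^ 3 <= _); first by rewrite !expnS !expn0; lia.
apply: leq_trans h _; rewrite mulnCA leq_mul2l; apply/orP; right.
by rewrite leq_mul2l te orbT.
Qed.

End PathSystem.

(** * Sparse cuts from an optimal path system *)

Section SparseCut.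
Variables (T : finType) (A : rel T).
Hypotheses (Arefl : reflexive A) (Asym : symmetric A) (K33 : K33_crossing A).
Implicit Types (F X Y Z : {set T}) (f g x : T).

Notation q := (nbrs A).

(* The second side of the cut is [F :\: (X :|: Z)]. *)
Definition sparse_cut C F X Z :=
  [/\ X \subset F /\ Z \subset F :\: X,
      {in X & F, forall x y, A x y -> y \in X :|: Z},
      X != F /\ X :|: Z != set0,
      #|Z| ^ 2 * vol q F <= C * vol q (X :|: Z) ^ 2 &
      #|Z| ^ 2 * vol q F <= C * vol q (F :\: X) ^ 2].

Lemma card_vol X : #|X| <= vol q X.
Proof. by rewrite -sum1_card; apply: leq_sum => f _; apply: nbrs_gt0. Qed.

Lemma unlinked_cut C F : ~~ linked A F -> exists X Z, sparse_cut C F X Z.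
Proof.
move=> /forall_inPn[x xF /forall_inPn[y yF nxy]].
exists [set z in F | joined A F x z], set0; split.
- by split; [apply/subsetP => z; rewrite inE => /andP[]|apply: sub0set].
- move=> u v; rewrite !inE orbF => /andP[uF xu] vF uv; rewrite vF /=.
  exact: joined_trans xu (joined_step uF vF uv).
- split; last by apply/set0Pn; exists x; rewrite !inE xF joined_refl.
  by apply: contraNneq nxy => e; move: yF; rewrite -{1}e inE => /andP[].
- by rewrite cards0.
- by rewrite cards0.
Qed.

Section Linked.
Variables (F : {set T}) (F0 : F != set0).
Hypothesis linkedF : linked A F.

Let om := flow_len A F.
Let E := energy (opt A F).
Let W := vol q F.
Let Omega := \sum_(f in F) om f.

Lemma vol_gt0 : 0 < W.
Proof. by apply: leq_trans (card_vol F); rewrite card_gt0. Qed.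

Lemma om_gt0 f : f \in F -> 0 < om f.
Proof.
by move=> fF; rewrite /om /flow_len muln_gt0 nbrs_gt0 ?congestion_gt0.
Qed.

Lemma sum_le_wt s X : {subset X <= s} -> \sum_(f in X) om f <= wt om s.
Proof.
elim: s X => [|x s IH] X Xs; first by rewrite /wt big_nil big_pred0 // => f; apply: contraTF isT => /Xs.
rewrite wt_cons; have [xX|xX] := boolP (x \in X).
  rewrite (big_setD1 x) //= leq_add2l; apply: IH => f.
  by rewrite !inE => /andP[/negPf fx /Xs]; rewrite inE fx.
apply: leq_trans (leq_addl _ _); apply: IH => f fX.
by have := Xs f fX; rewrite inE => /orP[/eqP fx|//]; rewrite -fx fX in xX.
Qed.

Section Root.
Variables (rho x0 : _) (rho0 : 0 < rho) (x0F : x0 \in F) (om_x0 : om x0 <= rho).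

(** Above the weight of every simple path, so that depths in the linked set [F] are finite, and
    above the radius [320 * rho]. *)
Let cap := (Omega + 320 * rho).+1.
Let phi := depth A om cap F [set x0].

Lemma phi_le f : f \in F -> phi f <= Omega.
Proof.
move=> fF; have /joinedP[s [sF ps ls]] := linkedP _ _ linkedF _ _ fF x0F.
have tl : touches A [set x0] (last f s).
  by apply/existsP; exists x0; rewrite inE -ls eqxx Arefl.
case/shortenP: ps tl => s' ps' us' s's tl.
have s'F : {subset f :: s' <= F}.
  move=> x; rewrite inE => /orP[/eqP->//|/s's xs]; apply: (allP sF).
  by rewrite inE xs orbT.
apply: leq_trans (depth_seq _ _ _ ps' tl) _; first by apply/allP.
rewrite /wt big_uniq //= /Omega [leqRHS](bigID (fun x => x \in f :: s')) /=.
apply: leq_trans (leq_addr _ _); apply: eq_leq; apply: eq_bigl => x.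
by apply/idP/andP => [xs|[]//]; rewrite s'F.
Qed.

Lemma set_to_root f : f \in F -> exists2 Y : {set T}, Y \subset F &
  joined A Y f x0 /\ \sum_(x in Y) om x <= phi f + rho.
Proof.
move=> fF; have := phi_le fF; rewrite /phi.
have [] := depth_reach A om cap F [set x0] f.
- rewrite inE => /eqP-> _; exists [set x0]; first by rewrite sub1set.
  by rewrite joined_refl ?inE // big_set1 (leq_trans om_x0) ?leq_addl.
- by move=> c l; have := leq_trans c l; rewrite /cap; clear; lia.
case=> s [sF ps tl ws] _; exists (x0 |: [set x in f :: s]).
  by rewrite subUset sub1set x0F; apply/subsetP => x; rewrite inE => /(allP sF).
split.
  have l : last f s \in x0 |: [set x in f :: s] by rewrite in_setU1 inE mem_last orbT.
  case/existsP: tl => y /andP[]; rewrite inE => /eqP-> al.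
  apply: joined_trans (joined_step l (setU11 _ _) al).
  by apply: joined_path ps; apply/allP => x xs; rewrite /= in_setU1 inE xs orbT.
apply: leq_trans (_ : wt om (x0 :: f :: s) <= _).
  by apply: sum_le_wt => x; rewrite in_setU1 [x \in [set _ in _]]inE inE.
by rewrite wt_cons addnC leq_add.
Qed.

(** By [opt_len] every optimal route is compared with the detour through the root [x0]; summing the
    route lengths gives the energy. *)
Lemma energy_le_phi :
  E <= 6 * (W * \sum_(f in F) q f * phi f) + 6 * (rho * W ^ 2).
Proof.
rewrite /E -(sum_opt_len linkedF).
apply: (@leq_trans (\sum_(x : sample A F * sample A F) 3 * (phi (base x.1) + phi (base x.2) + 2 * rho))).
  apply: leq_sum => x _.
  have [Y1 Y1F [j1 w1]] := set_to_root (base_mem x.1).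
  have [Y2 Y2F [j2 w2]] := set_to_root (base_mem x.2).
  have YF : Y1 :|: Y2 \subset F by rewrite subUset Y1F.
  have jY : joined A (Y1 :|: Y2) (base x.1) (base x.2).
    apply: joined_trans (joined_subset (subsetUl _ _) j1) _.
    by apply: joined_subset (subsetUr _ _) _; rewrite joined_sym.
  apply: leq_trans (opt_len Arefl linkedF YF jY) _; rewrite leq_mul2l /=.
  apply: (@leq_trans (\sum_(f in Y1) om f + \sum_(f in Y2) om f)); last first.
    by apply: leq_trans (leq_add w1 w2) _; rewrite addnACA mul2n -addnn leqnn.
  rewrite [leqLHS](big_setID Y1) /= setUK leq_add2l.
  rewrite [leqRHS](big_setID Y1) /= setDUl setDv set0U leq_addl //.
rewrite -big_distrr /= big_split /= sum_nat_const card_prod !card_sample -/W.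
rewrite -(pair_bigA _ (fun x y : sample A F => phi (base x) + phi (base y))) /=.
have -> : \sum_(i : sample A F) \sum_(j : sample A F) (phi (base i) + phi (base j)) =
    2 * (W * \sum_(f in F) q f * phi f).
  rewrite (eq_bigr (fun i : sample A F => W * phi (base i) + \sum_(f in F) q f * phi f)) => [|i _]; last first.
    by rewrite big_split /= sum_nat_const card_sample sum_base.
  by rewrite big_split /= -big_distrr /= sum_base sum_nat_const card_sample -/W addnn mul2n.
by rewrite expnS expn1; clear; lia.
Qed.

(** A large energy forces a large mean distance from [x0], so much weight lies at levels beyond the
    heavy ball. Among these levels one has a sphere that is small compared with the weight outside
    it, while the inside keeps the ball. *)
Lemma ball_cut kappa : 2000 <= kappa -> kappa * rho * W ^ 2 <= E ->
  Omega ^ 2 <= 144 * kappa ^ 2 * rho ^ 2 * W ->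
  ~~ light q F (near A om cap F [set x0] (320 * rho)) ->
  exists X Z, sparse_cut (400 * (144 * kappa ^ 2)) F X Z.
Proof.
move=> k2000 E_ge Om2 nl; have W0 := vol_gt0.
have Om0 : 0 < Omega.
  by rewrite /Omega (big_setD1 x0) //= ltn_addr ?om_gt0.
pose r := 320 * rho; pose S := \sum_(f in F) q f * phi f.
(* From [kappa >= 2000] and [energy_le_phi]: [(2000 - 6) / 6 > 332], which exceeds the radius factor
   320 by 12. *)
have S_ge : 332 * rho * W <= S.
  have h := leq_trans E_ge energy_le_phi; rewrite -/S in h.
  have h2 : 2000 * (rho * W ^ 2) <= kappa * rho * W ^ 2 by rewrite -mulnA leq_mul2r k2000 orbT.
  rewrite -(leq_pmul2l W0); move: h h2; rewrite expnS expn1.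
  rewrite [_ * (332 * _ * _)](_ : _ = 332 * (rho * (W * W))); last by clear; lia.
  by move: (W * S) (rho * (W * W)) (kappa * _ * _) => a b d; clear; lia.
pose St t := [set f in F | t <= phi f].
pose Zt t := sphere om phi F t.
have sumSt : \sum_(r.+1 <= t < Omega.+1) vol q (St t) = \sum_(f in F) q f * (phi f - r).
  transitivity (\sum_(r.+1 <= t < Omega.+1) \sum_(f in F) q f * (t <= phi f)).
    apply: eq_bigr => t _; rewrite /vol big_mkcond [RHS]big_mkcond; apply: eq_bigr => f _.
    by rewrite inE; case: (f \in F); case: (t <= phi f); rewrite /= ?muln1 ?muln0.
  rewrite exchange_big; apply: eq_bigr => f fF /=; rewrite -big_distrr /=; congr (_ * _).
  have le := phi_le fF; have [pr|rp] := leqP (phi f) r.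
    rewrite big_nat big1 => [|t /andP[rt _]]; first by rewrite (eqP (pr : phi f - r == 0)).
    by rewrite leqNgt (leq_ltn_trans pr).
  rewrite (@big_cat_nat _ _ _ (phi f).+1) ?ltnS ?(ltnW rp) //=.
  rewrite [X in _ + X]big_nat [X in _ + X]big1 ?addn0; last first.
    by move=> t /andP[pt _]; rewrite leqNgt pt.
  rewrite big_nat (eq_bigr (fun=> 1)) => [|t /andP[_]]; last by rewrite ltnS => ->.
  by rewrite -big_nat sum_nat_const_nat muln1 subSS.
have St_ge : 12 * rho * W <= \sum_(r.+1 <= t < Omega.+1) vol q (St t).
  rewrite sumSt.
  have : S <= \sum_(f in F) q f * (phi f - r) + r * W.
    rewrite [r * W]mulnC /W /vol big_distrl -big_split; apply: leq_sum => f _ /=.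
    by rewrite -mulnDr leq_mul2l; apply/orP; right; clear; lia.
  by rewrite /r; move: S_ge; clear; lia.
(* Otherwise summing over the levels beyond [r], with spheres of total size at most [Omega], would
   give [12 * rho * W <= rho * W]. *)
have [t [rt vt ct]] : exists t, [/\ r < t, 0 < vol q (St t) &
    #|Zt t| * (rho * W) <= Omega * vol q (St t)].
  apply: contrapT => none.
  have le t : r < t -> Omega * vol q (St t) <= #|Zt t| * (rho * W).
    move=> rt; have [->|vt] := posnP (vol q (St t)); first by rewrite muln0.
    by rewrite ltnW // ltnNge; apply/negP => h; apply: none; exists t.
  have : Omega * (\sum_(r.+1 <= t < Omega.+1) vol q (St t)) <= Omega * (rho * W).
    apply: (@leq_trans ((\sum_(r.+1 <= t < Omega.+1) #|Zt t|) * (rho * W))); last first.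
      by rewrite leq_mul2r sum_sphere orbT.
    rewrite big_distrr big_distrl big_nat [leqRHS]big_nat; apply: leq_sum => t /andP[rt _] /=.
    exact: le.
  rewrite leq_pmul2l // => /(leq_trans St_ge).
  have : 0 < rho * W by rewrite muln_gt0 rho0.
  by clear; lia.
exists [set f in F | phi f < t], (Zt t).
have eS : F :\: [set f in F | phi f < t] = St t.
  by apply/setP => f; rewrite !inE; case: (f \in F); rewrite /= ?andbF ?andbT // -leqNgt.
have Zsq m : #|Zt t| * (rho * W) <= Omega * m -> #|Zt t| ^ 2 * W <= 144 * kappa ^ 2 * m ^ 2.
  move=> h; rewrite -(leq_pmul2l (_ : 0 < rho ^ 2 * W)) ?muln_gt0 ?expn_gt0 ?rho0 //.
  apply: (@leq_trans (Omega ^ 2 * m ^ 2)).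
    by have := leq_mul h h; rewrite !mulnn !expnMn; clear; lia.
  by apply: leq_trans (leq_mul Om2 (leqnn _)) _; clear; lia.
(* The ball has at least [W / 20] of the weight; squaring produces the factor 400. *)
have nearX : near A om cap F [set x0] r \subset [set f in F | phi f < t] :|: Zt t.
  apply/subsetP => f; rewrite !inE => /andP[-> d] /=.
  by rewrite (leq_ltn_trans d rt).
have vn : W <= 20 * vol q ([set f in F | phi f < t] :|: Zt t).
  by move: nl (vol_subset q nearX); rewrite /light -/W -/r; clear; lia.
have WF : vol q (St t) <= W by apply: vol_subset; apply/subsetP => f; rewrite inE => /andP[].
split; rewrite -/W ?eS.
- split; first by apply/subsetP => f; rewrite inE => /andP[].
  by apply/subsetP => f; rewrite !inE => /andP[-> /andP[->]].
- move=> u v; rewrite !inE => /andP[uF pu] vF uv; rewrite vF /=.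
  rewrite Asym in uv; have := depth_lip om cap [set x0] vF uF uv; rewrite -/phi.
  by move: pu; clear; lia.
- split; last by apply: contraTneq vn => ->; rewrite /vol big_set0; move: W0; clear; lia.
  by apply: contraTneq vt => e; rewrite -eS e setDv /vol big_set0.
- have := Zsq W (leq_trans ct (leq_mul (leqnn _) WF)).
  move/leq_trans; apply; rewrite -(mulnA 400) [leqRHS]mulnCA leq_mul2l; apply/orP; right.
  by have := leq_mul vn vn; rewrite !mulnn expnMn.
by apply: leq_trans (Zsq _ ct) _; rewrite leq_mul2r leq_pmull ?orbT.
Qed.

End Root.

(* The length of an edge is its weight times its congestion in an optimal path system.
   By [energy_ge] the average distance is at least of the order of [Omega / sqrt W]; [rho] is a
   small constant fraction of it. *)
Lemma linked_cut kappa : 2000 <= kappa -> 36 * kappa <= W ^ 2 ->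
  exists X Z, sparse_cut (36 * 400 * (144 * kappa ^ 2)) F X Z.
Proof.
move=> k2000 W2; apply: contrapT => none; have W0 := vol_gt0.
have kW0 : 0 < kappa * W ^ 2 by rewrite muln_gt0 expn_gt0 W0 (leq_trans _ k2000).
(* Integer division: by [energy_ge] and [36 * kappa <= W ^ 2] the quotient is positive, so rounding
   loses at most a factor 2. *)
pose rho := E %/ (kappa * W ^ 2).
have E_ge : W ^ 4 <= 36 * E := energy_ge Asym K33 linkedF.
have rho0 : 0 < rho.
  rewrite divn_gt0 // -(leq_pmul2l (isT : 0 < 36)); apply: leq_trans E_ge.
  by rewrite mulnA (expnD W 2 2) leq_mul2r W2 orbT.
have rhoE : kappa * rho * W ^ 2 <= E.
  by rewrite mulnAC mulnC leq_trunc_div.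
have Erho : E <= 2 * kappa * rho * W ^ 2.
  have := ltn_ceil E kW0; rewrite -/rho => /ltnW/leq_trans; apply.
  apply: (@leq_trans (2 * rho * (kappa * W ^ 2))); last by clear; lia.
  by rewrite leq_mul2r; apply/orP; right; move: rho0; clear; lia.
have W2rho : W ^ 2 <= 72 * kappa * rho.
  rewrite -(leq_pmul2r (_ : 0 < W ^ 2)) ?expn_gt0 ?W0 // -expnD.
  apply: leq_trans E_ge _; apply: leq_trans (leq_mul (leqnn 36) Erho) _.
  by clear; lia.
(* [Omega ^ 2 <= W * E], then [E <= 2 * kappa * rho * W ^ 2], then [W ^ 2 <= 72 * kappa * rho]. *)
have Om2 : Omega ^ 2 <= 144 * kappa ^ 2 * rho ^ 2 * W.
  apply: leq_trans (flow_len_sqr A F) _; apply: leq_trans (leq_mul (leqnn _) Erho) _.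
  apply: leq_trans (leq_mul (leqnn _) (leq_mul (leqnn _) W2rho)) _.
  by rewrite -/W; clear; lia.
(* A region with no light side is already a sparse cut: [#|Z| <= 6 * Omega / rho] gives the factor
   36, and sides of at least [W / 20] give 400. *)
have haven X Z : region A om rho F 6 X Z -> light q F (X :|: Z) \/ light q F (F :\: X).
  case=> XF ZF bX cZ; apply: contrapT => /not_orP[/negP n1 /negP n2]; apply: none; exists X, Z.
  have cW : #|Z| ^ 2 <= 36 * (144 * kappa ^ 2 * W).
    rewrite -(leq_pmul2r (_ : 0 < rho ^ 2)) ?expn_gt0 ?rho0 // -expnMn.
    have := leq_mul cZ cZ; rewrite !mulnn => /leq_trans; apply.
    rewrite expnMn -mulnA leq_mul2l /=; apply: leq_trans Om2 _; clear; lia.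
  have vv m : ~~ (20 * m < W) -> #|Z| ^ 2 * W <= 36 * 400 * (144 * kappa ^ 2) * m ^ 2.
    rewrite -leqNgt => Wm; apply: leq_trans (leq_mul cW (leqnn W)) _.
    have := leq_mul Wm Wm; rewrite !mulnn expnMn => h.
    rewrite -mulnA -[_ * W * W]mulnA mulnn -(mulnA (36 * 400)) mulnCA [leqRHS]mulnCA leq_mul2l.
    by apply/orP; right; move: h; move: (W ^ 2) (m ^ 2) => a b; clear; lia.
  split=> //; rewrite -/W.
  - split.
      apply: contraNneq n2 => ->; by rewrite /light setDv /vol big_set0.
    by apply: contraNneq n1 => ->; rewrite /light /vol big_set0.
  - exact: vv.
  - exact: vv.
apply: (no_haven (q := q) (cap := (Omega + 320 * rho).+1) Arefl Asym W0 rho0 _ haven) => //.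
  by rewrite ltnS leq_addl.
move=> x xF xrho; apply: contrapT => /negP nl; apply: none.
have [X [Z [h1 h2 h3 h4 h5]]] := ball_cut rho0 xF xrho k2000 rhoE Om2 nl.
have le m : 400 * (144 * kappa ^ 2) * m <= 36 * 400 * (144 * kappa ^ 2) * m.
  by rewrite -[36 * 400 * _]mulnA -[36 * _ * _]mulnA leq_pmull.
exists X, Z; split=> //; [exact: leq_trans h4 (le _)|exact: leq_trans h5 (le _)].
Qed.

End Linked.

Lemma exists_sparse_cut_const kappa F : 2000 <= kappa -> F != set0 ->
  exists X Z, sparse_cut (36 * 400 * (144 * kappa ^ 2)) F X Z.
Proof.
move=> k2000 F0; have [lF|/unlinked_cut//] := boolP (linked A F).
have [W2|W2] := leqP (36 * kappa) (vol q F ^ 2); first exact: linked_cut.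
(* The weight is bounded by a constant here, and the whole of [F] can serve as separator. *)
have cF := card_vol F; have v0 := vol_gt0 F0.
have vC : #|F| ^ 2 * vol q F <= 36 * 400 * (144 * kappa ^ 2) * vol q F ^ 2.
  have vk : vol q F <= 36 * 400 * (144 * kappa ^ 2).
    by move: W2; rewrite !expnS !expn0 ?muln1; move: k2000 v0; clear; nia.
  apply: leq_trans (_ : vol q F ^ 2 * vol q F <= _); first by rewrite leq_mul2r leq_exp2r // cF orbT.
  by rewrite mulnC leq_mul2r vk orbT.
exists set0, F; rewrite /sparse_cut set0U !setD0; split=> //.
- by split; [apply: sub0set|].
- by split=> //; rewrite eq_sym.
Qed.

End SparseCut.

Theorem exists_sparse_cut : exists C, forall (T : finType) (A : rel T),
  reflexive A -> symmetric A -> K33_crossing A ->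
  forall F : {set T}, F != set0 -> exists X Z, sparse_cut A C F X Z.
Proof.
exists (36 * 400 * (144 * 2000 ^ 2)) => T A Arefl Asym K33 F F0.
exact: exists_sparse_cut_const.
Qed.

(** * Ordering the vertices *)

Section RealArithmetic.
Import Order.TTheory GRing.Theory Num.Theory.
Local Open Scope ring_scope.
Variable R : realFieldType.

(** With [r] and [r1] the roots of the weights of a set and of one side,
    [Z <= c * M / r <= 2 * c * (r - r1)]. *)
Lemma sqrt_telescope (c r r1 D Z M : R) : 0 <= c -> 0 < r -> r1 <= r ->
  M = (r - r1) * (r + r1) -> Z * r <= c * M -> D <= 2 * c * r1 ->
  D + Z <= 2 * c * r.
Proof.
move=> c0 r0 r1r e zr dr; rewrite -(ler_pM2r r0).
have : c * M <= c * ((r - r1) * (2 * r)).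
  by rewrite e ler_wpM2l // ler_wpM2l ?subr_ge0 // mulr_natl mulr2n lerD2l.
have : D * r <= 2 * c * r1 * r by rewrite ler_wpM2r // ltW.
by move: zr; nra.
Qed.

(** [Z ^ 2] contributes [c ^ 2 * M] and [2 * D] contributes [8 * c ^ 2 * M]. *)
Lemma sqrt_crossings (c r D Z M : R) : 0 <= c -> 0 <= Z ->
  Z <= c * r -> Z * r <= c * M -> D <= 2 * (Z * (2 * c * r)) ->
  Z ^+ 2 + 2 * D <= 9 * c ^+ 2 * M.
Proof.
move=> c0 z0 zcr zr dz.
have : Z * Z <= Z * (c * r) by rewrite ler_wpM2l.
have : c * (Z * r) <= c * (c * M) by rewrite ler_wpM2l.
by rewrite !expr2; move: dz; lra.
Qed.

End RealArithmetic.

(** * The recursive order and its interleaving pairs *)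

Section Ordering.
Variables (R : rcfType) (V T : finType) (A : rel T) (a b : T -> V) (C : nat).
Hypotheses (A_end : forall f g, [|| a f == a g, a f == b g, b f == a g | b f == b g] -> A f g)
  (sparse : forall F : {set T}, F != set0 -> exists X Z, sparse_cut A C F X Z).
Implicit Types (s : seq V) (f g : T) (u v : V) (F X Y Z : {set T}).

Definition between s f u :=
  (minn (index (a f) s) (index (b f) s) < index u s) &&
  (index u s < maxn (index (a f) s) (index (b f) s)).

Definition crosses s f g := [&& a f != a g, a f != b g, b f != a g, b f != b g &
  between s f (a g) != between s f (b g)].

Definition crossing_count s F := \sum_(f in F) \sum_(g in F) (crosses s f g : nat).

(** An edge interleaves only with edges that pass over one of its ends, so this number limits what a
    separator edge can cross. *)
Definition nesting s F u := \sum_(f in F) (between s f u : nat).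

Lemma crosses_sym s f g : a f \in s -> b f \in s -> a g \in s -> b g \in s ->
  crosses s f g = crosses s g f.
Proof.
move=> af bf ag bg; rewrite /crosses /between (eq_sym (a g) (a f)) (eq_sym (a g) (b f)) (eq_sym (b g) (a f)) (eq_sym (b g) (b f)).
have neq x y : x \in s -> y \in s -> x != y -> index x s != index y s.
  by move=> xs ys; apply: contraNneq => e; rewrite -(nth_index x xs) e nth_index.
case E1: (a f == a g) => //=; case E2: (a f == b g); rewrite /= ?andbF //.
case E3: (b f == a g); rewrite /= ?andbF //; case E4: (b f == b g); rewrite /= ?andbF //.
have := neq _ _ af ag (negbT E1); have := neq _ _ af bg (negbT E2).
have := neq _ _ bf ag (negbT E3); have := neq _ _ bf bg (negbT E4).
by clear; move: (index (a f) s) (index (b f) s) (index (a g) s) (index (b g) s) => i j k l; lia.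
Qed.

Lemma between_mem s f u : a f \in s -> b f \in s -> between s f u -> u \in s.
Proof.
rewrite -!index_mem /between => af bf /andP[_ h]; apply: leq_trans h _.
by rewrite geq_max (ltnW af) (ltnW bf).
Qed.

Lemma between_catl s s' f u : a f \in s -> b f \in s -> between (s ++ s') f u = between s f u.
Proof.
move=> af bf; rewrite /between !index_cat af bf; case: ifPn => // us.
have := index_size u s; rewrite leq_eqVlt index_mem (negbTE us) orbF => /eqP->.
move: af bf; rewrite -!index_mem; clear.
by move: (index (a f) s) (index (b f) s) => i j; lia.
Qed.

Lemma between_catr s s' f u : a f \in s' -> b f \in s' -> ~~ has (mem s) s' ->
  between (s ++ s') f u = between s' f u.
Proof.
move=> af bf /hasPn ss'; rewrite /between !index_cat.
have /negPf-> : a f \notin s := ss' _ af.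
have /negPf-> : b f \notin s := ss' _ bf.
case: ifPn => us; last first.
  by clear; move: (index (a f) s') (index (b f) s') (index u s') => i j k; lia.
have us' : u \notin s' by apply: contraL us => /ss'.
have := index_size u s'; rewrite leq_eqVlt index_mem (negbTE us') orbF => /eqP->.
move: us af bf; rewrite -!index_mem; clear.
by move: (index (a f) s') (index (b f) s') (index u s) => i j k; lia.
Qed.

Definition log_weight w := w * (trunc_log 2 w).+1.

(** The lighter side [x] at least doubles on passing to the whole and gains a unit of logarithm;
    each of the [z] units weighs at least 1 in the whole. *)
Lemma log_weightD x y z : log_weight x + log_weight y + minn (x + z) (y + z) <=
  log_weight (x + y + z).
Proof.
wlog xy : x y / x <= y.
  by move=> H; have [/H//|/ltnW/H] := leqP x y; rewrite minnC [y + x]addnC [log_weight y + _]addnC.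
rewrite (minn_idPl _) ?leq_add2r //; set w := x + y + z.
have Ly : trunc_log 2 y <= trunc_log 2 w by apply: leq_trunc_log; rewrite /w; lia.
have [->|x0] := posnP x.
  rewrite /log_weight /w mul0n; move: Ly; rewrite /w; nia.
have Lx : (trunc_log 2 x).+1 <= trunc_log 2 w.
  by rewrite -trunc_log2_double //; apply: leq_trunc_log; rewrite /w; lia.
rewrite /log_weight; move: Lx Ly; move: (trunc_log 2 x) (trunc_log 2 y) (trunc_log 2 w) => i j k.
by rewrite /w; clear w; nia.
Qed.

Notation q := (nbrs A).

Section RealBounds.
Import Order.TTheory GRing.Theory Num.Theory.
Local Open Scope ring_scope.
Variables (z m w w1 : nat).
Hypotheses (w0 : (0 < w)%N) (wm : (w = w1 + m)%N) (zw : (z ^ 2 * w <= C * m ^ 2)%N).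

Lemma cut_sqrt : z%:R * Num.sqrt w%:R <= Num.sqrt C%:R * m%:R :> R.
Proof.
have s0 (k : nat) : 0 <= Num.sqrt (k%:R : R) by apply: sqrtr_ge0.
have sq (k : nat) : Num.sqrt (k%:R : R) ^+ 2 = k%:R by apply: sqr_sqrtr; apply: ler0n.
rewrite -(@ler_pXn2r _ 2) ?nnegrE ?mulr_ge0 ?s0 ?ler0n // !exprMn !sq.
by rewrite -!natrX -!natrM ler_nat.
Qed.

Lemma cut_le : z%:R <= Num.sqrt C%:R * Num.sqrt w%:R :> R.
Proof.
have r0 : 0 < Num.sqrt (w%:R : R) by rewrite sqrtr_gt0 ltr0n.
rewrite -(ler_pM2r r0); apply: le_trans cut_sqrt _; rewrite -mulrA -expr2 sqr_sqrtr ?ler0n //.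
by rewrite ler_wpM2l ?sqrtr_ge0 // ler_nat wm leq_addl.
Qed.

Lemma nesting_step (d : nat) : d%:R <= 2 * Num.sqrt C%:R * Num.sqrt w1%:R :> R ->
  (d + z)%:R <= 2 * Num.sqrt C%:R * Num.sqrt w%:R :> R.
Proof.
move=> dr; rewrite natrD.
have r0 : 0 < Num.sqrt (w%:R : R) by rewrite sqrtr_gt0 ltr0n.
apply: (sqrt_telescope (sqrtr_ge0 _) r0 _ _ cut_sqrt dr).
  by rewrite ler_sqrt ?ltr0n // ler_nat wm leq_addr.
by rewrite -subr_sqr !sqr_sqrtr ?ler0n // wm natrD addrAC subrr add0r.
Qed.

Lemma crossing_step (d : nat) : d%:R <= 2 * (z%:R * (2 * Num.sqrt C%:R * Num.sqrt w%:R)) :> R ->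
  (z ^ 2 + 2 * d <= 9 * C * m)%N.
Proof.
move=> dz; rewrite -(ler_nat R) natrD natrX !natrM -(@sqr_sqrtr R C%:R) ?ler0n //.
exact: sqrt_crossings (sqrtr_ge0 _) (ler0n _ _) cut_le cut_sqrt dz.
Qed.

End RealBounds.

Lemma sum_setU (Phi : T -> nat) X Y : [disjoint X & Y] ->
  \sum_(f in X :|: Y) Phi f = \sum_(f in X) Phi f + \sum_(f in Y) Phi f.
Proof.
move=> dXY; rewrite (big_setID X) /= setUK; congr (_ + _); apply: eq_bigl => f.
by rewrite !inE; have := disjointFr dXY (x := f); case: (f \in X) => //= ->.
Qed.

(** The nesting bound is part of the induction because it controls the interleavings of the
    separator with both sides. *)
Lemma exists_order n F : #|F| <= n -> exists s, [/\ uniq s,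
  {in F, forall f, a f \in s /\ b f \in s},
  {in s, forall v, exists2 f, f \in F & v \in [:: a f; b f]},
  forall u, ((nesting s F u)%:R <= 2 * Num.sqrt C%:R * Num.sqrt (vol q F)%:R :> R)%R &
  crossing_count s F <= 9 * C * log_weight (vol q F)].
Proof.
elim: n F => [|n IH] F.
  rewrite leqn0 cards_eq0 => /eqP->; exists [::]; split=> //.
  - by move=> f; rewrite inE.
  - move=> u; rewrite /nesting big_set0; apply: Num.Theory.mulr_ge0; last exact: Num.Theory.sqrtr_ge0.
    by apply: Num.Theory.mulr_ge0; rewrite ?Num.Theory.ler0n ?Num.Theory.sqrtr_ge0.
  - by rewrite /crossing_count big_set0.
have [->|F0] := eqVneq F set0; first by move=> _; apply: IH; rewrite cards0.
move=> Fn; have [X [Z [[XF ZF] bX [nXF XZ0] c1 c2]]] := sparse F0.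
pose Y := F :\: (X :|: Z).
have ZF' : Z \subset F by apply: subset_trans ZF _; apply: subsetDl.
have XltF : #|X| < #|F| by apply: proper_card; rewrite properEneq nXF.
have YltF : #|Y| < #|F|.
  rewrite /Y cardsD (setIidPr _) ?subUset ?XF // ltn_subrL !card_gt0 XZ0 /=.
  by apply/set0Pn; case/set0Pn: F0 => x; exists x.
have [s1 [u1 e1 m1 d1 n1]] := IH X (ltnSE (leq_trans XltF Fn)).
have [s2 [u2 e2 m2 d2 n2]] := IH Y (ltnSE (leq_trans YltF Fn)).
have dXZ : [disjoint X & Z].
  rewrite disjoint_sym -setI_eq0; apply/eqP/setP => x; rewrite !inE.
  by apply/andP => -[/(subsetP ZF)]; rewrite inE => /andP[/negPf->].
have eF : F = (X :|: Z) :|: Y.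
  have XZF : X :|: Z \subset F by rewrite subUset XF.
  apply/setP => x; rewrite [x \in _ :|: Y]in_setU [x \in Y]in_setD.
  by case: (boolP (x \in X :|: Z)) => // /(subsetP XZF).
have dXZY : [disjoint X :|: Z & Y].
  by rewrite -setI_eq0; apply/eqP/setP => x; rewrite in_setI in_setD in_set0 andbA andbN.
have vXZ : vol q (X :|: Z) = vol q X + vol q Z by apply: sum_setU.
have vF : vol q F = vol q X + vol q Z + vol q Y by rewrite {1}eF -vXZ; apply: sum_setU.
have vFX : vol q (F :\: X) = vol q Y + vol q Z.
  by have := volD q XF; rewrite vF; clear; lia.
have w0 : 0 < vol q F by apply: vol_gt0 => // f; apply: A_end; rewrite eqxx.
(* The ends of separator edges that belong to no edge of the two sides come last. *)
pose s3 := [seq v <- undup (flatten [seq [:: a f; b f] | f <- enum Z]) | v \notin s1 ++ s2].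
(* A common end would make an edge of [X] adjacent to one of [Y], although the neighbours of [X] in
   [F] lie in [X :|: Z]. *)
have s12 : ~~ has (mem s1) s2.
  apply/hasPn => v /m2[g gY vg]; apply/negP => /m1[f fX vf].
  have fg : A f g.
    apply: A_end; move: vf vg; rewrite !inE => /orP[]/eqP-> /orP[]/eqP->; rewrite eqxx ?orbT //.
  have gF : g \in F by move: gY; rewrite inE => /andP[].
  by have := bX _ _ fX gF fg; move: gY; rewrite inE => /andP[/negPf->].
have s123 : ~~ has (mem (s1 ++ s2)) s3 by apply/hasPn => v; rewrite mem_filter => /andP[].
pose s := (s1 ++ s2) ++ s3.
have us : uniq s.
  by rewrite /s !cat_uniq u1 u2 s12 s123 /s3 filter_uniq ?undup_uniq.
have es : {in F, forall f, a f \in s /\ b f \in s}.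
  move=> f; rewrite eF !in_setU => /orP[/orP[/e1|fZ]|/e2].
  - by case=> fa fb; rewrite /s !mem_cat fa fb.
  - rewrite /s !mem_cat; suff H v : v \in [:: a f; b f] -> v \in (s1 ++ s2) ++ s3.
      by rewrite -!mem_cat !H // !inE eqxx ?orbT.
    move=> vf; rewrite mem_cat mem_filter mem_undup; case: (v \in s1 ++ s2) => //=.
    by apply/flattenP; exists [:: a f; b f] => //; apply/mapP; exists f; rewrite ?mem_enum.
  - by case=> fa fb; rewrite /s !mem_cat fa fb !orbT.
have ms : {in s, forall v, exists2 f, f \in F & v \in [:: a f; b f]}.
  move=> v; rewrite /s !mem_cat => /orP[/orP[/m1|/m2]|].
  - by case=> f fX vf; exists f => //; apply: (subsetP XF).
  - by case=> f; rewrite inE => /andP[_ fF] vf; exists f.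
  - rewrite mem_filter mem_undup => /andP[_ /flattenP[l /mapP[f]]].
    by rewrite mem_enum => fZ -> vf; exists f => //; apply: (subsetP ZF').
have bX1 f u : f \in X -> between s f u = between s1 f u.
  by move=> /e1[fa fb]; rewrite /s -catA between_catl.
have bY2 f u : f \in Y -> between s f u = between s2 f u.
  by move=> /e2[fa fb]; rewrite /s between_catl ?mem_cat ?fa ?fb ?orbT // between_catr.
have split_sum (Phi : T -> nat) : \sum_(f in F) Phi f =
    \sum_(f in X) Phi f + \sum_(f in Z) Phi f + \sum_(f in Y) Phi f.
  by rewrite {1}eF !sum_setU.
(* At most one of the two terms is nonzero, since [s1] and [s2] occupy disjoint intervals. *)
pose D u := nesting s1 X u + nesting s2 Y u.
have nF u : nesting s F u <= D u + #|Z|.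
  rewrite /D /nesting split_sum addnAC; apply: leq_add; first apply: leq_add.
  - by apply: leq_sum => f /bX1->.
  - by apply: leq_sum => f /bY2->.
  by rewrite -sum1_card; apply: leq_sum => f _; apply: leq_b1.
have out1 u : u \notin s1 -> nesting s1 X u = 0.
  move=> us1; rewrite /nesting big1 // => f /e1[fa fb].
  by apply/eqP; rewrite eqb0; apply: contra us1; apply: between_mem.
have out2 u : u \notin s2 -> nesting s2 Y u = 0.
  move=> us2; rewrite /nesting big1 // => f /e2[fa fb].
  by apply/eqP; rewrite eqb0; apply: contra us2; apply: between_mem.
have vX : vol q F = vol q X + vol q (F :\: X) by rewrite vFX vF; clear; lia.
have vY : vol q F = vol q Y + vol q (X :|: Z) by rewrite vXZ vF; clear; lia.
have DZ u : ((D u + #|Z|)%:R <= 2 * Num.sqrt C%:R * Num.sqrt (vol q F)%:R :> R)%R.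
  rewrite /D; have [us1|us1] := boolP (u \in s1).
    rewrite (out2 u); last by apply: contraL us1 => us2; apply: (hasPn s12).
    by rewrite addn0; exact (nesting_step w0 vX c2 (d1 u)).
  by rewrite (out1 u us1) add0n; exact (nesting_step w0 vY c1 (d2 u)).
exists s; split=> //.
  by move=> u; apply: Order.POrderTheory.le_trans (DZ u); rewrite Num.Theory.ler_nat.
have cz f g : crosses s f g -> between s f (a g) || between s f (b g).
  by case/and5P=> _ _ _ _; case: (between s f (a g)); case: (between s f (b g)).
(* Interleavings of the separator with the two sides, bounded through both ends of each separator
   edge. *)
pose NZ := \sum_(z in Z) (D (a z) + D (b z)).
have XZ_count : \sum_(f in X) \sum_(z in Z) (crosses s f z : nat) +
    \sum_(f in Y) \sum_(z in Z) (crosses s f z : nat) <= NZ.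
  rewrite exchange_big [X in _ + X]exchange_big -big_split; apply: leq_sum => z _ /=.
  rewrite /D addnACA; apply: leq_add; rewrite /nesting -big_split; apply: leq_sum => f fX /=.
    rewrite -!(bX1 f _ fX); have := cz f z; case: (crosses s f z) => //= /(_ isT).
    by case: (between _ _ _); case: (between _ _ _).
  rewrite -!(bY2 f _ fX); have := cz f z; case: (crosses s f z) => //= /(_ isT).
  by case: (between _ _ _); case: (between _ _ _).
have csym f g : f \in F -> g \in F -> crosses s f g = crosses s g f.
  by move=> /es[? ?] /es[? ?]; apply: crosses_sym.
have YF : Y \subset F by apply: subsetDl.
have Zcount (G : {set T}) : G \subset F -> \sum_(f in Z) \sum_(g in G) (crosses s f g : nat) =
    \sum_(f in G) \sum_(g in Z) (crosses s f g : nat).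
  move=> GF; rewrite exchange_big; apply: eq_bigr => f fG; apply: eq_bigr => g gZ /=.
  by rewrite (csym _ _ (subsetP ZF' _ gZ) (subsetP GF _ fG)).
have XY0 : \sum_(f in X) \sum_(g in Y) (crosses s f g : nat) = 0.
  rewrite big1 // => f fX; rewrite big1 // => g gY; apply/eqP; rewrite eqb0; apply/negP => /cz.
  have [ag bg] := e2 g gY; have [af bf] := e1 f fX.
  rewrite !(bX1 f _ fX) => /orP[]/(between_mem af bf) h; [have := hasPn s12 _ ag|have := hasPn s12 _ bg];
    by move/negP; apply.
have YX0 : \sum_(f in Y) \sum_(g in X) (crosses s f g : nat) = 0.
  rewrite exchange_big; apply: etrans XY0; apply: eq_bigr => f fX; apply: eq_bigr => g gY /=.
  by rewrite (csym _ _ (subsetP YF _ gY) (subsetP XF _ fX)).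
have ZZ : \sum_(f in Z) \sum_(g in Z) (crosses s f g : nat) <= #|Z| ^ 2.
  rewrite -mulnn -[X in _ <= X * _]sum1_card big_distrl; apply: leq_sum => f _ /=.
  by rewrite mul1n -sum1_card; apply: leq_sum => g _; apply: leq_b1.
have Nle : crossing_count s F <= crossing_count s1 X + crossing_count s2 Y + (#|Z| ^ 2 + 2 * NZ).
  have eX : crossing_count s1 X = \sum_(f in X) \sum_(g in X) (crosses s f g : nat).
    by apply: eq_bigr => f fX; apply: eq_bigr => g gX; rewrite /crosses !(bX1 f _ fX).
  have eY : crossing_count s2 Y = \sum_(f in Y) \sum_(g in Y) (crosses s f g : nat).
    by apply: eq_bigr => f fY; apply: eq_bigr => g gY; rewrite /crosses !(bY2 f _ fY).
  have sp (G : {set T}) : \sum_(f in G) \sum_(g in F) (crosses s f g : nat) =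
      \sum_(f in G) \sum_(g in X) (crosses s f g : nat) +
      \sum_(f in G) \sum_(g in Z) (crosses s f g : nat) +
      \sum_(f in G) \sum_(g in Y) (crosses s f g : nat).
    by rewrite -!big_split; apply: eq_bigr => f _; rewrite split_sum.
  rewrite {1}/crossing_count split_sum !sp !Zcount // -eX -eY XY0 YX0.
  by move: XZ_count ZZ; clear; lia.
have NZ_le : (NZ%:R <= 2 * (#|Z|%:R * (2 * Num.sqrt C%:R * Num.sqrt (vol q F)%:R)) :> R)%R.
  rewrite /NZ GRing.natr_sum.
  apply: Order.POrderTheory.le_trans (_ : (\sum_(z in Z) 2 * (2 * Num.sqrt C%:R * Num.sqrt (vol q F)%:R) <= _)%R).
    apply: Num.Theory.ler_sum => z _; rewrite GRing.natrD GRing.mulr_natl GRing.mulr2n.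
    have Dle u : ((D u)%:R <= 2 * Num.sqrt C%:R * Num.sqrt (vol q F)%:R :> R)%R.
      by apply: Order.POrderTheory.le_trans (DZ u); rewrite Num.Theory.ler_nat leq_addr.
    exact: Num.Theory.lerD (Dle _) (Dle _).
  by rewrite GRing.sumr_const -[X in (X <= _)%R]GRing.mulr_natl GRing.mulrCA.
(* The new interleavings are bounded by the weight of either side with the separator; the smaller of
   the two bounds is the amount that [log_weightD] leaves free. *)
have h1 := crossing_step w0 vX c2 NZ_le.
have h2 := crossing_step w0 vY c1 NZ_le.
apply: leq_trans Nle _; apply: leq_trans (leq_add (leq_add n1 n2) (leqnn _)) _.
have h3 := log_weightD (vol q X) (vol q Y) (vol q Z).
rewrite vF [vol q X + _ + _]addnAC; apply: leq_trans (leq_mul (leqnn (9 * C)) h3).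
rewrite !mulnDr leq_add2l; case: (leqP (vol q X + vol q Z) (vol q Y + vol q Z)) => _.
  by move: h2; rewrite vXZ.
by move: h1; rewrite vFX.
Qed.

End Ordering.

(** * Crossing parity of a polygonal K33 *)

Import Order.TTheory GRing.Theory Num.Theory.
Local Open Scope ring_scope.

(* [abc] is the orientation of the triangle with vertices [a], [b], [c].  The two hypotheses are the
   sign conditions imposed by the linear and the quadratic relations between the ten determinants. *)
Lemma five_signs (abc abd abe acd ace ade bcd bce bde cde : bool) :
  let no4 p q r s := ~~ [&& p, ~~ q, r & ~~ s] && ~~ [&& ~~ p, q, ~~ r & s] in
  let no3 p q r := ~~ [&& p, ~~ q & r] && ~~ [&& ~~ p, q & ~~ r] in
  [&& no4 bcd acd abd abc, no4 bce ace abe abc, no4 bde ade abe abd,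
      no4 cde ade ace acd & no4 cde bde bce bcd] ->
  [&& no3 (abc (+) ade) (abd (+) ace) (abe (+) acd),
      no3 (abc (+) bde) (abd (+) bce) (abe (+) bcd),
      no3 (abc (+) cde) (acd (+) bce) (ace (+) bcd),
      no3 (abd (+) cde) (acd (+) bde) (ade (+) bcd) &
      no3 (abe (+) cde) (ace (+) bde) (ade (+) bce)] ->
  ((abc (+) abd) && (acd (+) bcd)) (+) ((abd (+) abe) && (ade (+) bde)) (+)
    ((abe (+) abc) && (~~ ace (+) ~~ bce)) =
  ((acd == ade) && (ade == ~~ ace)) (+) ((bcd == bde) && (bde == ~~ bce)).
Proof.
by case: abc; case: abd; case: abe; case: acd; case: ace; case: ade; case: bcd;
  case: bce; case: bde; case: cde.
Qed.

Section Parity.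
Variables (R : realFieldType) (z : nat -> R * R) (N : nat).

Definition orient (p q r : R * R) :=
  (q.1 - p.1) * (r.2 - p.2) - (q.2 - p.2) * (r.1 - p.1).

Hypothesis general_position : forall i j k, (i < N)%N -> (j < N)%N -> (k < N)%N ->
  i != j -> j != k -> i != k -> orient (z i) (z j) (z k) != 0.

Implicit Types (i j k a b c d e : nat) (phi : nat -> bool) (L D : seq (nat * nat)).

Definition det i j k := orient (z i) (z j) (z k).
Definition neg i j k := det i j k < 0.

Lemma det_rot i j k : det i j k = det j k i. Proof. by rewrite /det /orient; ring. Qed.
Lemma det_swap i j k : det i j k = - det j i k. Proof. by rewrite /det /orient; ring. Qed.
Lemma neg_rot i j k : neg i j k = neg j k i. Proof. by rewrite /neg det_rot. Qed.

Definition gp s := uniq s && all (fun i => i < N)%N s.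

Lemma gp_det i j k : gp [:: i; j; k] -> det i j k != 0.
Proof.
rewrite /gp /= !inE !andbT negb_or => /andP[/andP[/andP[ij ik] jk] /and3P[iN jN kN]].
exact: general_position.
Qed.

Lemma neg_swap i j k : gp [:: i; j; k] -> neg j i k = ~~ neg i j k.
Proof.
by move=> g; rewrite /neg det_swap oppr_lt0 -leNgt le_eqVlt eq_sym (negPf (gp_det g)).
Qed.

Lemma neg_signs3 (x y u v w t : R) : x * y - u * v + w * t = 0 ->
  x != 0 -> y != 0 -> u != 0 -> v != 0 -> w != 0 -> t != 0 ->
  let p := (x < 0) (+) (y < 0) in let q := (u < 0) (+) (v < 0) in let r := (w < 0) (+) (t < 0) in
  ~~ [&& p, ~~ q & r] && ~~ [&& ~~ p, q & ~~ r].
Proof.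
have sgn (x0 y0 : R) : x0 != 0 -> y0 != 0 -> (x0 < 0) (+) (y0 < 0) = (x0 * y0 < 0).
  move=> x0n y0n; case: (ltgtP x0 0) x0n => // x00 _; case: (ltgtP y0 0) y0n => // y00 _ /=.
  - by rewrite ltNge ltW // nmulr_lgt0.
  - by rewrite nmulr_rlt0 // y00.
  - by rewrite pmulr_rlt0 // y00.
  - by rewrite ltNge ltW // mulr_gt0.
move=> e x0 y0 u0 v0 w0 t0 /=; rewrite !sgn //.
have xy0 := mulf_neq0 x0 y0; have uv0 := mulf_neq0 u0 v0; have wt0 := mulf_neq0 w0 t0.
move: e xy0 uv0 wt0; move: (x * y) (u * v) (w * t) => X Y Z e.
by case: (ltgtP X 0) => // hX _; case: (ltgtP Y 0) => // hY _; case: (ltgtP Z 0) => // hZ _ /=; lra.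
Qed.

Lemma neg_signs4 (x y u v : R) : x - y + u - v = 0 ->
  ~~ [&& x < 0, ~~ (y < 0), u < 0 & ~~ (v < 0)] &&
  ~~ [&& ~~ (x < 0), y < 0, ~~ (u < 0) & v < 0].
Proof.
move=> e; apply/andP; split; apply/negP => /and4P[]; rewrite -?leNgt => h1 h2 h3 h4; lra.
Qed.

Definition xing a b c d :=
  (neg a b c (+) neg a b d) && (neg c d a (+) neg c d b).

Definition intri c d e a := (neg c d a == neg d e a) && (neg d e a == neg e c a).

(** A segment crosses the boundary of a triangle an odd number of times exactly when one of its ends
    is inside. The relations fed to [five_signs] are the linear one for each four points and the
    quadratic Grassmann-Pluecker ones. *)
Lemma xing_triangle a b c d e : gp [:: a; b; c; d; e] ->
  xing a b c d (+) xing a b d e (+) xing a b e c = intri c d e a (+) intri c d e b.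
Proof.
rewrite /gp /= !inE !andbT !negb_or => /andP[/and4P[/and4P[ab ac ad ae] /and3P[bc bd be] /andP[cd ce] de]].
case/and5P=> aN bN cN dN eN.
have g i j k : i != j -> j != k -> i != k -> (i < N)%N -> (j < N)%N -> (k < N)%N -> gp [:: i; j; k].
  by move=> ij jk ik iN jN kN; rewrite /gp /= !inE !negb_or ij jk ik iN jN kN.
have d4 i j k l : det j k l - det i k l + det i j l - det i j k = 0 by rewrite /det /orient; ring.
have nz i j k : i != j -> j != k -> i != k -> (i < N)%N -> (j < N)%N -> (k < N)%N -> det i j k != 0.
  by move=> *; apply: gp_det; apply: g.
rewrite /xing /intri (neg_rot c d a) (neg_rot d a c) (neg_rot c d b) (neg_rot d b c).
rewrite (neg_rot d e a) (neg_rot e a d) (neg_rot d e b) (neg_rot e b d).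
rewrite (neg_rot e c a) (neg_rot e c b) (@neg_swap a c e) ?(@neg_swap b c e) ?g //.
apply: five_signs; first by apply/and5P; split; apply: neg_signs4; apply: d4.
apply/and5P; split; apply: neg_signs3; rewrite ?nz //; by rewrite /det /orient; ring.
Qed.

(** Degenerate triangles count as empty, so the parity law holds for repeated vertices as well. *)
Definition tri c d e a := uniq [:: c; d; e] && intri c d e a.

Lemma xing_sym a b c d : xing a b c d = xing c d a b.
Proof. by rewrite /xing andbC. Qed.

Lemma xing_swap a b c d : a != b -> all (fun i => i < N)%N [:: a; b; c; d] ->
  c \notin [:: a; b] -> d \notin [:: a; b] -> xing b a c d = xing a b c d.
Proof.
move=> ab /and5P[aN bN cN dN _]; rewrite !inE !negb_or => /andP[ca cb] /andP[da db].
rewrite /xing (@neg_swap a b c) ?(@neg_swap a b d).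
- by rewrite addNb addbN negbK [neg c d b (+) _]addbC.
- by rewrite /gp /= !inE !negb_or ab aN bN dN ![_ == d]eq_sym da db.
- by rewrite /gp /= !inE !negb_or ab aN bN cN ![_ == c]eq_sym ca cb.
Qed.

Lemma xing_id a c d : xing a a c d = false.
Proof. by rewrite /xing addbb andbF. Qed.

Lemma xing_swapr a b c d : all (fun i => i < N)%N [:: a; b; c; d] ->
  c \notin [:: a; b] -> d \notin [:: a; b] -> xing a b c d = xing a b d c.
Proof.
move=> /and5P[aN bN cN dN _] ca da; have [->//|cd] := eqVneq c d.
rewrite ![xing a b _ _]xing_sym; apply: xing_swap.
- by rewrite eq_sym.
- by rewrite /= aN bN cN dN.
- by move: ca da; rewrite !inE !negb_or ![a == _]eq_sym => /andP[-> _] /andP[->].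
- by move: ca da; rewrite !inE !negb_or ![b == _]eq_sym => /andP[_ ->] /andP[_ ->].
Qed.

Lemma xing_tri a b c d e : all (fun i => i < N)%N [:: a; b; c; d; e] ->
  c \notin [:: a; b] -> d \notin [:: a; b] -> e \notin [:: a; b] ->
  xing a b c d (+) xing a b d e (+) xing a b e c = tri c d e a (+) tri c d e b.
Proof.
move=> allN ca da ea; have [->|ab] := eqVneq a b; first by rewrite !xing_id !addbb.
have /and5P[aN bN cN dN /andP[eN _]] := allN.
have sw x y : (x < N)%N -> (y < N)%N -> x \notin [:: a; b] -> y \notin [:: a; b] ->
    xing a b x y = xing a b y x.
  by move=> xN yN xa ya; apply: xing_swapr => //=; rewrite aN bN xN yN.
have id x : xing a b x x = false by rewrite xing_sym xing_id.
rewrite /tri /= !inE !andbT negb_or.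
have [<-|cd] := eqVneq c d; rewrite /= ?id.
  by have [->|ce] := eqVneq c e; rewrite ?id // (sw c e) // addbb.
have [<-|ce] := eqVneq c e; rewrite /= ?id.
  by rewrite (sw c d) // addbF addbb.
have [<-|de] := eqVneq d e; rewrite /= ?id.
  by rewrite (sw c d) // addbF addbb.
apply: xing_triangle; move: allN; rewrite /gp => -> /=.
rewrite !inE !negb_or in ca da ea *.
case/andP: ca => ca cb; case/andP: da => da db; case/andP: ea => ea eb.
by rewrite ab cd ce de ![_ == c]eq_sym ![_ == d]eq_sym ![_ == e]eq_sym ca cb da db ea eb.
Qed.

(** A list of segments is a chain modulo 2. Its boundary is given by its values on all functions
    [phi], so repeated points cancel without a normal form. *)
Definition bdry L phi := \big[addb/false]_(u <- L) (phi u.1 (+) phi u.2).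
Definition cross L D := \big[addb/false]_(u <- L) \big[addb/false]_(v <- D) xing u.1 u.2 v.1 v.2.

Definition joins p q L := forall phi, bdry L phi = phi p (+) phi q.
Definition supp L := flatten [seq [:: u.1; u.2] | u <- L].

Lemma cross_sym L D : cross L D = cross D L.
Proof.
rewrite /cross exchange_big; apply: eq_bigr => v _; apply: eq_bigr => u _; exact: xing_sym.
Qed.

Lemma cross_cat L D1 D2 : cross L (D1 ++ D2) = cross L D1 (+) cross L D2.
Proof. by rewrite /cross -big_split; apply: eq_bigr => u _; rewrite big_cat. Qed.

Lemma bdry_cat L1 L2 phi : bdry (L1 ++ L2) phi = bdry L1 phi (+) bdry L2 phi.
Proof. exact: big_cat. Qed.

Lemma supp_mem L u : u \in L -> u.1 \in supp L /\ u.2 \in supp L.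
Proof.
by move=> uL; split; apply/flatten_mapP; exists u; rewrite // !inE eqxx ?orbT.
Qed.

(* The parity of the winding number of the closed chain [D] around [a], read off from the triangles
   that [D] spans with [d0]. *)
Definition turning D d0 a := \big[addb/false]_(v <- D) tri d0 v.1 v.2 a.

(** Cone [D] from [d0]: the added segments cancel because [D] is closed, and each resulting triangle
    obeys [xing_tri]. Summing along [L] telescopes to its two ends. *)
Lemma closed_cross D L d0 p q : (forall phi, bdry D phi = false) -> joins p q L ->
  (d0 < N)%N -> all (fun i => i < N)%N (supp D) -> all (fun i => i < N)%N (supp L) ->
  d0 \notin supp L -> {in supp L, forall i, i \notin supp D} ->
  cross L D = turning D d0 p (+) turning D d0 q.
Proof.
move=> bD jL d0N DN LN d0L LD; rewrite -jL /cross /bdry.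
apply: eq_big_seq => u uL; have [u1 u2] := supp_mem uL.
rewrite /turning -big_split /=.
have -> : \big[addb/false]_(v <- D) xing u.1 u.2 v.1 v.2 =
  \big[addb/false]_(v <- D) (xing u.1 u.2 v.1 v.2 (+)
     (xing u.1 u.2 d0 v.1 (+) xing u.1 u.2 d0 v.2)).
  have e := bD (xing u.1 u.2 d0); rewrite /bdry in e.
  by rewrite big_split /= e addbF.
apply: eq_big_seq => v vD; have [v1 v2] := supp_mem vD.
have out i : i \in supp D -> i \notin [:: u.1; u.2].
  move=> iD; apply: contraL iD; rewrite !inE => /orP[]/eqP->; exact: LD.
have d0o : d0 \notin [:: u.1; u.2].
  by apply: contra d0L; rewrite !inE => /orP[]/eqP->.
have [u1N u2N v1N v2N] : [/\ u.1 < N, u.2 < N, v.1 < N & v.2 < N]%N.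
  by split; [apply: (allP LN)|apply: (allP LN)|apply: (allP DN)|apply: (allP DN)].
rewrite -(xing_tri _ d0o (out _ v1) (out _ v2)); last by rewrite /= u1N u2N d0N v1N v2N.
rewrite (xing_swapr _ (out _ v2) d0o); last by rewrite /= u1N u2N d0N v2N.
by rewrite addbA; congr (_ (+) _); apply: addbC.
Qed.

Definition pairs r r' := cross (r 0%N) (r' 1%N) (+) cross (r 1%N) (r' 0%N) (+)
  (cross (r 0%N) (r' 2%N) (+) cross (r 2%N) (r' 0%N)) (+) (cross (r 1%N) (r' 2%N) (+) cross (r 2%N) (r' 1%N)).

Definition cross33 (c : nat -> nat -> seq (nat * nat)) :=
  pairs (c 0%N) (c 1%N) (+) pairs (c 0%N) (c 2%N) (+) pairs (c 1%N) (c 2%N).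

Lemma pairs_sym r r' : pairs r r' = pairs r' r.
Proof.
rewrite /pairs; congr (_ (+) _ (+) _); rewrite addbC; congr (_ (+) _); exact: cross_sym.
Qed.

Lemma cross33_transpose (c : nat -> nat -> seq (nat * nat)) : cross33 (fun i j => c j i) = cross33 c.
Proof.
rewrite /cross33 /pairs.
have e i j i' j' : cross (c i' j') (c i j) = cross (c i j) (c i' j') by exact: cross_sym.
rewrite (e 0%N 1%N 1%N 0%N) (e 0%N 2%N 1%N 0%N) (e 0%N 2%N 1%N 1%N) (e 0%N 1%N 2%N 0%N).
rewrite (e 0%N 2%N 2%N 0%N) (e 0%N 2%N 2%N 1%N) (e 1%N 1%N 2%N 0%N) (e 1%N 2%N 2%N 0%N) (e 1%N 2%N 2%N 1%N).
do 9![move: (cross _ _ (+) cross _ _) => ?].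
rewrite -!addbA; do !bool_congr.
Qed.

Lemma turning_cat D1 D2 d0 a : turning (D1 ++ D2) d0 a = turning D1 d0 a (+) turning D2 d0 a.
Proof. exact: big_cat. Qed.

(** [allow i j] holds the points available to path [(i, j)]. Independent paths share none, and the
    apex [d0] belongs to no path. *)
Variables (d0 : nat) (allow : nat -> nat -> pred nat).
Hypothesis d0N : (d0 < N)%N.
Hypothesis allow_inside : forall i j u, allow i j u -> (u < N)%N && (u != d0).
Hypothesis allow_apart : forall i j i' j' u, i != i' -> j != j' -> allow i j u -> ~~ allow i' j' u.

Definition chain i j p q L := joins p q L /\ all (allow i j) (supp L).

Definition row i (B : nat -> nat) p (r : nat -> seq (nat * nat)) :=
  forall j, (j < 3)%N -> chain i j p (B j) (r j).

Lemma supp_cat L1 L2 : supp (L1 ++ L2) = supp L1 ++ supp L2.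
Proof. by rewrite /supp map_cat flatten_cat. Qed.

(* The right-hand side depends only on the ends of the row [r]: each winding number around [p] occurs
   twice. *)
Lemma row_pairs i i' i'' B p p' p'' r r' r'' : i != i' -> i != i'' ->
  row i B p r -> row i' B p' r' -> row i'' B p'' r'' ->
  let D k l := r' k ++ r' l ++ r'' k ++ r'' l in
  pairs r r' (+) pairs r r'' = turning (D 1 2) d0 (B 0) (+) turning (D 0 2) d0 (B 1)
     (+) turning (D 0 1) d0 (B 2).
Proof.
move=> ii' ii'' hr hr' hr'' D.
(* For [j], [k], [l] distinct, [D k l] is the closed chain through [p'], [B k], [p''], [B l], and
   path [j] of the first row is independent of all of it. *)
have cl j k l : (j < 3)%N -> (k < 3)%N -> (l < 3)%N -> j != k -> j != l ->
    cross (r j) (D k l) = turning (D k l) d0 p (+) turning (D k l) d0 (B j).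
  move=> j3 k3 l3 jk jl.
  have [rj rjs] := hr _ j3; have [rk rks] := hr' _ k3; have [rl rls] := hr' _ l3.
  have [sk sks] := hr'' _ k3; have [sl sls] := hr'' _ l3.
  have inN i0 j0 L : all (allow i0 j0) (supp L) -> all (fun u => u < N)%N (supp L).
    by apply: sub_all => u /allow_inside/andP[].
  apply: closed_cross => //.
  - move=> phi; rewrite !bdry_cat rk rl sk sl.
    by case: (phi p'); case: (phi p''); case: (phi (B k)); case: (phi (B l)).
  - rewrite !supp_cat !all_cat; apply/and4P; split; [apply: inN rks|apply: inN rls|apply: inN sks|apply: inN sls].
  - exact: inN rjs.
  - by apply/negP => /(allP rjs)/allow_inside; rewrite eqxx andbF.
  - move=> u /(allP rjs) a; rewrite !supp_cat !mem_cat !negb_or.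
    apply/and4P; split.
    + apply: contraL a => /(allP rks); apply: allow_apart; by rewrite eq_sym.
    + apply: contraL a => /(allP rls); apply: allow_apart; by rewrite eq_sym.
    + apply: contraL a => /(allP sks); apply: allow_apart; by rewrite eq_sym.
    + apply: contraL a => /(allP sls); apply: allow_apart; by rewrite eq_sym.
have -> : pairs r r' (+) pairs r r'' =
    cross (r 0%N) (D 1%N 2%N) (+) cross (r 1%N) (D 0%N 2%N) (+) cross (r 2%N) (D 0%N 1%N).
  rewrite /pairs /D !cross_cat; change addb with (@GRing.add bool); ring.
rewrite !cl // /D !turning_cat.
move: (turning _ _ (B 0) (+) _) (turning _ _ (B 1) (+) _) (turning _ _ (B 2) (+) _) => x y t.
by do 6![case: (turning _ _ _)]; case: x; case: y; case: t.
Qed.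

Lemma row_replace i i' i'' B a a' p' p'' r n r' r'' : i != i' -> i != i'' ->
  row i B a r -> row i B a' n -> row i' B p' r' -> row i'' B p'' r'' ->
  pairs r r' (+) pairs r r'' = pairs n r' (+) pairs n r''.
Proof.
move=> ii' ii'' hr hn hr' hr''.
by rewrite (row_pairs ii' ii'' hr hr' hr'') (row_pairs ii' ii'' hn hr' hr'').
Qed.

(** The rows are exchanged one after the other; each exchange preserves the parity since the targets
    [B] stay fixed. *)
Lemma cross33_rows A A' B (c c' : nat -> nat -> seq (nat * nat)) :
  (forall i, (i < 3)%N -> row i B (A i) (c i)) -> (forall i, (i < 3)%N -> row i B (A' i) (c' i)) ->
  cross33 c = cross33 c'.
Proof.
move=> hc hc'; have h i i' i'' : (i < 3)%N -> (i' < 3)%N -> (i'' < 3)%N -> i != i' -> i != i'' ->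
    forall r' r'' p' p'', row i' B p' r' -> row i'' B p'' r'' ->
    pairs (c i) r' (+) pairs (c i) r'' = pairs (c' i) r' (+) pairs (c' i) r''.
  move=> i3 i'3 i''3 ii' ii'' r' r'' p' p'' h1 h2.
  exact: (row_replace ii' ii'' (hc i i3) (hc' i i3) h1 h2).
rewrite /cross33 (h 0%N 1%N 2%N _ _ _ _ _ _ _ _ _ (hc 1%N _) (hc 2%N _)) //.
rewrite (pairs_sym _ (c 1%N)) addbAC (h 1%N 0%N 2%N _ _ _ _ _ _ _ _ _ (hc' 0%N _) (hc 2%N _)) // addbAC.
rewrite (pairs_sym _ (c 2%N)) (pairs_sym _ (c 2%N)) -addbA.
rewrite (h 2%N 0%N 1%N _ _ _ _ _ _ _ _ _ (hc' 0%N _) (hc' 1%N _)) //.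
by rewrite addbA ![pairs (c' 2%N) _]pairs_sym (pairs_sym (c' 1%N)).
Qed.

Lemma chain_edge i j p q : allow i j p -> allow i j q -> chain i j p q [:: (p, q)].
Proof. by move=> ap aq; split => [phi|]; rewrite /bdry ?big_seq1 //= ap aq. Qed.

Lemma chain_sym i j p q L : chain i j p q L -> chain i j q p L.
Proof. by case=> h ?; split=> // phi; rewrite h addbC. Qed.

End Parity.

(** * The parity of the convex model and its transfer *)

Section Model.
Variables (R : realFieldType) (z : nat -> R * R) (N d0 : nat) (allow : nat -> nat -> pred nat).
Hypothesis general_position : forall i j k, (i < N)%N -> (j < N)%N -> (k < N)%N ->
  i != j -> j != k -> i != k -> orient (z i) (z j) (z k) != 0.
Hypothesis d0N : (d0 < N)%N.
Hypothesis allow_inside : forall i j u, allow i j u -> (u < N)%N && (u != d0).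
Hypothesis allow_apart : forall i j i' j' u, i != i' -> j != j' -> allow i j u -> ~~ allow i' j' u.
Hypothesis model : forall i j k, (i < j)%N -> (j < k)%N -> (k < 6)%N -> 0 < orient (z i) (z j) (z k).
Hypothesis allow_model : forall i j, (i < 3)%N -> (j < 3)%N -> allow i j i /\ allow i j (3 + j)%N.
Variables (A B : nat -> nat) (c : nat -> nat -> seq (nat * nat)).
Hypothesis allow_ends : forall i j, (i < 3)%N -> (j < 3)%N -> allow i j (A i) /\ allow i j (B j).
Hypothesis chains : forall i j, (i < 3)%N -> (j < 3)%N -> chain allow i j (A i) (B j) (c i j).

(** In convex position the chords [(i, 3 + j)] and [(i', 3 + j')] with [i < i'] cross exactly when
    [j < j'], which makes nine crossings. *)
Lemma cross33_model : cross33 z (fun i j => [:: (i, 3 + j)%N]).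
Proof.
have pos i j k : (i < j)%N -> (j < k)%N -> (k < 6)%N -> neg z i j k = false.
  by move=> ij jk k6; apply/negbTE; rewrite -leNgt ltW // model.
have pos2 i j k : (i < j)%N -> (j < k)%N -> (k < 6)%N -> neg z j k i = false.
  by move=> *; rewrite -neg_rot pos.
have pos3 i j k : (i < j)%N -> (j < k)%N -> (k < 6)%N -> neg z k i j = false.
  by move=> *; rewrite neg_rot pos.
have flip i j k : (i < j)%N -> (j < k)%N -> (k < 6)%N -> neg z j i k.
  by move=> *; rewrite /neg det_swap oppr_lt0 model.
have flip2 i j k : (i < j)%N -> (j < k)%N -> (k < 6)%N -> neg z i k j.
  by move=> *; rewrite neg_rot neg_rot flip.
have flip3 i j k : (i < j)%N -> (j < k)%N -> (k < 6)%N -> neg z k j i.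
  by move=> *; rewrite neg_rot flip.
have val i j k : [&& i != j, j != k, i != k, i < 6, j < 6 & k < 6]%N ->
    neg z i j k = ((j < i) (+) (k < j) (+) (k < i))%N.
  case/and5P=> ij jk ik i6 /andP[j6 k6].
  case: (ltngtP i j) ij => // ij _; case: (ltngtP j k) jk => // jk _; case: (ltngtP i k) ik => // ik _ /=.
  - exact: pos.
  - lia.
  - exact: flip2.
  - exact: pos2.
  - exact: flip.
  - exact: pos3.
  - lia.
  - exact: flip3.
by rewrite /cross33 /pairs /cross !big_seq1 /xing /= !val.
Qed.

Lemma cross33_true : cross33 z c.
Proof.
(* The sources move to model points first; after transposing, the targets follow. *)
have -> : cross33 z c = cross33 z (fun i j => [:: (i, B j)]).
  apply: (cross33_rows general_position d0N allow_inside allow_apart) => i i3 j j3; first exact: chains.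
  by apply: chain_edge; [case: (allow_model i3 j3)|case: (allow_ends i3 j3)].
rewrite -cross33_transpose.
rewrite (@cross33_rows R z N general_position d0 (fun j i => allow i j) _ _ _ B (fun j => 3 + j)%N id _ (fun j i => [:: (i, 3 + j)%N])).
- by rewrite (cross33_transpose z (fun i j => [:: (i, 3 + j)%N])) cross33_model.
- by [].
- by move=> i j u /allow_inside.
- by move=> i j i' j' u ii jj; apply: allow_apart.
- move=> j j3 i i3; apply: chain_sym; apply: chain_edge; [case: (allow_model i3 j3)|case: (allow_ends i3 j3)] => //.
- move=> j j3 i i3; apply: chain_sym; apply: chain_edge; case: (allow_model i3 j3) => //.
Qed.

Lemma exists_crossing : exists i i' j j' u v,
  [/\ [/\ (i < 3)%N, (i' < 3)%N, (j < 3)%N & (j' < 3)%N], i != i', j != j', u \in c i j /\ v \in c i' j' &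
    xing z u.1 u.2 v.1 v.2].
Proof.
have cr i j i' j' : (i < 3)%N -> (i' < 3)%N -> (j < 3)%N -> (j' < 3)%N -> i != i' -> j != j' ->
    cross z (c i j) (c i' j') ->  exists i i' j j' u v,
  [/\ [/\ (i < 3)%N, (i' < 3)%N, (j < 3)%N & (j' < 3)%N], i != i', j != j', u \in c i j /\ v \in c i' j' &
    xing z u.1 u.2 v.1 v.2].
  move=> i3 i'3 j3 j'3 ii' jj' x; apply: contrapT => no.
  move: x; rewrite /cross big_seq big1 // => u ul; rewrite big_seq big1 // => v vl.
  apply/negbTE/negP => x; apply: no; by exists i, i', j, j', u, v.
apply: contrapT => no; have := cross33_true; rewrite /cross33 /pairs.
have f i j i' j' : (i < 3)%N -> (i' < 3)%N -> (j < 3)%N -> (j' < 3)%N -> i != i' -> j != j' -> cross z (c i j) (c i' j') = false.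
  by move=> *; apply/negbTE/negP => x; apply: no; apply: (cr i j i' j').
by rewrite !f.
Qed.

End Model.

(** * Crossing polygons with short steps have nearby vertices *)

Section Nearness.
Variable R : realFieldType.
Implicit Types (p q r s : R * R) (x y t d : R).

Lemma straddle p q r s : orient p q r != 0 -> orient p q s != 0 ->
  (orient p q r < 0) (+) (orient p q s < 0) ->
  exists2 t, 0 <= t <= 1 & orient p q r + t * (orient p q s - orient p q r) = 0.
Proof.
move: (orient p q r) (orient p q s) => x y x0 y0 xy.
have d0 : x - y != 0.
  by rewrite subr_eq0; apply/eqP => e; rewrite e addbb in xy.
exists (x / (x - y)); last by field.
case: (ltgtP x 0) x0 xy => // hx _; case: (ltgtP y 0) y0 => // hy _ _.
  by rewrite ler_ndivlMr ?ler_ndivrMr; lra.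
by rewrite ler_pdivlMr ?ler_pdivrMr; lra.
Qed.

(* The common point is [p + x (q - p) = r + y (s - r)]. *)
Lemma segments_meet p q r s : orient p q r != 0 -> orient p q s != 0 ->
  orient r s p != 0 -> orient r s q != 0 ->
  ((orient p q r < 0) (+) (orient p q s < 0)) && ((orient r s p < 0) (+) (orient r s q < 0)) ->
  exists x y, [/\ 0 <= x <= 1, 0 <= y <= 1, p.1 + x * (q.1 - p.1) = r.1 + y * (s.1 - r.1)
    & p.2 + x * (q.2 - p.2) = r.2 + y * (s.2 - r.2)].
Proof.
move=> n1 n2 n3 n4 /andP[h1 h2].
have [y y01 ey] := straddle n1 n2 h1; have [x x01 ex] := straddle n3 n4 h2.
have d0 : orient p q s - orient p q r != 0.
  by rewrite subr_eq0; apply/eqP => e; rewrite e addbb in h1.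
exists x, y; split=> //; apply/eqP; rewrite -subr_eq0 -(mulrI_eq0 _ (mulfI d0)); apply/eqP.
  transitivity ((r.1 - s.1) * (orient p q r + y * (orient p q s - orient p q r)) -
    (q.1 - p.1) * (orient r s p + x * (orient r s q - orient r s p))); first by rewrite /orient; ring.
  by rewrite ey ex; ring.
transitivity ((r.2 - s.2) * (orient p q r + y * (orient p q s - orient p q r)) -
  (q.2 - p.2) * (orient r s p + x * (orient r s q - orient r s p))); first by rewrite /orient; ring.
by rewrite ey ex; ring.
Qed.

Definition boxed d p q := (`|p.1 - q.1| <= d) && (`|p.2 - q.2| <= d).

Lemma boxedW d d' p q : d <= d' -> boxed d p q -> boxed d' p q.
Proof. by move=> dd /andP[h1 h2]; rewrite /boxed !(le_trans _ dd). Qed.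

Lemma boxed_sym d p q : boxed d p q = boxed d q p.
Proof. by rewrite /boxed distrC [`|p.2 - _|]distrC. Qed.

Lemma boxed_trans d d' p q r : boxed d p q -> boxed d' q r -> boxed (d + d') p r.
Proof.
move=> /andP[h1 h2] /andP[h3 h4]; apply/andP.
by split; [apply: le_trans (ler_distD q.1 _ _) _|apply: le_trans (ler_distD q.2 _ _) _]; apply: lerD.
Qed.

Lemma segments_close d p q r s x y : boxed d p q -> boxed d r s -> 0 <= x <= 1 -> 0 <= y <= 1 ->
  p.1 + x * (q.1 - p.1) = r.1 + y * (s.1 - r.1) ->
  p.2 + x * (q.2 - p.2) = r.2 + y * (s.2 - r.2) -> boxed (2 * d) p r.
Proof.
have key (a b c e : R) : `|a - b| <= d -> `|c - e| <= d -> 0 <= x <= 1 -> 0 <= y <= 1 ->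
    a + x * (b - a) = c + y * (e - c) -> `|a - c| <= 2 * d.
  move=> ab ce /andP[x0 x1] /andP[y0 y1] h.
  have -> : a - c = y * (e - c) - x * (b - a) by lra.
  rewrite (le_trans (ler_normB _ _)) // !normrM (ger0_norm y0) (ger0_norm x0) distrC [`|b - a|]distrC.
  have : x * `|a - b| <= 1 * d by apply: ler_pM.
  have : y * `|c - e| <= 1 * d by apply: ler_pM.
  by lra.
move=> /andP[h1 h2] /andP[h3 h4] hx hy e1 e2; apply/andP; split.
  exact: key h1 h3 hx hy e1.
exact: key h2 h4 hx hy e2.
Qed.

(* Moving the [k]-th point along [(k, k^2)] makes every orientation a polynomial in [t] whose leading
   coefficient is a Vandermonde determinant. *)
Definition perturb t (z : nat -> R * R) (k : nat) : R * R :=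
  ((z k).1 + t * k%:R, (z k).2 + t * k%:R ^+ 2).

(** A nonzero polynomial has fewer than [size P] roots, and [size P] candidates are tried. *)
Lemma small_nonroot (P : {poly R}) d : P != 0 -> 0 < d -> exists2 t, 0 < t < d & P.[t] != 0.
Proof.
move=> P0 d0; apply: contrapT => no.
pose s := [seq d / (k.+2)%:R | k <- iota 0 (size P)].
have inj : injective (fun k : nat => d / (k.+2)%:R : R).
  move=> k l /(mulfI (lt0r_neq0 d0))/invr_inj/eqP; rewrite eqr_nat => /eqP[]; by [].
have us : uniq s by rewrite (map_inj_uniq inj) iota_uniq.
suff : (size s < size P)%N by rewrite size_map size_iota ltnn.
apply: max_poly_roots => //; apply/allP => x /mapP[k _ ->]; apply: contrapT => /negP nr.
apply: no; exists (d / k.+2%:R); rewrite ?rootE // in nr *.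
rewrite divr_gt0 ?ltr0n //= ltr_pdivrMr ?ltr0n // ltr_pMr //.
by rewrite ltr1n.
Qed.

Lemma exists_perturbation (z : nat -> R * R) N d : 0 < d -> exists2 t, 0 < t < d &
  forall i j k, (i < N)%N -> (j < N)%N -> (k < N)%N -> i != j -> j != k -> i != k ->
    orient (perturb t z i) (perturb t z j) (perturb t z k) != 0.
Proof.
move=> d0.
pose zx k : {poly R} := ((z k).1)%:P + k%:R *: 'X.
pose zy k : {poly R} := ((z k).2)%:P + (k%:R ^+ 2) *: 'X.
pose P i j k := (zx j - zx i) * (zy k - zy i) - (zy j - zy i) * (zx k - zx i).
have PE i j k t : (P i j k).[t] = orient (perturb t z i) (perturb t z j) (perturb t z k).
  by rewrite /P /zx /zy /orient /perturb !hornerE /=; ring.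
have P0 i j k : i != j -> j != k -> i != k -> P i j k != 0.
  move=> ij jk ik; apply/eqP => e0.
  (* The second difference isolates twice the coefficient of [t ^ 2], a Vandermonde product. *)
  have : (P i j k).[2] - 2 * (P i j k).[1] + (P i j k).[0] = 0 by rewrite e0 !horner0; ring.
  rewrite !PE.
  have -> : orient (perturb 2 z i) (perturb 2 z j) (perturb 2 z k) -
      2 * orient (perturb 1 z i) (perturb 1 z j) (perturb 1 z k) +
      orient (perturb 0 z i) (perturb 0 z j) (perturb 0 z k) =
      2 * ((j%:R - i%:R) * (k%:R - i%:R) * (k%:R - j%:R)) by rewrite /orient /perturb /=; ring.
  by move/eqP; rewrite !mulf_eq0 !subr_eq0 !eqr_nat pnatr_eq0 /= [j == i]eq_sym [k == i]eq_sym [k == j]eq_sym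
    (negPf ij) (negPf jk) (negPf ik).
pose Q := \prod_(i < N) \prod_(j < N) \prod_(k < N)
  if [&& i != j, j != k & i != k] then P i j k else 1.
have Q0 : Q != 0.
  apply/prodf_neq0 => i _; apply/prodf_neq0 => j _; apply/prodf_neq0 => k _.
  by case: ifP => [/and3P[]|_]; [exact: P0|exact: oner_neq0].
have [t td Qt] := small_nonroot Q0 d0; exists t => // i j k iN jN kN ij jk ik.
rewrite -PE; move: Qt; rewrite /Q !horner_prod => /prodf_neq0/(_ (Ordinal iN) isT).
rewrite !horner_prod => /prodf_neq0/(_ (Ordinal jN) isT).
rewrite !horner_prod => /prodf_neq0/(_ (Ordinal kN) isT).
by rewrite -!val_eqE /= ij jk ik.
Qed.

Definition links (x : nat) (l : seq nat) : seq (nat * nat) := pairmap pair x l.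

Lemma bdry_links (x : nat) l phi : bdry (links x l) phi = phi x (+) phi (last x l).
Proof.
rewrite /bdry /links; elim: l x => [|y l IH] x /=; first by rewrite big_nil addbb.
by rewrite big_cons IH /=; case: (phi x); case: (phi y); case: (phi _).
Qed.

Lemma supp_links (x : nat) l : {subset supp (links x l) <= x :: l}.
Proof.
elim: l x => [|y l IH] x u //=; rewrite !inE => /or3P[-> //|->|/IH]; first by rewrite orbT.
by rewrite inE => ->; rewrite orbT.
Qed.

Lemma all_links (e : rel nat) (x : nat) l : path e x l = all (fun u => e u.1 u.2) (links x l).
Proof. by elim: l x => //= y l IH x; rewrite IH. Qed.

Lemma boxed_refl d p : 0 <= d -> boxed d p p.
Proof. by move=> d0; rewrite /boxed !subrr normr0 d0. Qed.

Section Layout.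
Variables (a b : nat -> R * R) (s : nat -> nat -> seq (R * R)) (n : nat).
Hypothesis size_s : forall i j, (i < 3)%N -> (j < 3)%N -> (size (s i j) < n)%N.

(* Indices 0-5 are the six model points, 12 the base point of the winding numbers. *)
Definition layout u : R * R :=
  if (u < 6)%N then (0, 0) else if (u < 9)%N then a (u - 6) else if (u < 12)%N then b (u - 9) else
  if u == 12%N then (0, 0) else nth (0, 0) (s ((u - 13) %/ n %/ 3) ((u - 13) %/ n %% 3)) ((u - 13) %% n).

Definition inner i j k := (13 + ((3 * i + j) * n + k))%N.
Definition track i j := rcons [seq inner i j k | k <- iota 0 (size (s i j))] (9 + j)%N.
Definition zone i j u := [&& (i < 3)%N, (j < 3)%N &
  [|| u == i, u == (3 + j)%N, u == (6 + i)%N, u == (9 + j)%N | (13 <= u)%N && ((u - 13) %/ n == 3 * i + j)%N]].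

Lemma zone_apart i j i' j' u : i != i' -> j != j' -> zone i j u -> ~~ zone i' j' u.
Proof.
rewrite /zone => ii jj; case: (leqP 13 u) => hu /=; last by clear - ii jj hu; lia.
by move: (_ %/ n)%N => m; clear - ii jj hu; lia.
Qed.

Lemma zone_inside i j u : zone i j u -> (u < 13 + 9 * n)%N && (u != 12%N).
Proof.
case/and3P=> i3 j3; case: (ltnP u 13) => hu.
  by rewrite /= orbF; clear -i3 j3 hu; lia.
case/or4P=> [||| /orP[|/eqP e]]; try by clear -i3 j3 hu; lia.
have n0 : (0 < n)%N by apply: leq_ltn_trans (size_s i3 j3).
have := ltn_ceil (u - 13) n0; rewrite e => h.
have : ((3 * i + j).+1 * n <= 9 * n)%N by rewrite leq_mul2r; apply/orP; right; clear -i3 j3; lia.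
by clear -hu h; lia.
Qed.

Lemma inner_div i j k : (k < n)%N -> ((inner i j k - 13) %/ n = 3 * i + j)%N.
Proof.
move=> kn; rewrite /inner addKn divnMDl ?divn_small ?addn0 //; exact: leq_ltn_trans kn.
Qed.

Lemma layout_inner i j k : (i < 3)%N -> (j < 3)%N -> (k < n)%N -> layout (inner i j k) = nth (0, 0) (s i j) k.
Proof.
move=> i3 j3 kn; rewrite /layout (inner_div _ _ kn) -[X in _ == X]/(13 - 1)%N.
have [-> -> -> ->] : [/\ (inner i j k < 6)%N = false, (inner i j k < 9)%N = false,
    (inner i j k < 12)%N = false & (inner i j k == 13 - 1)%N = false].
  by rewrite /inner; move: (_ * n + k)%N => m; clear; split; lia.
rewrite /inner addKn modnMDl (modn_small kn) mulnC divnMDl // modnMDl.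
by rewrite (modn_small j3) (divn_small j3) addn0.
Qed.

Lemma layout_ends i : (i < 3)%N -> layout (6 + i) = a i /\ layout (9 + i) = b i.
Proof. by case: i => [|[|[|]]]. Qed.

Lemma map_track i j : (i < 3)%N -> (j < 3)%N -> map layout (track i j) = rcons (s i j) (b j).
Proof.
move=> i3 j3; rewrite map_rcons (layout_ends j3).2; congr rcons.
rewrite -map_comp -[RHS](mkseq_nth (0, 0)) /mkseq.
apply/eq_in_map => k; rewrite mem_iota /= => ks; apply: layout_inner => //.
exact: ltn_trans ks (size_s i3 j3).
Qed.

Lemma track_chain i j : (i < 3)%N -> (j < 3)%N ->
  chain zone i j (6 + i) (9 + j) (links (6 + i) (track i j)).
Proof.
move=> i3 j3; split; first by move=> phi; rewrite bdry_links /track last_rcons.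
apply/allP => u /supp_links; rewrite /zone i3 j3 inE mem_rcons inE => /or3P[->|->|]; rewrite ?orbT //.
case/mapP=> k; rewrite mem_iota /= => ks ->.
by rewrite inner_div ?eqxx /= ?orbT //; apply: ltn_trans ks (size_s i3 j3).
Qed.

Lemma near_crossing_layout eps : 0 < eps ->
  (forall i j, (i < 3)%N -> (j < 3)%N -> path (boxed eps) (a i) (s i j) /\ last (a i) (s i j) = b j) ->
  exists i i' j j' p p', [/\ [/\ (i < 3)%N, (i' < 3)%N, (j < 3)%N & (j' < 3)%N], i != i', j != j',
    p \in a i :: s i j /\ p' \in a i' :: s i' j' & boxed (8 * eps) p p'].
Proof.
move=> eps0 hs; pose N := (13 + 9 * n)%N.
have N0 : (0 : R) < N%:R ^+ 2 by rewrite exprn_gt0 // ltr0n.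
(* Point [k < N] moves by at most [t * k ^ 2], hence by less than [eps]. *)
have d0 : 0 < eps / N%:R ^+ 2 by apply: divr_gt0.
have [t /andP[t0 td] gp] := exists_perturbation layout N d0.
have tN k : (k < N)%N -> boxed eps (layout k) (perturb t layout k).
  move=> kN; rewrite ltr_pdivlMr // in td.
  have kk : (k%:R : R) <= k%:R ^+ 2 by rewrite -natrX ler_nat; clear; nia.
  have kNN : (k%:R ^+ 2 : R) <= N%:R ^+ 2 by rewrite -!natrX ler_nat leq_sqr ltnW.
  have k0 : 0 <= (k%:R : R) by rewrite ler0n.
  have h : t * k%:R ^+ 2 <= eps by apply: le_trans (ltW td); rewrite ler_pM2l.
  have h' : t * k%:R <= eps by apply: le_trans h; rewrite ler_pM2l.
  have small (x y : R) : 0 <= y -> y <= eps -> `|x - (x + y)| <= eps.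
    by move=> y0 ye; rewrite opprD addrA subrr sub0r normrN ger0_norm.
  by rewrite /boxed !small // mulr_ge0 ?exprn_ge0 // ltW.
(* The six model points all start at the origin, so the perturbation puts them on a parabola, in
   convex position. *)
have model i j k : (i < j)%N -> (j < k)%N -> (k < 6)%N ->
    0 < orient (perturb t layout i) (perturb t layout j) (perturb t layout k).
  move=> ij jk k6; have j6 := ltn_trans jk k6; have i6 := ltn_trans ij j6.
  rewrite /perturb /layout k6 j6 i6 /orient /=.
  have -> : (0 + t * j%:R - (0 + t * i%:R)) * (0 + t * k%:R ^+ 2 - (0 + t * i%:R ^+ 2)) -
      (0 + t * j%:R ^+ 2 - (0 + t * i%:R ^+ 2)) * (0 + t * k%:R - (0 + t * i%:R)) =
    t ^+ 2 * ((j%:R - i%:R) * (k%:R - i%:R) * (k%:R - j%:R)) by ring.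
  by rewrite mulr_gt0 ?exprn_gt0 // !mulr_gt0 ?subr_gt0 ?ltr_nat // (ltn_trans ij).
have model_zone i j : (i < 3)%N -> (j < 3)%N -> zone i j i /\ zone i j (3 + j)%N.
  by move=> i3 j3; rewrite /zone i3 j3 !eqxx ?orbT.
have end_zone i j : (i < 3)%N -> (j < 3)%N -> zone i j (6 + i)%N /\ zone i j (9 + j)%N.
  by move=> i3 j3; rewrite /zone i3 j3 !eqxx ?orbT.
have NN : (12 < N)%N by rewrite /N; lia.
have [i [i' [j [j' [u [v [[i3 i'3 j3 j'3] ii' jj' [ul vl] x]]]]]]] :=
  exists_crossing gp NN zone_inside zone_apart model model_zone end_zone track_chain.
have hpath i0 j0 : (i0 < 3)%N -> (j0 < 3)%N ->
    path (fun u v => boxed eps (layout u) (layout v)) (6 + i0)%N (track i0 j0).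
  move=> i3' j3'.
  have -> : forall (x : nat) l, path (fun u v => boxed eps (layout u) (layout v)) x l =
      path (boxed eps) (layout x) (map layout l) by move=> x0 l; elim: l x0 => //= y l IH x0; rewrite IH.
  rewrite map_track //.
  have hl := hs i0 j0 i3' j3'; rewrite (layout_ends i3').1.
  by rewrite rcons_path hl.1 hl.2 boxed_refl // ltW.
have step i0 j0 w : (i0 < 3)%N -> (j0 < 3)%N -> w \in links (6 + i0) (track i0 j0) ->
    [/\ layout w.1 \in a i0 :: s i0 j0, (w.1 < N)%N, (w.2 < N)%N &
     boxed (3 * eps) (perturb t layout w.1) (perturb t layout w.2)].
  move=> i3' j3' wl; have [w1 w2] := supp_mem wl.
  have /allP zs := (track_chain i3' j3').2.
  have /andP[w1N _] := zone_inside (zs _ w1); have /andP[w2N _] := zone_inside (zs _ w2).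
  split=> //.
    have := map_f layout (supp_links w1); rewrite /= map_track // (layout_ends i3').1.
    rewrite !inE mem_rcons inE => /or3P[->//|/eqP->|->]; rewrite ?orbT //.
    by rewrite -(hs i0 j0 i3' j3').2 -in_cons mem_last.
  have := hpath _ _ i3' j3'; rewrite all_links => /allP/(_ _ wl) /= cl.
  have -> : 3 * eps = eps + (eps + eps) by ring.
  apply: boxed_trans (boxed_trans cl (tN _ w2N)); by rewrite boxed_sym tN.
have [u1 u1N u2N uc] := step _ _ _ i3 j3 ul; have [v1 v1N v2N vc] := step _ _ _ i'3 j'3 vl.
exists i, i', j, j', (layout u.1), (layout v.1); split=> //.
have out w : w \in supp (links (6 + i') (track i' j')) -> w \notin supp (links (6 + i) (track i j)).
  move=> wl; have /allP zs := (track_chain i'3 j'3).2; have /allP zs' := (track_chain i3 j3).2.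
  by apply: contraL (zs _ wl) => /zs'; apply: zone_apart.
have [up uq] := supp_mem ul; have [vp vq] := supp_mem vl.
have ne (w w' : nat) : w \in supp (links (6 + i) (track i j)) -> w' \in supp (links (6 + i') (track i' j')) -> w != w'.
  by move=> h /out; apply: contraNneq => <-.
have u12 : u.1 != u.2 by apply/eqP => e; move: x; rewrite e xing_id.
have v12 : v.1 != v.2 by apply/eqP => e; move: x; rewrite xing_sym e xing_id.
have [||||x0 [y0 [x01 y01 e1 e2]]] := segments_meet _ _ _ _ x.
- by apply: gp => //; apply: ne.
- by apply: gp => //; apply: ne.
- by apply: gp => //; rewrite eq_sym; apply: ne.
- by apply: gp => //; rewrite eq_sym; apply: ne.
have cl := segments_close uc vc x01 y01 e1 e2.
(* Perturbed steps have length at most [3 * eps], crossing ones start within [6 * eps], and undoing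
   the perturbation costs [eps] at each of the two points. *)
have -> : 8 * eps = eps + (2 * (3 * eps) + eps) by ring.
apply: boxed_trans (tN _ u1N) (boxed_trans cl _); by rewrite boxed_sym tN.
Qed.

End Layout.

Lemma near_crossing (a b : nat -> R * R) (s : nat -> nat -> seq (R * R)) eps : 0 < eps ->
  (forall i j, (i < 3)%N -> (j < 3)%N -> path (boxed eps) (a i) (s i j) /\ last (a i) (s i j) = b j) ->
  exists i i' j j' p p', [/\ [/\ (i < 3)%N, (i' < 3)%N, (j < 3)%N & (j' < 3)%N], i != i', j != j',
    p \in a i :: s i j /\ p' \in a i' :: s i' j' & boxed (8 * eps) p p'].
Proof.
pose n := (\sum_(i < 3) \sum_(j < 3) size (s i j)).+1; apply: (@near_crossing_layout a b s n).
move=> i j i3 j3; rewrite ltnS (bigD1 (Ordinal i3)) //= (bigD1 (Ordinal j3)) //=.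
by rewrite -addnA leq_addr.
Qed.

End Nearness.

From mathcomp Require Import finmap.
From mathcomp Require Import all_classical all_reals all_analysis.
Require Import Defs.

Import Order.TTheory GRing.Theory Num.Theory.
Import numFieldNormedType.Exports.
Local Open Scope classical_set_scope.
Local Open Scope ring_scope.

(** * Entangled edges of a drawing *)

Section Arcs.
Variable R : realType.
Implicit Types (p q : R * R) (a b : R -> R * R) (d eps : R).

Lemma near_close p d : 0 < d -> \forall q \near p, boxed d p q.
Proof.
move=> d0; apply/nbhs_ballP; exists d => //= q [h1 h2].
by move: h1 h2; rewrite /boxed /ball /= => /ltW-> /ltW->.
Qed.

Lemma near0_bound d : 0 < d -> \forall x \near 0^'+, x <= d.
Proof. by move=> d0; apply: nbhs_right_le. Qed.

Lemma near0_ex (P : set R) : (\forall d \near 0^'+, P d) -> exists2 d, 0 < d & P d.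
Proof.
by move=> h; have [d [d0 Pd]] := filter_ex (filterI (nbhs_right_gt 0) h); exists d.
Qed.

Lemma separation (K L : set (R * R)) : compact K -> compact L -> K `&` L = set0 ->
  \forall d \near (0 : R)^'+, forall p q, K p -> L q -> ~~ boxed d p q.
Proof.
move=> cK cL KL.
have sep p : K p -> exists2 d, 0 < d & forall q, L q -> ~~ boxed d p q.
  move=> Kp; have nL : (~` L) p by move=> Lp; have : (K `&` L) p by []; rewrite KL.
  have : nbhs p (~` L).
    apply: open_nbhs_nbhs; split=> //; apply: closed_openC; apply: compact_closed => //.
  case/nbhs_ballP => d /= d0 dL; exists (d / 2); first by apply: divr_gt0.
  move=> q Lq; apply/negP => /andP[h1 h2]; apply: (dL q) => //; split.
    by apply: le_lt_trans h1 _; rewrite ltr_pdivrMr // ltr_pMr // ltr1n.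
  by apply: le_lt_trans h2 _; rewrite ltr_pdivrMr // ltr_pMr // ltr1n.
have : \forall d \near (0 : R)^'+, K `<=` (fun p => forall q, L q -> ~~ boxed d p q).
  apply: (compact_near_coveringP K).1 => // p Kp; have [d d0 dL] := sep p Kp.
  have d20 : 0 < d / 2 by apply: divr_gt0.
  exists ([set p' | boxed (d / 2) p p'], [set x | x <= d / 2]).
    by split; [exact: near_close|exact: near0_bound].
  move=> [p' x] /= [pp' xd] q Lq; apply: contra (dL q Lq) => p'q.
  by rewrite [d]splitr; apply: boxed_trans pp' _; apply: boxedW p'q.
by apply: filterS => d h p q Kp; apply: h.
Qed.

Lemma uniform_close a eps : {within `[0, 1]%classic, continuous a} -> 0 < eps ->
  exists2 d, 0 < d & forall s t, `[0, 1]%classic s -> `[0, 1]%classic t -> `|s - t| <= d -> boxed eps (a s) (a t).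
Proof.
move=> ca e0; have e20 : 0 < eps / 2 by apply: divr_gt0.
have : \forall d \near (0 : R)^'+, `[0, 1]%classic `<=`
   (fun s : R => `[0, 1]%classic s -> forall t, `[0, 1]%classic t -> `|s - t| <= d -> boxed eps (a s) (a t)).
  apply: (compact_near_coveringP _).1; first exact: segment_compact.
  move=> s s01.
  have : \forall t \near within `[0, 1]%classic (nbhs s), boxed (eps / 2) (a s) (a t).
    have /subspace_continuousP/(_ s s01) h := ca; exact: (h _ (near_close (a s) e20)).
  rewrite near_withinE => /nbhs_ballP[d /= d0 ds]; have d20 : 0 < d / 2 by apply: divr_gt0.
  exists ([set s' | `|s - s'| < d / 2] `&` [set s' | `[0, 1]%classic s' -> boxed (eps / 2) (a s) (a s')], [set x | x < d / 2]).
    split; last exact: nbhs_right_lt.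
    apply: filterI; first by apply/nbhs_ballP; exists (d / 2).
    apply/nbhs_ballP; exists d => // s' ss'; exact: ds.
  move=> [s' x] /= [[ss' cs'] xd] s'01 t t01 s't.
  rewrite [eps]splitr; apply: (@boxed_trans _ _ _ _ (a s)); first by rewrite boxed_sym; exact: cs'.
  apply: ds => //=; rewrite /ball /= [d]splitr; apply: le_lt_trans (ler_distD s' _ _) _.
  by rewrite ltrD // (le_lt_trans s't).
by case/near0_ex => d d0 h; exists d => // s t s01; apply: h.
Qed.

Lemma path_iota (T : Type) (r : rel T) (g : nat -> T) m n :
  (forall k, (m <= k < m + n)%N -> r (g k) (g k.+1)) ->
  path r (g m) [seq g k | k <- iota m.+1 n] /\ last (g m) [seq g k | k <- iota m.+1 n] = g (m + n)%N.
Proof.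
elim: n m => [|n IH] m h /=; first by rewrite addn0.
have [k|h1 h2] := IH m.+1.
  by move=> hk; apply: h; lia.
by rewrite h1 h2 h ?addSnnS //; lia.
Qed.

Lemma arc_chain a eps p q : {within `[0, 1]%classic, continuous a} -> 0 < eps -> arc a p -> arc a q ->
  exists s, [/\ path (boxed eps) p s, last p s = q & {in p :: s, forall u, arc a u}].
Proof.
move=> ca e0 [s s01 <-] [t t01 <-]; have [d d0 ud] := uniform_close ca e0.
pose n := (Num.truncn d^-1).+1.
have nd : (n%:R)^-1 <= d.
  rewrite -[leRHS]invrK lef_pV2 ?posrE ?invr_gt0 ?ltr0n //.
  by apply/ltW/truncnS_gt.
pose w k : R := s + (t - s) * (k%:R / n%:R).
have n0 : (n%:R : R) != 0 by rewrite pnatr_eq0.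
have w01 k : (k <= n)%N -> `[0, 1]%classic (w k).
  move=> kn; have : 0 <= (k%:R : R) / n%:R <= 1.
    by apply/andP; split; [exact: divr_ge0|rewrite ler_pdivrMr ?ltr0n // mul1r ler_nat].
  move: s01 t01; rewrite /= !in_itv /= => /andP[s0 s1] /andP[t0 t1] /andP[h0 h1].
  rewrite /w; move: h0 h1; move: (_ / _) => x x0 x1; apply/andP; split; nra.
have step k : (0 <= k < 0 + n)%N -> boxed eps (a (w k)) (a (w k.+1)).
  move=> /= kn; apply: ud; [by apply: w01; exact: ltnW|exact: w01|].
  have -> : w k - w k.+1 = - ((t - s) / n%:R) by rewrite /w -natr1; field.
  rewrite normrN normrM normfV normr_nat; apply: le_trans nd.
  rewrite -[leRHS]mul1r ler_wpM2r ?invr_ge0 ?ler0n // ler_norml.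
  by move: s01 t01; rewrite /= !in_itv /=; lra.
have [h1 h2] := path_iota step; have ws : w 0%N = s by rewrite /w mul0r mulr0 addr0.
have wt : w n = t by rewrite /w divff // mulr1 addrC subrK.
rewrite ws in h1 h2; exists [seq a (w k) | k <- iota 1 n]; split; first exact: h1.
  by rewrite h2 add0n wt.
move=> u; rewrite inE => /orP[/eqP->|/mapP[k]]; first by exists s.
by rewrite mem_iota add1n ltnS => /andP[_ /w01 hk] ->; exists (w k).
Qed.

End Arcs.

(** * Entanglement of drawn edges and its weight *)

Section Strings.
Variables (R : realType) (V : finType) (e : rel V) (D : drawing R e).
Implicit Types (p q : R * R).

Definition edge := {f : {set V} | f \in edges e}.

Definition entangled : rel edge := fun f g =>
  [|| f == g, ~~ [disjoint val f & val g] | [set val f; val g]%SET \in crossing_pairs D].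

Lemma entangled_refl : reflexive entangled.
Proof. by move=> f; rewrite /entangled eqxx. Qed.

Lemma entangled_sym : symmetric entangled.
Proof. by move=> f g; rewrite /entangled eq_sym disjoint_sym finset.setUC. Qed.

Lemma edgesP (f : {set V}) : f \in edges e -> exists x y, e x y /\ f = [set x; y]%SET.
Proof. by rewrite inE => /existsP[x /existsP[y /andP[xy /eqP->]]]; exists x, y. Qed.

Lemma cross_at_arcs (a b : R -> R * R) p : cross_at a b p -> arc a p /\ arc b p.
Proof.
move=> [U [W [h [g [[_ Up _ hp] _ _ ha hb]]]]].
by split; [apply/(ha _ Up)|apply/(hb _ Up)]; rewrite hp.
Qed.

Lemma pos_arc f v : f \in edges e -> v \in f -> arc (curve D f) (pos D v).
Proof.
move=> fe vf; have : [set pos D v | v in [set` f]] (pos D v) by exists v.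
by rewrite -curve_ends // => -[->|->]; [exists 0|exists 1]; rewrite //= in_itv /= ?lexx ?ler01.
Qed.

Lemma entangled_meet f g : entangled f g ->
  exists p, arc (curve D (val f)) p /\ arc (curve D (val g)) p.
Proof.
have /edgesP[x [y [_ fxy]]] := valP f.
case/or3P=> [/eqP<-||].
- by exists (pos D x); split; apply: pos_arc (valP f) _; rewrite fxy !inE eqxx.
- rewrite disjoint_subset => /subsetPn[v vf]; rewrite !inE negbK => vg.
  by exists (pos D v); split; [apply: pos_arc (valP f) _|apply: pos_arc (valP g) _].
rewrite inE => /asboolP[f' [g' [_ _ fg' /finset.setP E [p /cross_at_arcs[pf pg]]]]].
exists p; have := E f'; have := E g'; have := E (val f); have := E (val g).
rewrite !inE !eqxx ?orbT /= => /esym E1 /esym E2.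
case/orP: E1 E2 => /eqP-> /orP[]/eqP-> // ; rewrite !orbb => /eqP k1 /eqP k2.
Qed.

(** A common point that is an end of one edge is a vertex, which the other edge may contain only as
    its own end. A common interior point is a crossing because tangency is excluded. *)
Lemma meet_entangled f g p : arc (curve D (val f)) p -> arc (curve D (val g)) p -> entangled f g.
Proof.
have interior (h : edge) : arc (curve D (val h)) p -> arc_interior (curve D (val h)) p \/
    exists2 v, v \in val h & p = pos D v.
  move=> [t t01 tp]; have := curve_ends D (valP h).
  have [t0|t0] := eqVneq t 0.
    move/seteqP=> [/(_ p) + _]; case; first by left; rewrite -tp t0.
    by move=> v vh vp; right; exists v.
  have [t1|t1] := eqVneq t 1.
    move/seteqP=> [/(_ p) + _]; case; first by right; rewrite -tp t1.
    by move=> v vh vp; right; exists v.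
  move=> _; left; exists t => //; move: t01; rewrite /= !in_itv /= => /andP[h0 h1].
  by rewrite !lt_neqAle h0 h1 eq_sym t0 t1.
move=> pf pg; apply/or3P.
have shared (f' g' : edge) v : v \in val f' -> p = pos D v -> arc (curve D (val g')) p -> ~~ [disjoint val f' & val g'].
  move=> vf pv; rewrite pv => /(curve_avoids (valP g')) vg.
  by rewrite disjoint_subset; apply/subsetPn; exists v => //; rewrite !inE negbK.
have [fg|fg] := eqVneq f g; first exact: Or31.
have [pf'|[v vf pv]] := interior f pf; last by apply: Or32; apply: shared vf pv pg.
have [pg'|[v vg pv]] := interior g pg; last by apply: Or32; rewrite disjoint_sym; apply: shared vg pv pf.
apply: Or33; rewrite inE; apply/asboolP; exists (val f), (val g); split; rewrite ?(valP f) ?(valP g) //.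
exists p; apply: contrapT => no.
have fg' : val f != val g by rewrite (inj_eq val_inj).
exact: (curves_not_tangent (d := D) (valP f) (valP g) fg' (And3 pf' pg' no)).
Qed.

(** Curves of edges that are not entangled are disjoint compact sets, and there are finitely many
    pairs. *)
Lemma entangled_separation : exists2 d, 0 < d & forall f g p q,
  arc (curve D (val f)) p -> arc (curve D (val g)) q -> boxed d p q -> entangled f g.
Proof.
apply: near0_ex; apply: filter_forall => f; apply: filter_forall => g.
have cpt (h : edge) : compact (arc (curve D (val h))).
  apply: continuous_compact; last exact: segment_compact.
  exact: curve_continuous (valP h).
have [fg|fg] := boolP (entangled f g); first by apply: filterE.
apply: filterS (separation (cpt f) (cpt g) _).
  by move=> d h p q pf qg c; have := h p q pf qg; rewrite c.
by rewrite -subset0 => p [pf pg]; rewrite (meet_entangled pf pg) in fg.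
Qed.

Lemma entangled_chain eps X f g p q : 0 < eps -> joined entangled X f g ->
  arc (curve D (val f)) p -> arc (curve D (val g)) q ->
  exists s, [/\ path (boxed eps) p s, last p s = q &
    {in p :: s, forall u, exists2 h, h \in X & arc (curve D (val h)) u}].
Proof.
move=> eps0 /joinedP[l [/=]]; elim: l f p => [|f' l IH] f p /= /andP[fX lX].
  move=> _ -> pf qg; have [s [h1 h2 h3]] := arc_chain (curve_continuous (d := D) (valP f)) eps0 pf qg.
  by exists s; split=> // u /h3; exists f.
case/andP=> /entangled_meet[r [rf rf']] ll gl pf qg.
have [s [h1 h2 h3]] := arc_chain (curve_continuous (d := D) (valP f)) eps0 pf rf.
have [s' [h1' h2' h3']] := IH f' r lX ll gl rf' qg.
exists (s ++ s'); split.
- by rewrite cat_path h1 h2.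
- by rewrite last_cat h2.
- move=> u; rewrite -cat_cons mem_cat => /orP[/h3|us]; first by exists f.
  by apply: h3'; rewrite inE us orbT.
Qed.

Lemma entangled_K33 : K33_crossing entangled.
Proof.
move=> P P' X XP; have [d d0 dP] := entangled_separation.
(* The step is an eighth of the separation distance because [near_crossing] loses a factor 8. *)
have e0 : 0 < d / 8 by apply: divr_gt0.
have start (f : edge) : arc (curve D (val f)) (curve D (val f) 0).
  by exists 0; rewrite //= in_itv /= lexx ler01.
pose A i := curve D (val (P (inord i))) 0; pose B j := curve D (val (P' (inord j))) 0.
have ch (ij : nat * nat) := entangled_chain e0 (XP (inord ij.1) (inord ij.2)) (start _) (start _).
have [s hs] := choice ch.
have [i j i3 j3|i [i' [j [j' [p [p' [[i3 i'3 j3 j'3] ii' jj' [pi pi'] c]]]]]]] :=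
  @near_crossing R A B (fun i j => s (i, j)) (d / 8) e0.
  by have [h1 h2 _] := hs (i, j).
have [_ _ /(_ p pi)[u uX pu]] := hs (i, j).
have [_ _ /(_ p' pi')[v vX pv]] := hs (i', j').
exists (inord i), (inord i'), (inord j), (inord j'), u, v; split=> //.
- by rewrite -val_eqE /= !inordK.
- by rewrite -val_eqE /= !inordK.
- by apply: dP pu pv _; rewrite [d](_ : _ = 8 * (d / 8)) //; field.
Qed.

Hypothesis e_sym : symmetric e.

Lemma card_edges_at v : (#|[set g : edge | v \in val g]%SET| <= degree e v)%N.
Proof.
rewrite -(card_imset _ val_inj) /degree.
apply: leq_trans (leq_imset_card (fun w => [set v; w]%SET) [set w | e v w]%SET).
apply/subset_leq_card/fintype.subsetP => f /imsetP[g]; rewrite inE => vg ->.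
have /edgesP[x [y [xy gxy]]] := valP g; move: vg; rewrite gxy !inE => /orP[]/eqP->.
  by apply/imsetP; exists y; rewrite ?inE.
by apply/imsetP; exists x; rewrite ?inE 1?e_sym // finset.setUC.
Qed.

Lemma card_ordered_pairs (F : {set {set V}}) : F \in crossing_pairs D ->
  (#|[set u : edge * edge | [set val u.1; val u.2]%SET == F]%SET| <= 2)%N.
Proof.
rewrite inE => /asboolP[x [y [xe ye xy -> _]]].
pose x' : edge := Sub x xe; pose y' : edge := Sub y ye.
apply: leq_trans (_ : (#|[set (x', y'); (y', x')]%SET| <= 2)%N); last by rewrite cards2; case: eqP.
apply/subset_leq_card/fintype.subsetP => -[f g]; rewrite !inE /= => /eqP E.
have := congr1 (fun F : {set {set V}} => #|F|) E; rewrite !cards2 xy => c.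
have in2 (h : edge) : val h \in [set val f; val g]%SET -> h = x' \/ h = y'.
  by rewrite E !inE => /orP[]/eqP hx; [left|right]; apply: val_inj.
have [] := in2 f _; first by rewrite !inE eqxx.
  have [] := in2 g _; first by rewrite !inE eqxx orbT.
    by move=> gx fx; move: c; rewrite gx fx eqxx.
  by move=> -> ->; rewrite eqxx.
have [] := in2 g _; first by rewrite !inE eqxx orbT.
  by move=> -> ->; rewrite eqxx orbT.
by move=> gx fx; move: c; rewrite gx fx eqxx.
Qed.

Lemma vol_entangled : (vol (nbrs entangled) [set: edge]%SET <=
  \sum_(v : V) degree e v ^ 2 + 2 * #|crossing_pairs D|)%N.
Proof.
(* An edge meets itself, so the case [f == g] of entanglement is counted here. *)
pose m (f : edge) := #|[set g : edge | ~~ [disjoint val f & val g]]%SET|.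
pose c (f : edge) := #|[set g : edge | [set val f; val g]%SET \in crossing_pairs D]%SET|.
have split_nbrs f : (nbrs entangled f <= m f + c f)%N.
  rewrite /nbrs /m /c -cardsUI; apply: leq_trans (leq_addr _ _).
  rewrite /entangled; move: (crossing_pairs D) => CP.
  apply/subset_leq_card/fintype.subsetP => g; rewrite !inE => /or3P[/eqP<-|->//|->]; last by rewrite orbT.
  have /edgesP[x [y [_ E]]] := valP f.
  apply/orP; left; rewrite disjoint_subset; apply/subsetPn; exists x; first by rewrite E !inE eqxx.
  by rewrite !inE negbK E !inE eqxx.
apply: (@leq_trans (\sum_(f in [set: edge]%SET) (m f + c f))).
  by apply: leq_sum => f _; exact: split_nbrs.
rewrite big_split; apply: leq_add.
  (* Exchanging the sums counts each vertex once per incident edge, with its degree: the sum of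
     squares. *)
  apply: (@leq_trans (\sum_(f in [set: edge]%SET) \sum_(v in val f) degree e v)).
    apply: leq_sum => f _.
    apply: (@leq_trans #|(\bigcup_(v in val f) [set g : edge | v \in val g])%SET|).
      apply/subset_leq_card/fintype.subsetP => g; rewrite !inE disjoint_subset => /subsetPn[v vf].
      by rewrite !inE negbK => vg; apply/finset.bigcupP; exists v; rewrite ?inE.
    elim/big_rec2: _ => [|v n U _ h]; first by rewrite cards0.
    apply: leq_trans (leq_card_setU _ _) _; apply: leq_add => //; exact: card_edges_at.
  rewrite (exchange_big_dep predT) //=; apply: leq_sum => v _.
  rewrite sum_nat_cond_const mulnC -mulnn leq_mul2l; apply/orP; right.
  by apply: leq_trans (card_edges_at v); apply/eq_leq/eq_card => f; rewrite !inE.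
pose P (u : edge * edge) := [set val u.1; val u.2]%SET.
have -> : (\sum_(f in [set: edge]%SET) c f = #|[set u | P u \in crossing_pairs D]%SET|)%N.
  under eq_bigr => f _ do rewrite /c -sum1dep_card.
  by rewrite pair_big_dep /= -sum1dep_card; apply: eq_bigl => -[f g]; rewrite /= finset.in_setT.
apply: (@leq_trans #|(\bigcup_(F in crossing_pairs D) [set u | P u == F])%SET|).
  apply/subset_leq_card/fintype.subsetP => u; rewrite finset.in_set => uP.
  by apply/finset.bigcupP; exists (P u) => //; rewrite finset.in_set.
apply: (@leq_trans (\sum_(F in crossing_pairs D) 2)); last by rewrite sum_nat_const mulnC.
elim/big_rec2: _ => [|F n U FP h]; first by rewrite cards0.
apply: leq_trans (leq_card_setU _ _) _; apply: leq_add => //; exact: card_ordered_pairs.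
Qed.

End Strings.

(** * Straight edges between points of a parabola *)

Section Spread.
Implicit Types (a b c d e f M : int) (i j k : nat).

(* The determinant with rows [(a + b, ab, 1)], [(c + d, cd, 1)], [(e + f, ef, 1)]: it vanishes when
   the chords [ab], [cd], [ef] of the parabola are concurrent. *)
Definition concurrence (K : comNzRingType) (a b c d e f : K) :=
  (c + d - (a + b)) * (e * f - a * b) - (c * d - a * b) * (e + f - (a + b)).

(** The determinant is linear in [f]. If the coefficient [S * e - P] is nonzero, it is at least 1 in
    absolute value and [f] dominates the rest, which is at most [4 * M ^ 3]. If both coefficient and
    rest vanished, [e] or [c] would equal [a] or [b]. *)
Lemma concurrence_far a b c d e f M :
  all (fun x => 0 <= x <= M) [:: a; b; c; d; e] -> 4 * M ^+ 3 < f ->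
  e != a -> e != b -> c != a -> c != b -> concurrence a b c d e f != 0.
Proof.
case/and5P=> /andP[a0 aM] /andP[b0 bM] /andP[c0 cM] /andP[d0 dM] /andP[/andP[e0 eM] _] fM ea eb ca cb.
have M0 : 0 <= M by apply: le_trans a0 aM.
pose S := c + d - (a + b); pose P := c * d - a * b; pose Q := e - a - b.
have -> : concurrence a b c d e f = (S * e - P) * f - (S * (a * b) + P * Q).
  by rewrite /concurrence /S /P /Q; ring.
rewrite subr_eq0; apply/eqP => E.
have ab : 0 <= a * b <= M ^+ 2 by rewrite mulr_ge0 // expr2 ler_pM.
have cd : 0 <= c * d <= M ^+ 2 by rewrite mulr_ge0 // expr2 ler_pM.
have [al|al] := eqVneq (S * e - P) 0.
  have : S * ((e - a) * (e - b)) = 0.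
    rewrite al mul0r in E.
    have -> : S * ((e - a) * (e - b)) = S * (a * b) + P * Q + (S * e - P) * Q by rewrite /Q; ring.
    by rewrite al -E mul0r addr0.
  move/eqP; rewrite !mulf_eq0 !subr_eq0 (negPf ea) (negPf eb) !orbF => /eqP S0.
  have P0 : P = 0 by move: al; rewrite /S S0 subrr mul0r sub0r => /eqP; rewrite oppr_eq0 => /eqP.
  have : (c - a) * (c - b) = 0.
    have -> : (c - a) * (c - b) = c * S - P by rewrite /S /P; ring.
    by rewrite /S S0 P0 subrr mulr0 subr0.
  by move/eqP; rewrite mulf_eq0 !subr_eq0 (negPf ca) (negPf cb).
have f0 : 0 < f by apply: le_lt_trans fM; rewrite mulr_ge0 ?exprn_ge0.
have : `|S * (a * b) + P * Q| < f.
  apply: le_lt_trans fM; apply: le_trans (ler_normD _ _) _; rewrite !normrM.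
  have -> : 4 * M ^+ 3 = 2 * M * M ^+ 2 + M ^+ 2 * (2 * M) by ring.
  apply: lerD; apply: ler_pM; rewrite ?normr_ge0 ?ler_norml // /S /P /Q; move: ab cd; clear -a0 aM b0 bM c0 cM d0 dM e0 eM; lia.
by rewrite -E normrM (gtr0_norm f0) gtr_pMl // ltNge -gtz0_ge1 normr_gt0 al.
Qed.

(** Each value is the fourth power of the preceding one; as it is at least 8, this exceeds four
    times its cube, the gap asked by [concurrence_far]. *)
Definition spread k : int := 8 ^+ (4 ^ k).

Lemma spread_ge1 k : 1 <= spread k. Proof. by rewrite exprn_ege1. Qed.

Lemma spreadS k : spread k.+1 = spread k * spread k ^+ 3.
Proof. by rewrite /spread expnS exprM -exprS -!exprM mulnC. Qed.

Lemma spread_lt i j : (i < j)%N -> spread i < spread j.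
Proof. by move=> ij; rewrite /spread ltr_eXn2l // ltn_exp2l. Qed.

Lemma spread_far i j : (i < j)%N -> 4 * spread i ^+ 3 < spread j.
Proof.
move=> ij; apply: (@lt_le_trans _ _ (spread i.+1)).
  rewrite spreadS ltr_pM2r; last by rewrite exprn_gt0 // (lt_le_trans _ (spread_ge1 i)).
  by apply: (@lt_le_trans _ _ (8 ^+ 1)) => //; rewrite ler_eXn2l // expn_gt0.
by rewrite /spread ler_eXn2l // leq_exp2l.
Qed.

Lemma spread_inj : injective spread.
Proof.
move=> i j; case: (ltngtP i j) => // /spread_lt h e; by rewrite e ltxx in h.
Qed.

Lemma spread_le i j : (i <= j)%N -> spread i <= spread j.
Proof. by move=> ij; rewrite /spread ler_eXn2l // leq_exp2l. Qed.

Let top i1 i2 i3 i4 i5 i6 : uniq [:: i1; i2; i3; i4; i5; i6] ->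
  all (fun i => i < i6)%N [:: i1; i2; i3; i4; i5] ->
  concurrence (spread i1) (spread i2) (spread i3) (spread i4) (spread i5) (spread i6) != 0.
Proof.
move=> u lt6; pose m := i6.-1.
have i60 : (0 < i6)%N by case/andP: lt6; case: (i6).
apply: (@concurrence_far _ _ _ _ _ _ (spread m)).
- have /allP le6 := lt6; apply/allP => x /(mapP (s := [:: i1; i2; i3; i4; i5]))[i /le6 hi ->].
  rewrite (le_trans _ (spread_ge1 i)) //= spread_le // /m -ltnS prednK //.
- by apply: spread_far; rewrite /m prednK.
all: by rewrite (inj_eq spread_inj); apply: contraTneq u => ->; rewrite /= !inE eqxx ?orbT /= ?andbF.
Qed.

(** The determinant is invariant under rotating the chords and under swapping the ends of the last
    one, so the largest point can be moved to the last place. *)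
Lemma spread_concurrence i1 i2 i3 i4 i5 i6 : uniq [:: i1; i2; i3; i4; i5; i6] ->
  concurrence (spread i1) (spread i2) (spread i3) (spread i4) (spread i5) (spread i6) != 0.
Proof.
have exmax x l : exists2 m, m \in x :: l & all (fun i => i <= m)%N (x :: l).
  elim: l x => [|y l IH] x; first by exists x; rewrite /= ?inE ?eqxx ?leqnn.
  have [m ml mm] := IH y; case: (leqP x m) => xm; [exists m|exists x].
  - by rewrite inE ml orbT.
  - by rewrite /= xm.
  - by rewrite inE eqxx.
  - by rewrite /= leqnn; apply: sub_all mm => i im; apply: ltnW; apply: leq_ltn_trans xm.
move=> u; have [m ml mm] := exmax i1 [:: i2; i3; i4; i5; i6].
have C1 (x y z w s t : int) : concurrence x y z w s t = concurrence z w s t x y by rewrite /concurrence; ring.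
have C2 (x y z w s t : int) : concurrence x y z w s t = concurrence x y z w t s by rewrite /concurrence; ring.
have lt i : i \in [:: i1; i2; i3; i4; i5; i6] -> i != m -> (i < m)%N.
  by move=> hi im; rewrite ltn_neqAle im (allP mm).
have T j1 j2 j3 j4 j5 : perm_eq [:: j1; j2; j3; j4; j5; m] [:: i1; i2; i3; i4; i5; i6] ->
    concurrence (spread j1) (spread j2) (spread j3) (spread j4) (spread j5) (spread m) != 0.
  move=> pj; have uj : uniq [:: j1; j2; j3; j4; j5; m] by rewrite (perm_uniq pj).
  apply: top => //; apply/allP => x xj; apply: lt.
    rewrite -(perm_mem pj) -[X in _ \in X]/(rcons [:: j1; j2; j3; j4; j5] m) mem_rcons inE xj orbT //.
  by apply: contraTneq uj => <-; rewrite -[X in uniq X]/(rcons [:: j1; j2; j3; j4; j5] x) rcons_uniq xj.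
move: ml; rewrite !inE => /orP[/eqP em|/orP[/eqP em|/orP[/eqP em|/orP[/eqP em|/orP[]/eqP em]]]];
  rewrite -em in T *.
- by rewrite C1 C2; apply: T; apply/permP => q /=; lia.
- by rewrite C1; apply: T; apply/permP => q /=; lia.
- by rewrite C1 C1 C2; apply: T; apply/permP => q /=; lia.
- by rewrite C1 C1; apply: T; apply/permP => q /=; lia.
- by rewrite C2; apply: T; apply/permP => q /=; lia.
- by apply: T; apply/permP => q /=; lia.
Qed.

End Spread.

(** * Meeting and crossing of chords of the parabola *)

Section Chords.
Variable R : realType.
Implicit Types (a b c d e f t : R) (p q : R * R).

Definition chord a b t : R * R := (a + t * (b - a), a ^+ 2 + t * (b ^+ 2 - a ^+ 2)).

Definition chord_line a b p := p.2 - (a + b) * p.1 + a * b.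

Definition chord_side a b p := (p.1 - a) * (p.1 - b).

Lemma chord_lineE a b t : chord_line a b (chord a b t) = 0.
Proof. by rewrite /chord_line /chord /=; ring. Qed.

Lemma chord_sideE a b t : chord_side a b (chord a b t) = - (t * (1 - t)) * (b - a) ^+ 2.
Proof. by rewrite /chord_side /chord /=; ring. Qed.

Lemma chordP a b p : a != b -> arc (chord a b) p <-> chord_line a b p = 0 /\ chord_side a b p <= 0.
Proof.
move=> ab; have ba : b - a != 0 by rewrite subr_eq0 eq_sym.
split=> [[t /= + <-]|[lp sp]].
  rewrite in_itv /= => /andP[t0 t1]; rewrite chord_lineE chord_sideE; split=> //.
  rewrite mulNr oppr_le0; apply: mulr_ge0; last exact: sqr_ge0.
  by apply: mulr_ge0; rewrite ?subr_ge0.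
exists ((p.1 - a) / (b - a)).
  pose t := (p.1 - a) / (b - a); have tE : p.1 = a + t * (b - a) by rewrite /t; field.
  move: sp; rewrite -/t /chord_side tE /= in_itv /=.
  have -> : (a + t * (b - a) - a) * (a + t * (b - a) - b) = t * (t - 1) * (b - a) ^+ 2 by ring.
  rewrite pmulr_lle0; last by rewrite exprn_even_gt0.
  by move=> h; apply/andP; split; nra.
rewrite /chord; move: lp; rewrite /chord_line; case: p {sp} => x y /= h.
by congr pair; [field|apply/eqP; rewrite eq_sym -subr_eq0 -h; apply/eqP; field].
Qed.

Lemma chord_interior a b p : a != b -> arc_interior (chord a b) p -> chord_line a b p = 0 /\ chord_side a b p < 0.
Proof.
move=> ab [t /= + <-]; have ba : b - a != 0 by rewrite subr_eq0 eq_sym.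
rewrite in_itv /= => /andP[t0 t1]; rewrite chord_lineE chord_sideE; split=> //.
by rewrite mulNr oppr_lt0; apply: mulr_gt0; rewrite ?exprn_even_gt0 //; apply: mulr_gt0; rewrite ?subr_gt0.
Qed.

Lemma chord_simple a b s t : a != b -> chord a b s = chord a b t -> s = t.
Proof.
rewrite -subr_eq0 -oppr_eq0 opprB => ab [/addrI/(mulIf ab)]; exact.
Qed.

Lemma continuous_pair (T : topologicalType) (f g : T -> R) :
  continuous f -> continuous g -> continuous (fun x => (f x, g x)).
Proof. by move=> cf cg x; exact: (cvg_pair (cf x) (cg x)). Qed.

Lemma chord_continuous a b : continuous (chord a b).
Proof.
by apply: continuous_pair => t; (apply: cvgD; [exact: cvg_cst|apply: cvgM; [exact: cvg_id|exact: cvg_cst]]).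
Qed.

(** Chords of equal slope that meet lie on one line, and a line meets the parabola in at most two
    points. *)
Lemma slopes_neq a b c d p : (c != a) && (c != b) || (d != a) && (d != b) ->
  chord_line a b p = 0 -> chord_line c d p = 0 -> a + b != c + d.
Proof.
rewrite /chord_line => ne h1 h2; apply/eqP => e; rewrite e in h1.
have abcd : a * b = c * d by lra.
have hc : (c - a) * (c - b) = 0.
  have -> : (c - a) * (c - b) = c ^+ 2 - (a + b) * c + a * b by ring.
  by rewrite e abcd; ring.
have hd : (d - a) * (d - b) = 0.
  have -> : (d - a) * (d - b) = d ^+ 2 - (a + b) * d + a * b by ring.
  by rewrite e abcd; ring.
move/eqP: hc; move/eqP: hd; rewrite !mulf_eq0 !subr_eq0.
by case/orP: ne => /andP[/negPf-> /negPf->].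
Qed.

Lemma lines_meet_once a b c d p q : a + b != c + d ->
  chord_line a b p = 0 -> chord_line c d p = 0 ->
  chord_line a b q = 0 -> chord_line c d q = 0 -> p = q.
Proof.
rewrite -subr_eq0 /chord_line; case: p q => [x y] [x' y'] /= ne h1 h2 h3 h4.
have e : x = x'.
  apply: (mulfI ne); apply/eqP; rewrite -subr_eq0; apply/eqP.
  by transitivity (y - (c + d) * x + c * d - (y - (a + b) * x + a * b) -
     (y' - (c + d) * x' + c * d - (y' - (a + b) * x' + a * b))); [ring|rewrite h1 h2 h3 h4; ring].
by congr pair; rewrite // e in h1 *; lra.
Qed.

Lemma lines_concurrence a b c d e f p : chord_line a b p = 0 -> chord_line c d p = 0 ->
  chord_line e f p = 0 -> concurrence a b c d e f = 0.
Proof.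
rewrite /chord_line /concurrence => h1 h2 h3.
have -> : e * f - a * b = (e + f - (a + b)) * p.1 by lra.
have -> : c * d - a * b = (c + d - (a + b)) * p.1 by lra.
by ring.
Qed.

(** The equation of line [ab] takes the values [(c - a) * (c - b)] and [(d - a) * (d - b)] at the
    ends of chord [cd]. It is affine and vanishes at [p] between them, so the signs differ. *)
Lemma chords_interleave a b c d p : c != d -> c != a -> c != b -> d != a -> d != b ->
  chord_line a b p = 0 -> chord_line c d p = 0 -> chord_side c d p <= 0 ->
  ((c - a) * (c - b) < 0) != ((d - a) * (d - b) < 0).
Proof.
rewrite /chord_line /chord_side => cd ca cb da db h1 h2 sp.
have E : (c - a) * (c - b) * (d - p.1) + (d - a) * (d - b) * (p.1 - c) = 0.
  transitivity ((d - c) * (p.2 - (a + b) * p.1 + a * b - (p.2 - (c + d) * p.1 + c * d))); first by ring.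
  by rewrite h1 h2; ring.
have c0 : (c - a) * (c - b) != 0 by rewrite mulf_neq0 // subr_eq0.
have d0 : (d - a) * (d - b) != 0 by rewrite mulf_neq0 // subr_eq0.
have st : 0 <= (d - p.1) * (p.1 - c).
  have -> : (d - p.1) * (p.1 - c) = - ((p.1 - c) * (p.1 - d)) by ring.
  by rewrite oppr_ge0.
have dc : (d - p.1) + (p.1 - c) != 0 by rewrite addrA subrK subr_eq0 eq_sym.
move: ((c - a) * (c - b)) ((d - a) * (d - b)) (d - p.1) (p.1 - c) c0 d0 st dc E => u v t s u0 v0 st dc E.
apply: contra dc => /eqP uv; have uv0 : 0 < u * v.
  by case: (ltgtP u 0) uv u0 => // hu; case: (ltgtP v 0) v0 => // hv _ _ _; [rewrite nmulr_rgt0|rewrite pmulr_rgt0].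
have h : (u * t) ^+ 2 = - (u * v * (t * s)).
  have e : u * t = - (v * s) by lra.
  by rewrite expr2 {1}e; ring.
have : (u * t) ^+ 2 <= 0 by rewrite h oppr_le0 mulr_ge0 // ltW.
rewrite real_exprn_even_le0 ?num_real // mulf_eq0 (negPf u0) /= => /eqP t0.
by move: E; rewrite t0 mulr0 !add0r => /eqP; rewrite mulf_eq0 (negPf v0).
Qed.

(** The two line equations are affine coordinates of the plane, and over the strip [U] each chord
    coincides with its line. *)
Lemma chords_cross_at a b c d p : a != b -> c != d -> a + b != c + d ->
  arc_interior (chord a b) p -> arc_interior (chord c d) p -> cross_at (chord a b) (chord c d) p.
Proof.
move=> ab cd ne /(chord_interior ab)[l1 s1] /(chord_interior cd)[l2 s2].
pose U : set (R * R) := [set q | chord_side a b q < 0] `&` [set q | chord_side c d q < 0].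
pose h q : R * R := (chord_line c d q, chord_line a b q).
pose m := (a + b) - (c + d); have m0 : m != 0 by rewrite subr_eq0.
pose x q := (q.1 - q.2 - c * d + a * b) / m.
pose g q : R * R := (x q, q.2 + (a + b) * x q - a * b).
have gh q : g (h q) = q.
  have e : x (h q) = q.1 by rewrite /x /h /chord_line /m /=; field; exact: m0.
  by case: q e => q1 q2 e; rewrite /g e /h /chord_line /=; congr pair; ring.
have hg q : h (g q) = q.
  by case: q => q1 q2; rewrite /h /g /chord_line /x /m /=; congr pair; [field; exact: m0|ring].
have cline u v : continuous (chord_line u v).
  move=> q; apply: cvgD; last exact: cvg_cst.
  apply: cvgB; first exact: cvg_snd.
  by apply: cvgM; [exact: cvg_cst|exact: cvg_fst].
have cside u v : continuous (chord_side u v).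
  by move=> q; apply: cvgM; apply: cvgB; [exact: cvg_fst|exact: cvg_cst|exact: cvg_fst|exact: cvg_cst].
have ch : continuous h by apply: continuous_pair; exact: cline.
have cx : continuous x.
  move=> q; apply: cvgM; last exact: cvg_cst.
  by apply: cvgD; last exact: cvg_cst; apply: cvgB; last exact: cvg_cst; apply: cvgB; [exact: cvg_fst|exact: cvg_snd].
have cg : continuous g.
  apply: continuous_pair; first exact: cx.
  move=> q; apply: cvgB; last exact: cvg_cst; apply: cvgD; first exact: cvg_snd.
  by apply: cvgM; [exact: cvg_cst|exact: cx].
have oU : open U.
  have o u v : open [set q | chord_side u v q < 0].
    apply: (open_comp (D := [set t : R | t < 0])); last exact: open_lt.
    by move=> q _; exact: cside.
  by apply: openI.
exists U, (g @^-1` U), h, g; split.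
- split=> //; last by rewrite /h l1 l2.
  by apply: open_comp => // q _; exact: cg.
- by split; apply: continuous_subspaceT.
- by split=> // q; rewrite /= gh.
- by move=> q [q1 _]; rewrite (chordP _ ab) /=; split=> [[]//|->]; split=> //; exact: ltW.
- by move=> q [_ q2]; rewrite (chordP _ cd) /=; split=> [[]//|->]; split=> //; exact: ltW.
Qed.

End Chords.

(** * The straight-line drawing on a parabola *)

Section StraightLine.
Variables (R : realType) (V : finType) (e : rel V) (l r : {set V} -> V) (s : seq V).
Hypothesis ends : forall f, f \in edges e -> f = [set l f; r f]%SET /\ l f != r f.
Hypothesis all_s : forall v, v \in s.
Implicit Types (f g k : {set V}) (p q : R * R) (u v w : V).

Let rk v := index v s.
Let X v : R := (spread (rk v))%:~R.

Let X_inj : injective X.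
Proof.
move=> u v /eqP; rewrite /X eqr_int => /eqP/spread_inj rkuv.
by rewrite -(nth_index u (all_s u)) -/(rk u) rkuv nth_index.
Qed.

Let X_lt u v : (X u < X v) = (rk u < rk v)%N.
Proof.
rewrite /X ltr_int; case: (ltngtP (rk u) (rk v)) => [/spread_lt//|/spread_lt/ltW h|->].
  by rewrite ltNge h.
by rewrite ltxx.
Qed.

Let neqX u v : (X u != X v) = (u != v). Proof. by rewrite (inj_eq X_inj). Qed.

Let line_neq f g : f \in edges e -> g \in edges e -> f != g ->
  (X (l g) != X (l f)) && (X (l g) != X (r f)) || (X (r g) != X (l f)) && (X (r g) != X (r f)).
Proof.
move=> fe ge fg; have [fE flr] := ends fe; have [gE glr] := ends ge.
rewrite !neqX -!negb_or -negb_and; apply: contra fg => /andP[h1 h2].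
suff : g \subset f by rewrite eq_sym eqEcard => ->; rewrite fE gE !cards2 flr glr.
by rewrite gE finset.subUset !finset.sub1set fE !inE h1 h2.
Qed.

Let X_neq f : f \in edges e -> X (l f) != X (r f).
Proof. by move=> fe; rewrite neqX; have [] := ends fe. Qed.

Definition parabola_point v : R * R := (X v, X v ^+ 2).
Definition parabola_chord f : R -> R * R := chord (X (l f)) (X (r f)).

Let line f p := chord_line (X (l f)) (X (r f)) p.

Let arc_line f p : f \in edges e -> arc (parabola_chord f) p -> line f p = 0.
Proof. by move=> fe /(chordP _ (X_neq fe))[]. Qed.

Let chords_once f g p q : f \in edges e -> g \in edges e -> f != g ->
  arc (parabola_chord f) p -> arc (parabola_chord g) p ->
  arc (parabola_chord f) q -> arc (parabola_chord g) q -> p = q.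
Proof.
move=> fe ge fg /(arc_line fe) pf /(arc_line ge) pg /(arc_line fe) qf /(arc_line ge) qg.
exact: (lines_meet_once (slopes_neq (line_neq fe ge fg) pf pg) pf pg qf qg).
Qed.

Let line_at f v : line f (parabola_point v) = (X v - X (l f)) * (X v - X (r f)).
Proof. by rewrite /line /chord_line /parabola_point /=; ring. Qed.

Lemma parabola_avoids f v : f \in edges e -> arc (parabola_chord f) (parabola_point v) -> v \in f.
Proof.
move=> fe /(arc_line fe)/eqP; rewrite line_at mulf_eq0 !subr_eq0 !(inj_eq X_inj) (ends fe).1 !inE.
by rewrite -(ends fe).1.
Qed.

Lemma parabola_ends f v : f \in edges e -> v \in f -> arc (parabola_chord f) (parabola_point v).
Proof.
move=> fe; rewrite {1}(ends fe).1 !inE => /orP[]/eqP->; [exists 0|exists 1].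
- by rewrite /= in_itv /= lexx ler01.
- by rewrite /parabola_chord /chord !mul0r !addr0.
- by rewrite /= in_itv /= lexx ler01.
- by rewrite /parabola_chord /chord !mul1r !subrKC.
Qed.

Lemma parabola_interior f p v : f \in edges e -> v \in f ->
  arc_interior (parabola_chord f) p -> p != parabola_point v.
Proof.
move=> fe vf /(chord_interior (X_neq fe))[_]; rewrite /chord_side => h; apply: contraTneq h => ->.
by move: vf; rewrite {1}(ends fe).1 !inE /= => /orP[]/eqP->; rewrite subrr ?mul0r ?mulr0 ltxx.
Qed.

Lemma arc_interiorW f p : arc_interior (parabola_chord f) p -> arc (parabola_chord f) p.
Proof. by move=> [t t01 <-]; exists t => //; apply: subset_itv_oo_cc. Qed.

Lemma parabola_disjoint f g p : f \in edges e -> g \in edges e -> f != g ->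
  arc_interior (parabola_chord f) p -> arc (parabola_chord g) p -> [disjoint f & g]%B.
Proof.
move=> fe ge fg pf pg; rewrite disjoint_subset; apply/fintype.subsetP => v vf; rewrite !inE.
apply/negP => vg; have := parabola_interior fe vf pf; rewrite -[_ != _]/(~~ _).
by rewrite (chords_once fe ge fg (arc_interiorW pf) pg (parabola_ends fe vf) (parabola_ends ge vg)) eqxx.
Qed.

Let mem_ends f : f \in edges e -> l f \in f /\ r f \in f.
Proof. by move=> fe; rewrite {2 4}(ends fe).1 !inE !eqxx orbT. Qed.

Let disjoint_ends f g : f \in edges e -> g \in edges e -> [disjoint f & g]%B ->
  [&& l f != l g, l f != r g, r f != l g & r f != r g].
Proof.
move=> fe ge dfg; have [lf rf] := mem_ends fe; have [lg rg] := mem_ends ge.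
have ne u v : u \in f -> v \in g -> u != v.
  by move=> uf vg; apply: contraTneq vg => <-; rewrite (disjointFr dfg).
by rewrite !ne.
Qed.

Lemma parabola_not_triple f g k p : f \in edges e -> g \in edges e -> k \in edges e ->
  f != g -> g != k -> f != k ->
  ~ [/\ arc_interior (parabola_chord f) p, arc_interior (parabola_chord g) p
      & arc_interior (parabola_chord k) p].
Proof.
move=> fe ge ke fg gk fk [pf pg pk].
have dfg := parabola_disjoint fe ge fg pf (arc_interiorW pg).
have dgk := parabola_disjoint ge ke gk pg (arc_interiorW pk).
have dfk := parabola_disjoint fe ke fk pf (arc_interiorW pk).
have lf := arc_line fe (arc_interiorW pf); have lg := arc_line ge (arc_interiorW pg).
have lk := arc_line ke (arc_interiorW pk).
have := lines_concurrence lf lg lk.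
have -> : concurrence (X (l f)) (X (r f)) (X (l g)) (X (r g)) (X (l k)) (X (r k)) =
    (concurrence (spread (rk (l f))) (spread (rk (r f))) (spread (rk (l g))) (spread (rk (r g)))
       (spread (rk (l k))) (spread (rk (r k))))%:~R.
  by rewrite /concurrence /X !(rmorphB, rmorphD, rmorphM).
move/eqP; rewrite intr_eq0; apply/negP/spread_concurrence.
have -> : [:: rk (l f); rk (r f); rk (l g); rk (r g); rk (l k); rk (r k)] =
   map rk [:: l f; r f; l g; r g; l k; r k] by [].
rewrite map_inj_uniq; last by move=> u v rkuv; apply: X_inj; rewrite /X rkuv.
have /and4P[h1 h2 h3 h4] := disjoint_ends fe ge dfg; have /and4P[h5 h6 h7 h8] := disjoint_ends fe ke dfk.
have /and4P[h9 h10 h11 h12] := disjoint_ends ge ke dgk.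
by rewrite /= !inE !negb_or h1 h2 h3 h4 h5 h6 h7 h8 h9 h10 h11 h12 (ends fe).2 (ends ge).2 (ends ke).2.
Qed.

Lemma parabola_inj : injective parabola_point.
Proof. by move=> u v [/X_inj]. Qed.

Lemma parabola_finite f g : f \in edges e -> g \in edges e -> f != g ->
  finite_set (arc (parabola_chord f) `&` arc (parabola_chord g)).
Proof.
move=> fe ge fg; have [[p [pf pg]]|no] := pselect (exists p, (arc (parabola_chord f) `&` arc (parabola_chord g)) p).
  apply: (@sub_finite_set _ _ [set p]); last exact: finite_set1.
  by move=> q [qf qg]; rewrite /= (chords_once fe ge fg qf qg pf pg).
by apply: (@sub_finite_set _ _ set0) => // q hq; apply: no; exists q.
Qed.

Lemma parabola_not_tangent f g : f \in edges e -> g \in edges e -> f != g ->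
  forall p, ~ tangent_at (parabola_chord f) (parabola_chord g) p.
Proof.
move=> fe ge fg p [pf pg]; apply; apply: chords_cross_at => //; try exact: X_neq.
exact: slopes_neq (line_neq fe ge fg) (arc_line fe (arc_interiorW pf)) (arc_line ge (arc_interiorW pg)).
Qed.

Definition parabola_drawing : drawing R e.
Proof.
refine (@Drawing R V e parabola_point parabola_chord parabola_inj _ _ _ _ parabola_finite
  parabola_not_tangent _).
- by move=> f _; apply: continuous_subspaceT; exact: chord_continuous.
- by move=> f fe t t' _ _; apply: chord_simple; exact: X_neq.
- move=> f fe; have [fE _] := ends fe; have [lf rf] := mem_ends fe.
  have c0 : parabola_chord f 0 = parabola_point (l f) by rewrite /parabola_chord /chord !mul0r !addr0.
  have c1 : parabola_chord f 1 = parabola_point (r f) by rewrite /parabola_chord /chord !mul1r !subrKC.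
  apply/seteqP; split=> [p [->|->]|p [v vf <-]].
  + by exists (l f).
  + by exists (r f).
  + by move: vf; rewrite /= {1}fE !inE => /orP[]/eqP->; [left|right].
- by move=> f fe v; apply: parabola_avoids.
- by move=> f g k fe ge ke fg gk fk p; apply: parabola_not_triple.
Defined.

Let a (f : edge e) := l (val f).
Let b (f : edge e) := r (val f).

Let betweenE (f : edge e) u : a f != u -> b f != u ->
  between a b s f u = ((X u - X (a f)) * (X u - X (b f)) < 0).
Proof.
move=> fa fb; rewrite /between -!/(rk _).
have na v : v != u -> rk v != rk u by apply: contra => /eqP h; apply/eqP/X_inj; rewrite /X h.
have sub v : v != u -> (X u - X v < 0) = (rk u < rk v)%N /\ (0 < X u - X v) = (rk v < rk u)%N.
  by move=> _; rewrite subr_lt0 subr_gt0 !X_lt.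
have [na1 na2] := (na _ fa, na _ fb).
case: (ltngtP (rk (a f)) (rk u)) (na1) => // h1 _; case: (ltngtP (rk (b f)) (rk u)) (na2) => // h2 _.
- have -> : ((X u - X (a f)) * (X u - X (b f)) < 0) = false.
    by apply/negbTE; rewrite -leNgt mulr_ge0 // subr_ge0 ltW // X_lt.
  by clear -h1 h2; lia.
- by rewrite pmulr_rlt0 ?subr_gt0 ?X_lt // subr_lt0 X_lt h2; clear -h1 h2; lia.
- by rewrite nmulr_rlt0 ?subr_lt0 ?X_lt // subr_gt0 X_lt h2; clear -h1 h2; lia.
- have -> : ((X u - X (a f)) * (X u - X (b f)) < 0) = false.
    by apply/negbTE; rewrite -leNgt mulr_le0 // subr_le0 ltW // X_lt.
  by clear -h1 h2; lia.
Qed.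

Lemma parabola_crosses (f g : edge e) p : [disjoint val f & val g]%B ->
  arc (parabola_chord (val f)) p -> arc (parabola_chord (val g)) p -> crosses a b s f g.
Proof.
move=> dfg pf pg; have fe := valP f; have ge := valP g.
have /and4P[h1 h2 h3 h4] := disjoint_ends fe ge dfg.
rewrite /crosses h1 h2 h3 h4 /= !betweenE //.
have [lf _] := (chordP p (X_neq fe)).1 pf; have [lg sg] := (chordP p (X_neq ge)).1 pg.
by apply: (chords_interleave _ _ _ _ _ lf lg sg); rewrite ?X_neq // neqX eq_sym.
Qed.

Lemma card_fset_set_le (T : choiceType) (A : set T) (t : seq T) : finite_set A ->
  A `<=` [set` t] -> (#|` fset_set A| <= size t)%N.
Proof.
move=> fA At; apply: (uniq_leq_size (fset_uniq _)) => x.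
by rewrite in_fset_set // inE => /At.
Qed.

(** Common ends are simply counted as possible crossing points, which spares a topological argument
    at the vertices; there are no more of them than vertices of positive degree. *)
Lemma cr_le_crossings : symmetric e ->
  (cr R V e <= #|[set v | 0 < degree e v]%SET| + crossing_count a b s [set: edge e]%SET)%N.
Proof.
move=> e_sym; pose D := parabola_drawing; pose C : set nat := [set #|` fset_set (crossing_points D)| | D in [set: drawing R e]].
have [_ /(_ #|` fset_set (crossing_points D)|) h] := @natminP C (ex_intro _ _ (ex_intro2 _ _ D I erefl)).
apply: leq_trans (h _) _; first by exists D.
pose K := [set u : edge e * edge e | crosses a b s u.1 u.2]%SET.
(* Two distinct chords have at most one common point. The default value for disjoint chords could
   only lengthen the list. *)
pose q (u : edge e * edge e) := xget (0, 0) (arc (parabola_chord (val u.1)) `&` arc (parabola_chord (val u.2))).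
have -> : crossing_count a b s [set: edge e]%SET = #|K|.
  rewrite /crossing_count pair_big_dep /= -sum1dep_card big_mkcond [RHS]big_mkcond.
  by apply: eq_bigr => -[f g] _; rewrite /= !finset.in_setT; case: crosses.
pose t := [seq parabola_point v | v <- enum [set v | (0 < degree e v)%N]%SET] ++ map q (enum K).
apply: (@leq_trans (size t)); last by rewrite size_cat !size_map -!cardE.
apply: card_fset_set_le; first exact: finite_crossing_points.
move=> p [f [g [fe ge fg /cross_at_arcs[pf pg]]]]; rewrite /= /t mem_cat.
have [dfg|] := boolP [disjoint f & g]%B; last first.
  rewrite disjoint_subset => /subsetPn[v vf]; rewrite !inE negbK => vg.
  apply/orP; left; apply/mapP; exists v; last exact: (chords_once fe ge fg pf pg (parabola_ends fe vf) (parabola_ends ge vg)).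
  rewrite mem_enum inE card_gt0; apply/set0Pn.
  have /edgesP[x [y [xy fE]]] := fe; move: vf; rewrite fE !inE => /orP[]/eqP->; [exists y|exists x].
    by rewrite inE.
  by rewrite inE e_sym.
apply/orP; right; pose f' : edge e := Sub f fe; pose g' : edge e := Sub g ge.
apply/mapP; exists (f', g').
  by rewrite mem_enum finset.in_set; exact: (@parabola_crosses f' g' p dfg pf pg).
rewrite /q; case: xgetP => [p' _ [pf' pg']|no]; first exact: (chords_once fe ge fg).
by case: (no p).
Qed.

End StraightLine.

(** * From weights to crossing numbers *)

Section CrossingNumber.
Variables (R : realType) (V : finType) (e : rel V).
Hypotheses (e_sym : symmetric e) (e_irr : irreflexive e) (n2 : (2 <= #|V|)%N).

Lemma exists_ends : exists l r : {set V} -> V,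
  forall f, f \in edges e -> f = [set l f; r f]%SET /\ l f != r f.
Proof.
have [v0 _] : exists v : V, v \in predT by apply/card_gt0P; apply: leq_trans n2.
have h (f : {set V}) : exists u : V * V, f \in edges e -> f = [set u.1; u.2]%SET /\ u.1 != u.2.
  have [/edgesP[x [y [xy fE]]]|_] := boolP (f \in edges e); last by exists (v0, v0).
  by exists (x, y) => _; split=> //; apply: contraTneq xy => /= ->; rewrite e_irr.
have [u hu] := choice h.
by exists (fun f => (u f).1), (fun f => (u f).2).
Qed.

(** The straight-line drawing shows that drawings exist, so the minimum is attained and is not the
    junk value. *)
Lemma exists_optimal_drawing : exists D : drawing R e, #|crossing_pairs D| = pcr R V e.
Proof.
have [l [r ends]] := exists_ends.
have D0 : drawing R e := @parabola_drawing R V e l r (enum V) ends (mem_enum V).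
pose C : set nat := [set #|crossing_pairs D| | D in [set: drawing R e]].
by have [[D _ DE] _] := @natminP C (ex_intro _ _ (ex_intro2 _ _ D0 I erefl)); exists D.
Qed.

Lemma cr_le_vol C (D : drawing R e) :
  (forall F : {set edge e}, F != finset.set0 -> exists X Z, sparse_cut (entangled D) C F X Z) ->
  (cr R V e <= #|[set v | 0 < degree e v]%SET| +
     9 * C * log_weight (vol (nbrs (entangled D)) [set: edge e]%SET))%N.
Proof.
move=> cuts; have [l [r ends]] := exists_ends.
pose a (f : edge e) := l (val f); pose b (f : edge e) := r (val f).
have fE (f : edge e) : val f = [set a f; b f]%SET := (ends _ (valP f)).1.
have A_end (f g : edge e) : [|| a f == a g, a f == b g, b f == a g | b f == b g] -> entangled D f g.
  move=> h; apply/or3P; apply: Or32; rewrite disjoint_subset; apply/fintype.subsetPn.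
  case/or4P: h => /eqP h; [exists (a f)|exists (a f)|exists (b f)|exists (b f)];
    by rewrite ?inE ?negbK fE ?inE ?h eqxx ?orbT.
have [s [us endsF _ _ cs]] := exists_order R A_end cuts (leqnn #|[set: edge e]%SET|).
(* Isolated vertices are missing from [s]; appending them at the end changes no betweenness. *)
pose s' := s ++ [seq v <- enum V | v \notin s].
have all_s' v : v \in s' by rewrite mem_cat mem_filter mem_enum andbT; case: (v \in s).
apply: leq_trans (cr_le_crossings R ends all_s' e_sym) _; rewrite leq_add2l.
apply: leq_trans cs; apply/eq_leq; apply: eq_bigr => f _; apply: eq_bigr => g _.
have [af bf] := endsF f (finset.in_setT f).
by rewrite /crosses !between_catl.
Qed.

Lemma log2_ge1 : 1 <= log2 (#|V|%:R : R).
Proof.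
have ln2 : 0 < ln (2 : R) by rewrite ln_gt0 // ltr1n.
rewrite /log2 ler_pdivlMr // mul1r ler_ln ?posrE ?ltr0n ?ler_nat //; exact: leq_trans n2.
Qed.

Lemma trunc_log_le_log2 w k : (w <= #|V| ^ k)%N -> (trunc_log 2 w)%:R <= k%:R * log2 (#|V|%:R : R).
Proof.
have ln2 : 0 < ln (2 : R) by rewrite ln_gt0 // ltr1n.
have n0 : (0 < #|V|)%N by apply: leq_trans n2.
move=> wk; rewrite /log2 mulrA ler_pdivlMr // !mulr_natl -!lnXn ?ltr0n //.
rewrite ler_ln ?posrE ?exprn_gt0 ?ltr0n // -!natrX ler_nat.
case: w wk => [|w] wk; first by rewrite trunc_log0 expn0 expn_gt0 n0.
exact: leq_trans (trunc_logP _ _) wk.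
Qed.

Lemma card_edge : (#|{: edge e}| <= #|V| ^ 2)%N.
Proof.
rewrite card_sig -mulnn -card_prod; apply: leq_trans (leq_imset_card (fun u : V * V => [set u.1; u.2]%SET) predT).
apply/subset_leq_card/fintype.subsetP => f /edgesP[x [y [_ ->]]].
by apply/imsetP; exists (x, y).
Qed.

Lemma vol_le (D : drawing R e) : (vol (nbrs (entangled D)) [set: edge e]%SET <= #|V| ^ 4)%N.
Proof.
apply: (@leq_trans (\sum_(f in [set: edge e]%SET) #|V| ^ 2)).
  by apply: leq_sum => f _; apply: leq_trans (max_card _) card_edge.
by rewrite sum_nat_const cardsT -[4%N]/(2 + 2)%N expnD leq_mul2r card_edge orbT.
Qed.

End CrossingNumber.

(** [t + 1 <= 5 * L] and [s + 2 * p <= 2 * (p + s)] give [9 * 5 * 2 = 90]; the remaining [+ 1]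
    absorbs the first [s]. *)
Lemma log_bound (R : realFieldType) (c w t L p s : R) : 0 <= c -> 0 <= w -> 0 <= t -> 0 <= p -> 0 <= s ->
  1 <= L -> t <= 4 * L -> w <= s + 2 * p ->
  s + 9 * c * (w * (t + 1)) <= (90 * c + 1) * L * (p + s).
Proof.
move=> c0 w0 t0 p0 s0 L1 tL ws.
have wt : w * (t + 1) <= (s + 2 * p) * (5 * L) by apply: ler_pM => //; lra.
have sL : s + p <= L * (p + s) by rewrite [s + p]addrC ler_peMl // addr_ge0.
have pL : 0 <= L * s by rewrite mulr_ge0 //; lra.
have : 9 * c * (w * (t + 1)) <= 9 * c * (10 * (L * (p + s))).
  by apply: ler_wpM2l; [lra|apply: le_trans wt _; lra].
by lra.
Qed.

Theorem theorem5 (R : realType) :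
  exists c : R, 0 < c /\
    forall (V : finType) (e : rel V),
      symmetric e -> irreflexive e -> (2 <= #|V|)%N ->
      (cr R V e)%:R <=
        c * log2 (#|V|%:R : R) *
          ((pcr R V e)%:R + \sum_(v : V) (degree e v)%:R ^+ 2).
Proof.
have [C cuts] := exists_sparse_cut; exists (90 * C + 1)%:R; split; first by rewrite ltr0n addn1.
move=> V e e_sym e_irr n2; have [D Dpcr] := exists_optimal_drawing R e_irr n2.
have K33 : K33_crossing (entangled D) := @entangled_K33 R V e D.
have := cr_le_vol e_sym e_irr n2 (cuts _ _ (@entangled_refl R V e D) (@entangled_sym R V e D) K33).
have := vol_le D; have := vol_entangled D e_sym; rewrite Dpcr.
rewrite /log_weight; move: (vol _ _) => w wS w4 crS.
have L1 := log2_ge1 R n2; have T4 := trunc_log_le_log2 R n2 w4.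
set S := (\sum_(v : V) degree e v ^ 2)%N in wS.
have SE : \sum_(v : V) (degree e v)%:R ^+ 2 = S%:R :> R.
  by rewrite /S natr_sum; apply: eq_bigr => v _; rewrite natrX.
rewrite SE.
have noniso : (#|[set v | 0 < degree e v]%SET| <= S)%N.
  rewrite -sum1dep_card big_mkcond /S; apply: leq_sum => v _; case: ifP => // h; by rewrite expn_gt0 h.
have {}crS : (cr R V e <= S + 9 * C * (w * (trunc_log 2 w).+1))%N by apply: leq_trans crS _; rewrite leq_add2r.
rewrite -(ler_nat R) in crS; rewrite -(ler_nat R) in wS.
rewrite natrD (natrM _ (9 * C)) (natrM _ 9) (natrM _ w) -[(trunc_log 2 w).+1%:R]natr1 in crS.
rewrite natrD natrM in wS.
by rewrite natrD natrM; apply: le_trans crS _; apply: log_bound.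
Qed.
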